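(* Let $\tilde F_k$ ($k\ge1$) be the (re-indexed) even-indexed stable cluster variables of the framed $F_0$ quiver with mutation sequence $(0,1,2,3,0,1,2,3,\ldots)$, and let $AD^{(4)}_\infty$ be the infinite 4-color Aztec diamond pyramid, with $x_1,x_2,h_1,h_2,R_1,R_2$ the statistics of simple partitions (all as defined in the context). Then $$\lim_{k\to\infty}\tilde F_k=\sum_{P\text{ a simple partition of }AD^{(4)}_\infty} y_0^{\,x_2(P)+h_2(P)+\#R_2(P)}\;y_1^{\,x_1(P)+h_1(P)+\#R_1(P)}\;y_2^{\,x_2(P)+h_2(P)}\;y_3^{\,x_1(P)+h_1(P)},$$ the limit being taken coefficientwise as formal power series in $y_0,y_1,y_2,y_3$.
   Context: Quiver mutation. A quiver is a finite directed graph, possibly with multiple edges, without self-loops or 2-cycles; each vertex $v$ carries a label $\ell_v$. Mutation at $v$: (1) replace the label $\ell_v$ by $\bigl(\prod_{\text{arrows } u\to v}\ell_u+\prod_{\text{arrows } v\to u}\ell_u\bigr)/\ell_v$ (products over arrows with multiplicity, using the arrows before mutation); (2) for every 2-path $u\to v\to w$ add an arrow $u\to w$; (3) delete newly created self-loops and cancel newly created 2-cycles in pairs; (4) reverse all arrows incident to $v$. Framed $F_0$ quiver: vertices $0,1,2,3$ and frozen vertices $0',1',2',3'$ (never mutated); arrows: two arrows each $2\to 0$, $1\to 2$, $3\to 1$, $0\to 3$, and one arrow $i\to i'$ for each $i$. Initial labels: $1$ at each $i$, $y_i$ at each $i'$. Mutate successively at $0,1,2,3,0,1,2,3,\ldots$.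 Let $G_n$ be the new label produced at the $n$-th mutation, and $D_n$ the $4\times 4$ matrix whose $(i,j)$ entry is the number of arrows $i'\to j$ after $n$ mutations (negative if the arrows point $j\to i'$). Only even indices are considered, re-indexed: $F_k:=G_{2k}$, $C_k:=D_{2k}$. $\tilde F_k$ is obtained from $F_k$ by replacing each monomial $y^{\vec a}$ by $y^{\vec b}$, $\vec b=C_k^{-1}\vec a$. Convention on parity: for odd $k$ this replaces $y_0^{a_0}y_1^{a_1}y_2^{a_2}y_3^{a_3}$ by $$y_0^{ka_0-(k+1)a_2}\;y_1^{ka_1-(k+1)a_3}\;y_2^{(k-1)a_0-ka_2}\;y_3^{(k-1)a_1-ka_3},$$ while for even $k$ the result is the same after interchanging $y_0\leftrightarrow y_2$ and $y_1\leftrightarrow y_3$; to remove this alternation, the displayed form is used for all $k\ge1$. Infinite 4-color Aztec diamond pyramid $AD^{(4)}_\infty$: it consists of layers $j=1,2,3,\ldots$ (from the top), layer $j$ consisting of $j$ rows $(j,r)$, $1\le r\le j$. Each row has upper stones and lower stones: a left part with upper stones $w_{j,r,c}$ and lower stones $b_{j,r,c}$ ($c\ge1$, counted from the left end inward), and a right part with upper stones $w'_{j,r,c}$ and lower stones $b'_{j,r,c}$ ($c\ge1$, counted from the right end inward). Colors: for $j$ odd, upper stones are white and lower stones are black (black/white rows); for $j$ even, upper stones are yellow and lower stones are blue (blue/yellow rows). Within a row, $b_{j,r,c}$ lies beneath $w_{j,r,c}$ and $w_{j,r,c+1}$, and $b'_{j,r,c}$ lies beneath $w'_{j,r,c}$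 and $w'_{j,r,c+1}$. Between layers, $w_{j+1,r,c}$ lies beneath those of $b_{j,r-1,c}$, $b_{j,r,c}$ that exist (row index in $\{1,\dots,j\}$), and likewise for the primed stones. The left-to-right order of the upper stones in a row is $w_{j,r,1},w_{j,r,2},\ldots,\ldots,w'_{j,r,2},w'_{j,r,1}$. A partition of $AD^{(4)}_\infty$ is a configuration obtained by removing stones such that whenever a stone is removed every stone lying on top of it is removed, and in each row either no stone is removed, or infinitely many are removed so that only finitely many stones of the row remain. A row is altered if at least one of its stones is removed; only partitions with finitely many altered rows are considered, so that exponents are finite. A partition is simple if in each row either no stones are removed, or the removed upper stones form one consecutive block and no exposed lower stone remains (a lower stone is exposed if all upper stones of its row lying on top of it have been removed). The partition removing no stones is simple. The height of a row is $h((j,r))=j-1$. For a simple partition $P$, $R_1=R_1(P)$ is the set of altered black/white rows and $R_2=R_2(P)$ the set of altered blue/yellow rows; $h_i=\sum_{r\in R_i}h(r)$ for $i=1,2$; $x_1=\sum_{r\in R_1}(\#\text{ non-removed white stones in }r)$ (equivalently with black stones); $x_2=\sum_{r\in R_2}(\#\text{ non-removed yellow stones in }r)$ (equivalently with blue stones). *)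

(* Defs.v *)
From HB Require Import structures.
From mathcomp Require Import all_boot all_order all_algebra fraction.
From mathcomp Require Import finmap mpoly.
From mathcomp Require Import boolp classical_sets functions cardinality.
From mathcomp Require Import zify.

Set Implicit Arguments.
Unset Strict Implicit.
Unset Printing Implicit Defensive.

Import Order.TTheory GRing.Theory Num.Theory.

Local Open Scope classical_set_scope.
Local Open Scope ring_scope.

(** * Mutation of labelled quivers *)

(* [arrows Q u v] is the number of arrows u -> v. *)
Record quiver (V : finType) (K : fieldType) :=
  Quiver { arrows : V -> V -> nat; label : V -> K }.

Section Mutation.
Variables (V : finType) (K : fieldType).
Implicit Types (Q : quiver V K) (u v w : V).

Definition mutate_label Q v u : K :=
  if u == v then
    (\prod_(x : V) label Q x ^+ arrows Q x v
     + \prod_(x : V) label Q x ^+ arrows Q v x) / label Q v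
  else label Q u.

Definition add_2paths v (a : V -> V -> nat) u w : nat :=
  (a u w + a u v * a v w)%N.

(* The subtraction is truncated: of m arrows u -> w and n arrows w -> u,
   only m - n arrows u -> w (or n - m arrows w -> u) survive. *)
Definition cancel_cycles (a : V -> V -> nat) u w : nat :=
  if u == w then 0%N else (a u w - a w u)%N.

Definition reverse_at v (a : V -> V -> nat) u w : nat :=
  if (u == v) || (w == v) then a w u else a u w.

Definition mutate Q v : quiver V K :=
  Quiver (reverse_at v (cancel_cycles (add_2paths v (arrows Q))))
         (mutate_label Q v).

End Mutation.

(** * The framed F_0 quiver *)

(* [inl i] is the mutable vertex i, [inr i] the frozen vertex i'. *)
Definition vertex : finType := ('I_4 + 'I_4)%type.

Definition labels : fieldType := {fraction {mpoly int[4]}}.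

Definition F0_arrows (u v : vertex) : nat :=
  match u, v with
  | inl i, inl j =>
      if (nat_of_ord i, nat_of_ord j) \in [:: (2, 0); (1, 2); (3, 1); (0, 3)]%N
      then 2%N else 0%N
  | inl i, inr j => nat_of_bool (i == j)
  | inr _, _ => 0%N
  end.

Definition F0_labels (u : vertex) : labels :=
  match u with
  | inl _ => 1
  | inr i => tofrac ('X_i : {mpoly int[4]})
  end.

(* The vertex mutated at step n.+1, steps being counted from 1. *)
Definition mutation_vertex (n : nat) : vertex := inl (inord (n %% 4)).

Fixpoint F0_quiver (n : nat) : quiver vertex labels :=
  if n is m.+1 then mutate (F0_quiver m) (mutation_vertex m)
  else Quiver F0_arrows F0_labels.

(* G_n, meaningful for n >= 1. *)
Definition new_label (n : nat) : labels :=
  label (F0_quiver n) (mutation_vertex n.-1).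

(* D_n *)
Definition frozen_arrows (n : nat) : 'M[int]_4 :=
  \matrix_(i, j) ((arrows (F0_quiver n) (inr i) (inl j))%:Z
                  - (arrows (F0_quiver n) (inl j) (inr i))%:Z).

(* F_k *)
Definition cluster_var (k : nat) : labels := new_label k.*2.

(* C_k *)
Definition Cmatrix (k : nat) : 'M[int]_4 := frozen_arrows k.*2.

(** * Stable cluster variables *)

(* The interchange y_0 <-> y_2, y_1 <-> y_3 on exponent vectors. *)
Definition swap_exp (b : 'cV[int]_4) : 'cV[int]_4 :=
  \col_(i < 4) b (inord ((i + 2) %% 4)) 0.

(* The exponent vector replacing a: it is C_k^-1 a for odd k; for even k the
   alternation of the variables is removed.  The resulting closed form, the
   same for all k, is proved in [stable_expE] below. *)
Definition stable_exp (k : nat) (a : 'cV[int]_4) : 'cV[int]_4 :=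
  let b := invmx (Cmatrix k) *m a in if odd k then b else swap_exp b.

Section ClosedForm.
Local Open Scope nat_scope.

(* The arrows between mutable vertices are periodic, with period 4. *)
Let mutable_arrows (r i j : nat) : nat :=
  let s := nth [::] [:: [:: (2, 0, 2); (1, 2, 2); (3, 1, 2); (0, 3, 2)];
                        [:: (0, 2, 2); (1, 2, 2); (2, 3, 4); (3, 0, 2); (3, 1, 2)];
                        [:: (0, 2, 2); (1, 3, 2); (2, 1, 2); (3, 0, 2)];
                        [:: (0, 1, 4); (1, 2, 2); (1, 3, 2); (2, 0, 2); (3, 0, 2)]] r in
  sumn [seq t.2 | t <- s & t.1 == (i, j)].

Let block (odd : bool) (m i j : nat) : nat * nat :=
  match i, j with
  | 0, 0 => if odd then (m.+1, 0) else (0, m.+1)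
  | 0, 1 => if odd then (0, m.+2) else (m, 0)
  | 1, 0 => if odd then (m, 0) else (0, m)
  | _, _ => if odd then (0, m.+1) else (m, 1)
  end.

(* After 4 m + r steps, with (p, q) the returned pair, there are p - q arrows
   i' -> j and q - p arrows j -> i' (truncated subtractions). *)
Let frozen (r m i j : nat) : nat * nat :=
  if odd i != odd j then (0, 0) else
  if odd i then block (1 < r) m.*2 i./2 j./2
  else if r == 3 then block false m.*2.+2 i./2 j./2
  else block (0 < r) m.*2 i./2 j./2.

Let agree (r m : nat) (a : vertex -> vertex -> nat) :=
  forall i j : 'I_4,
  [/\ a (inl i) (inl j) = mutable_arrows r i j,
      a (inr i) (inl j) = (frozen r m i j).1 - (frozen r m i j).2
    & a (inl j) (inr i) = (frozen r m i j).2 - (frozen r m i j).1].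

Let mutate_step r (lt_r : r < 4) m (Q : quiver vertex labels) :
  agree r m (arrows Q) ->
  agree (r.+1 %% 4) (m + (r == 3)) (arrows (mutate Q (inl (Ordinal lt_r)))).
Proof.
move=> HQ i j; rewrite /mutate /= /reverse_at /cancel_cycles /add_2paths.
have H1 k l : arrows Q (inl k) (inl l) = mutable_arrows r k l by case: (HQ k l).
have H2 k l : arrows Q (inr k) (inl l) =
   (frozen r m k l).1 - (frozen r m k l).2 by case: (HQ k l).
have H3 k l : arrows Q (inl l) (inr k) =
   (frozen r m k l).2 - (frozen r m k l).1 by case: (HQ k l).
rewrite !(H1, H2, H3) {HQ H1 H2 H3}.
have E (x y : 'I_4) : (inl x == inl y :> vertex) = (nat_of_ord x == y) by [].
have E1 (x y : 'I_4) : (inr x == inl y :> vertex) = false by [].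
have E2 (x y : 'I_4) : (inl x == inr y :> vertex) = false by [].
rewrite !(E, E1, E2) {E E1 E2} /=.
case: i => [[|[|[|[|i]]]] // ?]; case: j => [[|[|[|[|j]]]] // ?];
  case: r lt_r => [|[|[|[|r]]]] // ?;
  rewrite /frozen /mutable_arrows /=; split; rewrite /= ?addn0 ?addn1 ?doubleS; lia.
Qed.

Lemma F0_arrows_closed n : agree (n %% 4) (n %/ 4) (arrows (F0_quiver n)).
Proof.
elim: n => [i j|n IH].
  by case: i => [[|[|[|[|i]]]] // ?]; case: j => [[|[|[|[|j]]]] // ?].
have -> : n.+1 %% 4 = (n %% 4).+1 %% 4 by lia.
have -> : n.+1 %/ 4 = n %/ 4 + (n %% 4 == 3) by lia.
have lt_r : n %% 4 < 4 by rewrite ltn_mod.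
rewrite [F0_quiver _]/= /mutation_vertex.
have -> : inord (n %% 4) = Ordinal lt_r by apply: val_inj; rewrite /= inordK.
exact: mutate_step.
Qed.


Lemma CmatrixE (k : nat) (z := k%:Z) :
  Cmatrix k = (\matrix_(i, j) nth 0 (nth [::] (
    if odd k then [:: [:: z;     0;     - (z + 1); 0];
                      [:: 0;     z;     0;         - (z + 1)];
                      [:: z - 1; 0;     - z;       0];
                      [:: 0;     z - 1; 0;         - z]]
    else          [:: [:: - (z + 1); 0;         z;     0];
                      [:: 0;         - (z + 1); 0;     z];
                      [:: - z;       0;         z - 1; 0];
                      [:: 0;         - z;       0;     z - 1]]) i) j)%R.
Proof.
apply/matrixP => i j; rewrite !mxE {}/z.
case: (F0_arrows_closed k.*2 i j) => _ -> ->.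
have -> : k.*2 %% 4 = (odd k).*2 by lia.
have -> : k.*2 %/ 4 = k./2 by lia.
have := odd_double_half k; case: (odd k) => Hk; rewrite -{-1}Hk /frozen;
  case: i => [[|[|[|[|i]]]] // ?]; case: j => [[|[|[|[|j]]]] // ?] /=; lia.
Qed.

End ClosedForm.

(* Acting on exponent vectors, this replaces y^a by
   y_0^(k a_0 - (k+1) a_2) y_1^(k a_1 - (k+1) a_3)
   y_2^((k-1) a_0 - k a_2) y_3^((k-1) a_1 - k a_3). *)
Definition stable_mx (k : int) : 'M[int]_4 :=
  \matrix_(i, j)
    nth 0 (nth [::] [:: [:: k;     0;     - (k + 1); 0];
                        [:: 0;     k;     0;         - (k + 1)];
                        [:: k - 1; 0;     - k;       0];
                        [:: 0;     k - 1; 0;         - k]] i) j.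

Lemma stable_expE (k : nat) (a : 'cV[int]_4) :
  stable_exp k a = stable_mx k%:Z *m a.
Proof.
have invmxE (N C : 'M[int]_4) : N *m C = 1%:M -> invmx C = N.
  move=> NC; have [_ uC] := mulmx1_unit NC.
  by rewrite -[LHS]mul1mx -NC mulmxK.
rewrite /stable_exp CmatrixE; case: (odd k).
  congr (_ *m _); apply: invmxE; apply/matrixP => i j.
  rewrite !mxE !big_ord_recl big_ord0 !mxE.
  by case: i => [[|[|[|[|i]]]] // ?]; case: j => [[|[|[|[|j]]]] // ?];
    rewrite /= ?/bump /=; lia.
pose N : 'M[int]_4 := \matrix_(i, j) stable_mx k (inord ((i + 2) %% 4)) j.
rewrite (invmxE N).
  apply/colP => i; rewrite !mxE; apply: eq_bigr => j _; rewrite mxE.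
  congr (stable_mx _ _ _ * _); apply: val_inj.
  have lt_mod n : (n %% 4 < 4)%N by rewrite ltn_mod.
  by rewrite /= !inordK // modnDml -addnA modnDr modn_small.
apply/matrixP => i j; rewrite !mxE !big_ord_recl big_ord0 !mxE inordK ?ltn_mod //.
by case: i => [[|[|[|[|i]]]] // ?]; case: j => [[|[|[|[|j]]]] // ?];
  rewrite /= ?/bump /=; lia.
Qed.

Definition mnm_col (m : 'X_{1..4}) : 'cV[int]_4 := \col_(i < 4) (m i)%:Z.

(* The coefficient of y^b in the Laurent polynomial obtained from p by
   replacing each monomial y^a with y^(stable_exp k a). *)
Definition stable_coeff (k : nat) (p : {mpoly int[4]}) (b : 'cV[int]_4) : int :=
  \sum_(m <- msupp p | stable_exp k (mnm_col m) == b) p@_m.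

(** * The infinite 4-color Aztec diamond pyramid *)

Inductive side := LeftPart | RightPart.
Inductive level := Upper | Lower.
Inductive color := White | Black | Yellow | Blue.

(* The layer, the row within the layer and the position c within the part of
   the row all start at 1, see [stones]. *)
Record stone := Stone {
  s_layer : nat; s_row : nat; s_side : side; s_level : level; s_pos : nat }.

HB.instance Definition _ := gen_eqMixin stone.
HB.instance Definition _ := gen_choiceMixin stone.

Definition row_index : Type := (nat * nat)%type.

Definition row_of (s : stone) : row_index := (s_layer s, s_row s).

Definition stones : set stone :=
  [set s | [/\ (1 <= s_row s)%N, (s_row s <= s_layer s)%N & (1 <= s_pos s)%N]].

Definition rows : set row_index :=
  [set r | (1 <= r.2)%N /\ (r.2 <= r.1)%N].

Definition row_stones (r : row_index) : set stone :=
  [set s | stones s /\ row_of s = r].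

Definition stone_color (s : stone) : color :=
  match s_level s with
  | Upper => if odd (s_layer s) then White else Yellow
  | Lower => if odd (s_layer s) then Black else Blue
  end.

(* [covers s t]: s lies directly on top of t, for stones of the same row. *)
Definition covers_in_row (s t : stone) : Prop :=
  [/\ row_of s = row_of t, s_side s = s_side t,
      s_level s = Upper, s_level t = Lower
    & s_pos s = s_pos t \/ s_pos s = (s_pos t).+1].

Definition covers_between_layers (s t : stone) : Prop :=
  [/\ s_layer t = (s_layer s).+1,
      s_row t = s_row s \/ s_row t = (s_row s).+1,
      s_side s = s_side t, s_pos s = s_pos t
    & s_level s = Lower /\ s_level t = Upper].

Definition covers (s t : stone) : Prop :=
  covers_in_row s t \/ covers_between_layers s t.

(* A configuration is represented by its set P of removed stones. *)
Definition altered (P : set stone) : set row_index := row_of @` P.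

Definition is_partition (P : set stone) : Prop :=
  [/\ P `<=` stones,
      forall s t, stones s -> covers s t -> P t -> P s,
      forall r, rows r -> row_stones r `&` P = set0 \/
        (infinite_set (row_stones r `&` P) /\ finite_set (row_stones r `\` P))
    & finite_set (altered P)].

(* The left-to-right order of the upper stones of a row. *)
Definition left_of (s t : stone) : Prop :=
  match s_side s, s_side t with
  | LeftPart, LeftPart => (s_pos s < s_pos t)%N
  | LeftPart, RightPart => True
  | RightPart, LeftPart => False
  | RightPart, RightPart => (s_pos t < s_pos s)%N
  end.

Definition upper_stones (r : row_index) : set stone :=
  [set s | row_stones r s /\ s_level s = Upper].

Definition removed_block (P : set stone) (r : row_index) : Prop :=
  forall s t u, upper_stones r s -> upper_stones r t -> upper_stones r u ->
    left_of s t -> left_of t u -> P s -> P u -> P t.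

Definition exposed (P : set stone) (t : stone) : Prop :=
  s_level t = Lower /\ forall s, stones s -> covers_in_row s t -> P s.

Definition simple_partition (P : set stone) : Prop :=
  is_partition P /\
  forall r, rows r -> row_stones r `&` P = set0 \/
    (removed_block P r /\ forall t, row_stones r t -> exposed P t -> P t).

(* The cardinality of a set, meaningful for finite sets only. *)
Definition ncard (T : choiceType) (A : set T) : nat := #|` fset_set A|%fset.

Definition altered_bw (P : set stone) : set row_index :=
  [set r | altered P r /\ odd r.1].

Definition altered_by (P : set stone) : set row_index :=
  [set r | altered P r /\ ~~ odd r.1].

Definition height (r : row_index) : nat := r.1.-1.

Definition remaining (P : set stone) (c : color) (r : row_index) : set stone :=
  [set s | [/\ row_stones r s, stone_color s = c & ~ P s]].

Definition sum_rows (A : set row_index) (f : row_index -> nat) : nat :=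
  (\sum_(r <- fset_set A) f r)%N.

Definition h1 (P : set stone) : nat := sum_rows (altered_bw P) height.
Definition h2 (P : set stone) : nat := sum_rows (altered_by P) height.

Definition x1 (P : set stone) : nat :=
  sum_rows (altered_bw P) (fun r => ncard (remaining P White r)).
Definition x2 (P : set stone) : nat :=
  sum_rows (altered_by P) (fun r => ncard (remaining P Yellow r)).

Definition weight (P : set stone) : 'cV[int]_4 :=
  \col_(i < 4) (nth 0%N [:: x2 P + h2 P + ncard (altered_by P);
                            x1 P + h1 P + ncard (altered_bw P);
                            x2 P + h2 P;
                            x1 P + h1 P]%N i)%:Z.

Definition simple_partitions_of_weight (b : 'cV[int]_4) : set (set stone) :=
  [set P | simple_partition P /\ weight P = b].

(* Main.v *)
Require Import Defs.
From HB Require Import structures.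
From mathcomp Require Import all_boot all_order all_algebra fraction.
From mathcomp Require Import finmap mpoly.
From mathcomp Require Import boolp classical_sets functions cardinality.
From mathcomp Require Import fingroup perm.
From mathcomp Require Import zify ring.

(* The labels at odd and even steps satisfy two coupled recurrences
   [A_{k+1} A_{k-1} = A_k^2 + a_k B_k^2] and [B_{k+1} B_{k-1} = B_k^2 + b_k A_k^2]
   with [a_k = y_0^{k+1} y_2^k] and [b_k = y_1^{k+1} y_3^k].  Because these
   coefficients are geometric in [k], the solutions are polynomials, and the change
   of exponents by [C_k^-1] turns them into the solutions of the same recurrences
   with the coefficients read in the opposite order.  The latter are matched, up
   to a degree growing with [k], with a family of Hankel determinants satisfying a
   Toda equation (Desnanot-Jacobi).  By Cauchy-Binet such a determinant is a sum
   over sets of sites, that is over Young diagrams, of a monomial recording the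
   boxes of the diagram divided by the product of [(1 - hook weight)^2].
   Finally, a simple partition is a Young diagram (the altered rows) with two
   reverse plane partitions (the numbers of stones left on both sides of the
   altered rows), and reverse plane partitions with given diagonal sums
   correspond to arrays on the hooks of the diagram, by toggling diagonals while
   the diagram grows box by box. *)

(** The sequences for different [k] do not extend one another: after the change of exponents the
    coefficients start in a degree growing with [k] and decrease to [y_0] and [y_1], so the limit
    cannot be followed along one recurrence. The match with the Toda equation is made for each [k]
    separately, time running along a parameter [r] from [k + 1] down to 0. For large [r] only the
    empty diagram counts up to degree [r], which gives the two initial values 1; at [r = 0] the box
    weights are those of the pyramid. The Toda equation couples the sizes [i - 1], [i], [i + 1],
    while the recurrence has only two sequences. Weights that depend on the parity of the content
    fold the sizes onto these two. A finite window of sites breaks the periodicity at its ends, so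
    the agreement is proved only on a triangle that loses one size at each end per unit of time. The
    square of the hook factors comes from a squared Vandermonde determinant; it is what produces two
    reverse plane partitions, one for each side of the pyramid. *)

Set Implicit Arguments.
Unset Strict Implicit.
Unset Printing Implicit Defensive.

Import Order.TTheory GRing.Theory Num.Theory.
Local Open Scope classical_set_scope.
Local Open Scope ring_scope.

(** * The Laurent phenomenon for coupled recurrences *)

Section Regular.
Variable R : idomainType.
Implicit Types f g h : R.

Definition divides f g := exists c, g = f * c.

(* [g] is a nonzerodivisor modulo [f]; in a factorial ring this is coprimality,
   but no factorization is needed to work with it. *)
Definition regular f g := forall h, divides f (g * h) -> divides f h.

Lemma divides_mul f h : divides f (f * h).
Proof. by exists h. Qed.

Lemma regular_mul f g h : regular f g -> regular f h -> regular f (g * h).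
Proof. by move=> fg fh x; rewrite -mulrA => /fg /fh. Qed.

Lemma regular_exp f g n : regular f g -> regular f (g ^+ n).
Proof.
move=> fg; elim: n => [|n IHn]; first by move=> h; rewrite expr0 mul1r.
by rewrite exprS; apply: regular_mul.
Qed.

Lemma regular_sym f g : f != 0 -> regular f g -> regular g f.
Proof.
move=> f0 fg h [u fhE]; have [v uE] : divides f u.
  by apply: fg; rewrite -fhE; apply: divides_mul.
by exists v; apply: (mulfI f0); rewrite fhE uE mulrCA.
Qed.

Lemma regular_factor f f' g : f' != 0 -> regular (f * f') g -> regular f g.
Proof.
move=> f'0 ffg h [u ghE].
have [v hE] : divides (f * f') (h * f').
  by apply: ffg; exists u; rewrite mulrA ghE mulrAC.
by exists v; apply: (mulIf f'0); rewrite hE mulrAC.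
Qed.

Lemma regular_congr f g g' : divides f (g - g') -> regular f g -> regular f g'.
Proof.
move=> [w gg'] fg h [u g'hE]; apply: fg; exists (u + w * h).
by rewrite mulrDr -g'hE mulrA -gg'; ring.
Qed.

End Regular.

Section Laurent.
(** [eps0] and [eps1] stand for evaluation at 0 and at 1. The value 1 at 0 keeps a polynomial prime
    to the monomials [c j] and [d j]; a positive value at 1 keeps it prime to [1 - c j * d j]. The
    coefficients are geometric only below [n], because the reversed exponents are truncated at 0. *)
Variables (R : idomainType) (eps0 eps1 : {rmorphism R -> int}).
Variables (c d : nat -> R) (n : nat).

Hypothesis eps0_c : forall j, eps0 (c j) = 0.
Hypothesis eps0_d : forall j, eps0 (d j) = 0.
Hypothesis eps1_c : forall j, eps1 (c j) = 1.
Hypothesis eps1_d : forall j, eps1 (d j) = 1.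
Hypothesis c_geom : forall j, (j.+2 < n)%N -> c j.+1 ^+ 2 = c j * c j.+2.
Hypothesis d_geom : forall j, (j.+2 < n)%N -> d j.+1 ^+ 2 = d j * d j.+2.
Hypothesis regular_c : forall f j, eps0 f = 1 -> regular f (c j).
Hypothesis regular_d : forall f j, eps0 f = 1 -> regular f (d j).
Hypothesis regular_1cd : forall f j, eps1 f != 0 -> regular (1 - c j * d j) f.

Let recurrence (A B : nat -> R) (c : nat -> R) j :=
  A j.+2 * A j = A j.+1 ^+ 2 + c j * B j.+1 ^+ 2.

Let good (A B : nat -> R) m :=
  forall j, (j <= m)%N ->
  [/\ eps0 (A j) = 1, eps0 (B j) = 1, 0 < eps1 (A j), 0 < eps1 (B j)
    & regular (A j) (B j)].

Let eps0_neq0 f : eps0 f = 1 -> f != 0.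
Proof. by move=> f1; apply: contra_eq_neq f1 => ->; rewrite rmorph0. Qed.

(** The numerator is multiplied by [A l.+1 ^+ 2 * B l.+1 ^+ 2], which is prime to [A l.+2]. Modulo
    [A l.+2] the recurrences turn the product into [B l.+2 ^+ 4] times [cc l.+1 ^+ 2 * B l.+1 ^+ 2 +
    cc l.+2 * A l.+1 ^+ 2], and the geometric law makes the last factor
    [cc l.+2 * (A l.+2 * A l)]. *)
Let step (A B cc dd : nat -> R) m :
  (forall f j, eps0 f = 1 -> regular f (cc j)) ->
  A 0%N = 1 -> A 1%N = 1 ->
  (forall j, (j < m)%N -> recurrence A B cc j /\ recurrence B A dd j) ->
  (forall j, (j.+2 < m.+1)%N -> cc j.+1 ^+ 2 = cc j * cc j.+2) ->
  good A B m.+1 -> divides (A m) (A m.+1 ^+ 2 + cc m * B m.+1 ^+ 2).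
Proof.
move=> regc A0 A1; case: m => [|[|l]] rec cg gAB.
- by rewrite A0; eexists; rewrite mul1r.
- by rewrite A1; eexists; rewrite mul1r.
have [recA _] := rec l.+1 (ltnSn _); have [_ recB] := rec l.+1 (ltnSn _).
have [recA' _] := rec l (ltnW (ltnSn _)).
have [a1 _ _ _ AB1] := gAB l.+1 (leqW (leqnSn _)).
have [a0 _ _ _ _] := gAB l (leqW (leqW (leqnSn _))).
have [a2 _ _ _ _] := gAB l.+2 (leqnSn _).
have [_ b1 _ _ _] := gAB l.+1 (leqW (leqnSn _)).
rewrite /recurrence in recA recB recA'.
have reg1 : regular (A l.+2) (A l.+1).
  apply: (@regular_factor _ _ (A l)); first exact: eps0_neq0.
  apply: regular_sym; first exact: eps0_neq0.
  rewrite recA'; apply: (@regular_congr _ _ (cc l * B l.+1 ^+ 2)).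
    by exists (- A l.+1); ring.
  by apply: regular_mul; [exact: regc | exact: regular_exp].
have reg2 : regular (A l.+2) (B l.+1).
  apply: (@regular_factor _ _ (A l)); first exact: eps0_neq0.
  apply: regular_sym; first exact: eps0_neq0.
  rewrite recA'; apply: (@regular_congr _ _ (A l.+1 ^+ 2)).
    by exists (- (cc l * B l.+1)); ring.
  by apply: regular_exp; apply: regular_sym => //; exact: eps0_neq0.
have := @regular_exp _ _ _ 2 reg1; apply; have := @regular_exp _ _ _ 2 reg2; apply.
have cg' : cc l.+1 ^+ 2 = cc l * cc l.+2 by apply: cg.
have A1E : A l.+1 ^+ 2 = A l.+2 * A l - cc l * B l.+1 ^+ 2 by rewrite recA'; ring.
set a3 := A l.+3 in recA *; set b3 := B l.+3 in recB *.
have -> : B l.+1 ^+ 2 * (A l.+1 ^+ 2 * (a3 ^+ 2 + cc l.+2 * b3 ^+ 2))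
  = B l.+1 ^+ 2 * (a3 * A l.+1) ^+ 2
    + cc l.+2 * A l.+1 ^+ 2 * (b3 * B l.+1) ^+ 2 by ring.
rewrite recA recB sqrrD.
have -> : (cc l.+1 * B l.+2 ^+ 2) ^+ 2 = cc l * cc l.+2 * B l.+2 ^+ 4.
  by rewrite exprMn cg' -exprM.
set a1' := A l.+1 in A1E *; rewrite A1E.
exists (B l.+1 ^+ 2 * (A l.+2 ^+ 3 + 2 * cc l.+1 * A l.+2 * B l.+2 ^+ 2)
  + cc l.+2 * (A l.+2 * A l - cc l * B l.+1 ^+ 2)
    * (2 * B l.+2 ^+ 2 * dd l.+1 * A l.+2 + dd l.+1 ^+ 2 * A l.+2 ^+ 3)
  + cc l.+2 * B l.+2 ^+ 4 * A l).
ring.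
Qed.

(** Modulo [A ^+ 2 + x * B ^+ 2] one has [B ^+ 2 + y * A ^+ 2 = (1 - x * y) * B ^+ 2]. This is where
    the factors [1 - c j * d j] come from. *)
Let next_regular (A B A' B' x y : R) :
  eps0 A = 1 -> eps0 B = 1 -> eps0 A' = 1 -> eps0 B' = 1 ->
  regular B A -> regular (1 - x * y) (A ^+ 2 + x * B ^+ 2) -> 1 - x * y != 0 ->
  forall A'' B'', eps0 A'' = 1 -> eps0 B'' = 1 ->
  A'' * A' = A ^+ 2 + x * B ^+ 2 -> B'' * B' = B ^+ 2 + y * A ^+ 2 ->
  regular A'' B''.
Proof.
move=> a b a' b' BA reg xy0 A'' B'' a'' b'' recA recB.
have f0 : A ^+ 2 + x * B ^+ 2 != 0.
  by rewrite -recA mulf_neq0 // eps0_neq0.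
apply: (@regular_factor _ _ A'); first exact: eps0_neq0.
apply: regular_sym; first exact: eps0_neq0.
apply: (@regular_factor _ _ B'); first exact: eps0_neq0.
apply: regular_sym; first by rewrite recA.
rewrite recA recB.
apply: (@regular_congr _ _ ((1 - x * y) * B ^+ 2)).
  by exists (- y); ring.
apply: regular_mul; first exact: regular_sym.
apply: regular_exp; apply: regular_sym; first exact: eps0_neq0.
apply: (@regular_congr _ _ (A ^+ 2)); last exact: regular_exp.
by exists (- (x * B)); ring.
Qed.

(* The Laurent phenomenon for this recurrence: modulo [A j] the numerator of
   [A j.+2] is a multiple of [A j] because [c] and [d] are geometric. *)
Theorem laurent_polynomials : exists A B : nat -> R,
  [/\ A 0%N = 1 /\ A 1%N = 1, B 0%N = 1 /\ B 1%N = 1,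
      forall j, (j < n)%N ->
        A j.+2 * A j = A j.+1 ^+ 2 + c j * B j.+1 ^+ 2
        /\ B j.+2 * B j = B j.+1 ^+ 2 + d j * A j.+1 ^+ 2
    & forall j, (j <= n.+1)%N -> eps0 (A j) = 1 /\ eps0 (B j) = 1].
Proof.
suff [A [B [A01 B01 rec AB]]] : exists A B : nat -> R,
  [/\ A 0%N = 1 /\ A 1%N = 1, B 0%N = 1 /\ B 1%N = 1,
      forall j, (j < n)%N -> recurrence A B c j /\ recurrence B A d j
    & good A B n.+1].
  by exists A, B; split=> // j /AB[].
have : (n <= n)%N by [].
elim: {-2}n => [_|m IHm lt_mn].
  exists (fun=> 1), (fun=> 1); split=> // j _; rewrite !rmorph1; split=> //.
  by move=> h; rewrite mul1r.
have [A [B [[A0 A1] [B0 B1] rec AB]]] := IHm (ltnW lt_mn).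
have [u uE] : divides (A m) (A m.+1 ^+ 2 + c m * B m.+1 ^+ 2).
  apply: (@step _ _ _ d) => // j jm; apply: c_geom; lia.
have [v vE] : divides (B m) (B m.+1 ^+ 2 + d m * A m.+1 ^+ 2).
  apply: (@step _ _ _ c) => //.
  - by move=> j /rec[].
  - by move=> j jm; apply: d_geom; lia.
  - move=> j /AB[? ? ? ? ?]; split=> //; apply: regular_sym => //; exact: eps0_neq0.
pose ext (f : nat -> R) x j := if j == m.+2 then x else f j.
have extE f x j : (j < m.+2)%N -> ext f x j = f j.
  by rewrite /ext; case: eqP => // ->; rewrite ltnn.
have extn f x : ext f x m.+2 = x by rewrite /ext eqxx.
exists (ext A u), (ext B v); split; rewrite ?extE //.
  move=> j; rewrite ltnS leq_eqVlt => /orP[/eqP->|jm].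
    by rewrite /recurrence !extn !extE // uE vE; split; rewrite mulrC.
  by rewrite /recurrence !extE ?ltnS //; [exact: rec | lia..].
move=> j; rewrite leq_eqVlt => /orP[/eqP->|jm]; last by rewrite !extE //; apply: AB.
rewrite !extn.
have [a1 b1 pa1 pb1 AB1] := AB m.+1 (leqnn _).
have [a0 b0 pa0 pb0 AB0] := AB m (leqnSn _).
have au : eps0 u = 1.
  have := congr1 eps0 uE; rewrite !(rmorphM, rmorphD, rmorphXn) /=.
  by rewrite eps0_c a1 a0 mul0r addr0 expr1n mul1r.
have bv : eps0 v = 1.
  have := congr1 eps0 vE; rewrite !(rmorphM, rmorphD, rmorphXn) /=.
  by rewrite eps0_d b1 b0 mul0r addr0 expr1n mul1r.
have pf : 0 < eps1 (A m.+1 ^+ 2 + c m * B m.+1 ^+ 2).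
  by rewrite !(rmorphM, rmorphD, rmorphXn) /= eps1_c mul1r addr_gt0 ?exprn_gt0.
have pg : 0 < eps1 (B m.+1 ^+ 2 + d m * A m.+1 ^+ 2).
  by rewrite !(rmorphM, rmorphD, rmorphXn) /= eps1_d mul1r addr_gt0 ?exprn_gt0.
split=> //.
- by move: pf; rewrite uE rmorphM pmulr_rgt0.
- by move: pg; rewrite vE rmorphM pmulr_rgt0.
have reg1 : regular (1 - c m * d m) (A m.+1 ^+ 2 + c m * B m.+1 ^+ 2).
  by apply: regular_1cd; apply: lt0r_neq0.
have BA : regular (B m.+1) (A m.+1) by apply: regular_sym => //; apply: eps0_neq0.
apply: (next_regular a1 b1 a0 b0 BA reg1) => //.
- by apply: eps0_neq0; rewrite rmorphB rmorphM rmorph1 /= eps0_c mul0r subr0.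
- by rewrite mulrC uE.
- by rewrite mulrC vE.
Qed.

End Laurent.

(** * Regular elements in polynomial rings over the integers *)

Section RegularMpoly.
Variable n : nat.
Local Notation P := {mpoly int[n]}.

Lemma mpoly_ring_ind (Q : P -> Prop) :
  (forall c, Q c%:MP) -> (forall i, Q 'X_i) ->
  (forall p q, Q p -> Q q -> Q (p + q)) ->
  (forall p q, Q p -> Q q -> Q (p * q)) -> forall p, Q p.
Proof.
move=> QC QX QD QM; elim/mpolyind => [|c m p _ _ Qp].
  by rewrite -[0]/(0%:MP); apply: QC.
apply: (QD) => //; rewrite -mul_mpolyC mpolyXE_id; apply: (QM) => //.
apply: (big_ind Q) => [||i _]; [exact: (QC 1) | exact: QM |].
by elim: (m i) => [|k IHk]; [exact: (QC 1) | rewrite exprS; apply: QM].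
Qed.

Lemma mpolyX_neq0 m : 'X_[m] != 0 :> P.
Proof. by rewrite -msupp_eq0 msuppX. Qed.

Lemma mpoly_morphism (S : comNzRingType) (h : 'I_n -> S) :
  exists psi : {rmorphism P -> S}, forall i, psi 'X_i = h i.
Proof.
by exists (mmap intr h : {rmorphism P -> S}) => i /=; rewrite mmapX mmap1U.
Qed.

Lemma rmorph_mpolyC (S : comNzRingType) (psi : {rmorphism P -> S}) c :
  psi c%:MP = c%:~R.
Proof. by rewrite -[c in LHS]intz -(rmorph_int psi) -(rmorph_int (@mpolyC n int)). Qed.

Lemma rmorph_mpolyX (S : comNzRingType) (psi : {rmorphism P -> S}) m :
  psi 'X_[m] = \prod_(i < n) psi 'X_i ^+ m i.
Proof.
by rewrite mpolyXE_id rmorph_prod; apply: eq_bigr => i _; rewrite rmorphXn.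
Qed.

(** Setting ['X_i] to 0 is a morphism to an integral domain whose kernel consists of the multiples
    of ['X_i]. The constant term of [f] keeps it out of this kernel. *)
Lemma regular_X (f : P) i : meval (fun=> 0) f = 1 -> regular f 'X_i.
Proof.
move=> f1.
apply: regular_sym; [exact: mpolyX_neq0 | move=> h [u fhE]].
have [psi psiX] := mpoly_morphism (fun j => if j == i then 0 else 'X_j : P).
have dvd_psi p : divides 'X_i (p - psi p).
  elim/mpoly_ring_ind: p => [c|j|p q [x xE] [y yE]|p q [x xE] [y yE]].
  - exists 0; rewrite mulr0 rmorph_mpolyC -(rmorph_int (@mpolyC n int)) intz.
    by rewrite subrr.
  - rewrite psiX; case: eqP => [->|_].
      by exists 1; rewrite mulr1 subr0.
    by exists 0; rewrite mulr0 subrr.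
  - by exists (x + y); rewrite mulrDr -xE -yE rmorphD; ring.
  - exists (x * q + psi p * y).
    transitivity ((p - psi p) * q + psi p * (q - psi q)).
      by rewrite rmorphM; ring.
    by rewrite xE yE; ring.
have : psi f * psi h = 0 by rewrite -rmorphM fhE rmorphM psiX eqxx mul0r.
move/eqP; rewrite mulf_eq0 => /orP[/eqP psif|/eqP psih].
  have [x] := dvd_psi f; rewrite psif subr0 => /(congr1 (meval (fun=> 0))).
  by rewrite f1 mevalM mevalXU mul0r => /eqP; rewrite oner_eq0.
by have := dvd_psi h; rewrite psih subr0.
Qed.

Section Quotient.
Variables (K : fieldType) (iota : {rmorphism P -> K}).
Hypothesis iota_inj : injective iota.

(* The quotient by [1 - 'X_i * w] is a subring of the fraction field, in which
   ['X_i] becomes the inverse of [w]. *)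
Lemma regular_1subX_in (i : 'I_n) (m : 'X_{1..n}) (f : P) :
  m i = 0%N -> meval (fun=> 1) f != 0 -> regular (1 - 'X_i * 'X_[m]) f.
Proof.
move=> mi f1 h [u fhE]; set w : P := 'X_[m].
have w0 : iota w != 0.
  by rewrite -(rmorph0 iota) (inj_eq iota_inj) mpolyX_neq0.
have [psi psiX] := mpoly_morphism (fun j => if j == i then (iota w)^-1 else iota 'X_j).
have psiw : psi w = iota w.
  rewrite !rmorph_mpolyX; apply: eq_bigr => j _.
  by rewrite psiX; case: eqP => // ->; rewrite mi !expr0.
(* The values of [psi] have powers of [w] as denominators; [p'] is the cleared numerator, and it is
   congruent to [w ^+ N * p]. *)
have lift p : exists N p',
    divides (1 - 'X_i * w) (w ^+ N * p - p') /\ psi p * iota w ^+ N = iota p'.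
  elim/mpoly_ring_ind: p => [c|j|p q|p q].
  - exists 0%N, c%:MP; rewrite !expr0 mul1r subrr mulr1; split.
      by exists 0; rewrite mulr0.
    by rewrite !rmorph_mpolyC.
  - case: (eqVneq j i) => [->|ji].
      exists 1%N, 1; rewrite psiX eqxx expr1 mulVf // rmorph1; split=> //.
      by exists (-1); ring.
    exists 0%N, 'X_j; rewrite psiX (negbTE ji) !expr0 mul1r mulr1 subrr; split=> //.
    by exists 0; rewrite mulr0.
  - move=> [N [p' [[x xE] pE]]] [N' [q' [[y yE] qE]]].
    exists (N + N')%N, (w ^+ N' * p' + w ^+ N * q'); split.
      exists (w ^+ N' * x + w ^+ N * y).
      transitivity (w ^+ N' * (w ^+ N * p - p') + w ^+ N * (w ^+ N' * q - q')).
        by rewrite exprD; ring.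
      by rewrite xE yE; ring.
    by rewrite rmorphD [RHS]rmorphD !rmorphM !rmorphXn -pE -qE exprD; ring.
  - move=> [N [p' [[x xE] pE]]] [N' [q' [[y yE] qE]]].
    exists (N + N')%N, (p' * q'); split.
      exists (w ^+ N' * q * x + p' * y).
      transitivity (w ^+ N' * q * (w ^+ N * p - p') + p' * (w ^+ N' * q - q')).
        by rewrite exprD; ring.
      by rewrite xE yE; ring.
    by rewrite !rmorphM -pE -qE exprD; ring.
have : psi f * psi h = 0.
  rewrite -rmorphM fhE rmorphM rmorphB rmorph1 rmorphM psiX eqxx.
  by rewrite -/w psiw mulVf // subrr mul0r.
(* Modulo [1 - 'X_i * w] the factors [w] are cancelled one at a time, since ['X_i] is inverse to
   [w]. *)
have dvd_ker p : psi p = 0 -> divides (1 - 'X_i * w) p.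
  move=> psip; have [N [p' [[x]]]] := lift p.
  rewrite psip mul0r => xE /esym/eqP; rewrite -(rmorph0 iota) => /eqP/iota_inj p'0.
  move: xE; rewrite p'0 subr0; elim: N x => [|N IHN] x.
    by rewrite expr0 mul1r => ->; exists x.
  rewrite exprS => xE; apply: (IHN (w ^+ N * p + 'X_i * x)).
  by rewrite mulrDr [X in _ = _ + X]mulrCA -xE; ring.
move/eqP; rewrite mulf_eq0 => /orP[/eqP/dvd_ker[x fE]|/eqP/dvd_ker//].
case/negP: f1; rewrite fE mevalM mevalB meval1 mevalM mevalXU mevalX big1 => [|j _].
  by rewrite mulr1 subrr mul0r.
by rewrite expr1n.
Qed.

End Quotient.

Lemma regular_1subX (i : 'I_n) (m : 'X_{1..n}) (f : P) :
  m i = 0%N -> meval (fun=> 1) f != 0 -> regular (1 - 'X_i * 'X_[m]) f.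
Proof.
have inj : injective (@tofrac P) by move=> p q /eqP; rewrite tofrac_eq => /eqP.
by move=> mi f1; refine (regular_1subX_in inj mi f1).
Qed.

Definition mpoly_eval (v : 'I_n -> int) : {rmorphism P -> int} := meval v.

End RegularMpoly.

(* The variables are a, b, q, p in this order. *)
Lemma laurent_mpoly (e : nat -> nat) (n : nat) :
  (forall j, (j.+2 < n)%N -> (e j.+1 + e j.+1 = e j + e j.+2)%N) ->
  exists A B : nat -> {mpoly int[4]},
  [/\ A 0%N = 1 /\ A 1%N = 1, B 0%N = 1 /\ B 1%N = 1,
      forall j, (j < n)%N ->
        A j.+2 * A j = A j.+1 ^+ 2
          + ('X_(inord 0) * 'X_(inord 2) ^+ e j) * B j.+1 ^+ 2
        /\ B j.+2 * B j = B j.+1 ^+ 2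
          + ('X_(inord 1) * 'X_(inord 3) ^+ e j) * A j.+1 ^+ 2
    & forall j, (j <= n.+1)%N ->
        meval (fun=> 0) (A j) = 1 /\ meval (fun=> 0) (B j) = 1].
Proof.
move=> eE.
apply: (@laurent_polynomials _ (mpoly_eval (fun=> 0)) (mpoly_eval (fun=> 1))
  (fun j => 'X_(inord 0) * 'X_(inord 2) ^+ e j)
  (fun j => 'X_(inord 1) * 'X_(inord 3) ^+ e j)) => [j|j|j|j|j jn|j jn|f j f1|f j f1|f j f1].
- by rewrite /= mevalM mevalXU mul0r.
- by rewrite /= mevalM mevalXU mul0r.
- by rewrite /= mevalM rmorphXn /= !mevalXU expr1n.
- by rewrite /= mevalM rmorphXn /= !mevalXU expr1n.
- by rewrite exprMn -exprM muln2 -addnn eE // exprD; ring.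
- by rewrite exprMn -exprM muln2 -addnn eE // exprD; ring.
- by apply: regular_mul; [|apply: regular_exp]; apply: regular_X.
- by apply: regular_mul; [|apply: regular_exp]; apply: regular_X.
- have -> : 'X_(inord 0) * 'X_(inord 2) ^+ e j * ('X_(inord 1) * 'X_(inord 3) ^+ e j)
     = 'X_(inord 0) * 'X_[U_(inord 2) *+ e j + (U_(inord 1) + U_(inord 3) *+ e j)]
     :> {mpoly int[4]}.
    by rewrite !mpolyXD -!mpolyXn !mulrA.
  apply: regular_1subX => //.
  by rewrite !mnmDE !mulmnE !mnm1E -!val_eqE /= !inordK.
Qed.

(** * The labels of the framed quiver *)

Definition F0_label (n i : nat) : labels := label (F0_quiver n) (inl (inord i)).

Lemma F0_label_frozen n (i : 'I_4) : label (F0_quiver n) (inr i) = tofrac 'X_i.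
Proof. by elim: n => //= n IHn; rewrite /mutate_label. Qed.

Lemma F0_label_step n i : (i < 4)%N -> i != (n %% 4)%N ->
  F0_label n.+1 i = F0_label n i.
Proof.
move=> i4 ni; rewrite /F0_label /= /mutate_label /mutation_vertex.
case: eqP => // -[] /(congr1 val) /=; rewrite !inordK ?ltn_mod // => iE.
by rewrite iE eqxx in ni.
Qed.

Lemma F0_label_mutate m r (n := (4 * m + r)%N) (y := fun i : nat => tofrac 'X_(inord i) : labels) :
  (r < 4)%N ->
  F0_label n.+1 r =
    nth 0 [:: F0_label n 2 ^+ 2 + y 0%N ^+ m.*2.+1 * y 2%N ^+ m.*2 * F0_label n 3 ^+ 2;
              F0_label n 3 ^+ 2 + y 1%N ^+ m.*2.+1 * y 3%N ^+ m.*2 * F0_label n 2 ^+ 2;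
              F0_label n 0 ^+ 2 + y 0%N ^+ m.*2.+2 * y 2%N ^+ m.*2.+1 * F0_label n 1 ^+ 2;
              F0_label n 1 ^+ 2 + y 1%N ^+ m.*2.+2 * y 3%N ^+ m.*2.+1 * F0_label n 0 ^+ 2] r
    / F0_label n r.
Proof.
move=> r4.
have nr : (n %% 4 = r)%N by rewrite /n; lia.
have nm : (n %/ 4 = m)%N by rewrite /n; lia.
have vE : mutation_vertex n = inl (inord r) by rewrite /mutation_vertex nr.
rewrite {1}/F0_label /= /mutate_label vE eqxx /= -/(F0_label n r); congr (_ / _).
set rhs := nth _ _ _.
have rE : nat_of_ord (inord r : 'I_4) = r by rewrite inordK.
have arr i := F0_arrows_closed n i (inord r).
rewrite nr nm in arr.
have arr' i := F0_arrows_closed n (inord r) i.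
rewrite nr nm in arr'.
have labE (i : 'I_4) : label (F0_quiver n) (inl i) = F0_label n i.
  by rewrite /F0_label inord_val.
have yE (i : 'I_4) : tofrac 'X_i = y i by rewrite /y inord_val.
rewrite !big_sumType /=.
under [X in X * _ + _]eq_bigr => i _ do (rewrite labE; have [-> _ _] := arr i; rewrite rE).
under [X in _ * X + _]eq_bigr => i _ do
  (rewrite F0_label_frozen yE; have [_ -> _] := arr i; rewrite rE).
under [X in _ + X * _]eq_bigr => i _ do (rewrite labE; have [-> _ _] := arr' i; rewrite rE).
under [X in _ + _ * X]eq_bigr => i _ do
  (rewrite F0_label_frozen yE; have [_ _ ->] := arr i; rewrite rE).
rewrite !big_ord_recl !big_ord0 /= /rhs.
clearbody n y.
case: r r4 {nr vE rE arr arr' rhs} => [|[|[|[|r]]]] // _ /=;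
  rewrite /bump /= ?(addn0, subn0, sub0n, expr0, mul1r, mulr1);
  by congr (_ + _); rewrite mulrC.
Qed.

(** Mutation at vertex 0 involves the labels at 2 and 3, and mutation at 2 those at 0 and 1. So the
    labels at 0 and 2 interleave into one sequence and those at 1 and 3 into another, all read at
    the start of a round of four mutations. *)
Definition label_A j := F0_label (4 * j./2) (if odd j then 2 else 0)%N.
Definition label_B j := F0_label (4 * j./2) (if odd j then 3 else 1)%N.

Lemma F0_label_later n k i : (i < 4)%N ->
  (forall j, (j < k)%N -> i != ((n + j) %% 4)%N) -> F0_label (n + k) i = F0_label n i.
Proof.
move=> i4; elim: k => [|k IHk] ni; first by rewrite addn0.
by rewrite addnS F0_label_step ?ni // IHk // => j jk; apply: ni; apply: leqW.
Qed.

Lemma label_recurrence j (y := fun i : nat => tofrac 'X_(inord i) : labels) :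
  label_A j.+2 = (label_A j.+1 ^+ 2 + y 0%N * (y 0%N * y 2%N) ^+ j * label_B j.+1 ^+ 2) / label_A j
  /\ label_B j.+2 = (label_B j.+1 ^+ 2 + y 1%N * (y 1%N * y 3%N) ^+ j * label_A j.+1 ^+ 2) / label_B j.
Proof.
have yE i i' : y i * (y i * y i') ^+ j = y i ^+ j.+1 * y i' ^+ j.
  by rewrite exprMn mulrA -exprS.
rewrite !yE.
have later m i k l : (i < 4)%N -> (k <= l)%N ->
    (forall r, (k <= r)%N -> (r < l)%N -> i != (r %% 4)%N) ->
    F0_label (4 * m + l) i = F0_label (4 * m + k) i.
  move=> i4 kl ikl; rewrite -(subnKC kl) addnA F0_label_later // => r rl.
  have -> : ((4 * m + k + r) %% 4 = (k + r) %% 4)%N by lia.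
  by apply: ikl; lia.
rewrite -(odd_double_half j); set m := j./2.
case: (odd j); rewrite /= ?add1n ?add0n /label_A /label_B /= ?uphalf_double ?doubleK ?odd_double /=.
  have mE : (4 * m.+1 = 4 * m + 4)%N by lia.
  have m2 := F0_label_mutate m (r := 2) isT; have m3 := F0_label_mutate m (r := 3) isT.
  rewrite /= -addnS in m2; rewrite /= -addnS in m3.
  rewrite mE (later m 2 3 4)%N //; last by case=> [|[|[|[|]]]].
  rewrite m2 m3 !(later m 0 2 4)%N ?(later m 0 2 3)%N //; last 2 first.
    by case=> [|[|[|[|]]]].
    by case=> [|[|[|[|]]]].
  rewrite !(later m 1 2 4)%N ?(later m 1 2 3)%N //; last 2 first.
    by case=> [|[|[|[|]]]].
    by case=> [|[|[|[|]]]].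
  rewrite (later m 2 0 2)%N ?(later m 3 0 3)%N ?addn0 //.
    by case=> [|[|[|[|]]]].
  by case=> [|[|[|[|]]]].
have mE : (4 * m.+1 = 4 * m + 4)%N by lia.
have m0 := F0_label_mutate m (r := 0) isT; have m1 := F0_label_mutate m (r := 1) isT.
rewrite /= -addnS in m0; rewrite /= -addnS in m1.
rewrite mE (later m 0 1 4)%N //; last by case=> [|[|[|[|]]]].
rewrite (later m 1 2 4)%N //; last by case=> [|[|[|[|]]]].
rewrite m0 m1 addn0.
rewrite (later m 1 0 1)%N ?(later m 2 0 1)%N ?(later m 3 0 1)%N ?addn0 //.
- by case=> [|[|[|[|]]]].
- by case=> [|[|[|[|]]]].
- by case=> [|[|[|[|]]]].
Qed.

Lemma label_initial : [/\ label_A 0 = 1, label_A 1 = 1, label_B 0 = 1 & label_B 1 = 1].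
Proof. by []. Qed.

Lemma cluster_varE k : (0 < k)%N -> cluster_var k = label_B k.+1.
Proof.
move=> k0; rewrite /cluster_var /new_label.
have -> : mutation_vertex k.*2.-1 = inl (inord (if odd k then 1 else 3)%N).
  rewrite /mutation_vertex; congr (inl (inord _)).
  by move: (odd_double_half k); case: (odd k) => /= kE; lia.
rewrite -/(F0_label _ _) /label_B /= uphalf_half.
move: (odd_double_half k); case: (odd k) => /= kE; last first.
  by congr F0_label; lia.
(* For odd [k] the label is read at the end of the round, two mutations after it was produced. *)
have -> : (4 * (1 + k./2) = k.*2 + 2)%N by lia.
rewrite F0_label_later // => -[|[|]] // _; [|]; apply/eqP; lia.
Qed.

(** * The change of exponents *)

Section StableCoefficients.
Local Notation P := {mpoly int[4]}.
Local Notation K := {fraction P}.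

Definition laurent_monomial (z : 'cV[int]_4) : K := \prod_i tofrac 'X_i ^ z i 0.

Lemma tofracX_unit i : (tofrac ('X_i : P)) \is a GRing.unit.
Proof. by rewrite unitfE tofrac_eq0 mpolyX_neq0. Qed.

Lemma laurent_monomialD z z' :
  laurent_monomial (z + z') = laurent_monomial z * laurent_monomial z'.
Proof.
rewrite -big_split; apply: eq_bigr => i _.
by rewrite mxE expfzDr // -unitfE tofracX_unit.
Qed.

Lemma laurent_monomial_sum (I : Type) (r : seq I) (F : I -> 'cV[int]_4) :
  laurent_monomial (\sum_(i <- r) F i) = \prod_(i <- r) laurent_monomial (F i).
Proof.
apply: (big_morph _ laurent_monomialD).
by rewrite /laurent_monomial big1 // => i _; rewrite mxE.
Qed.

Lemma laurent_monomialMn z n : laurent_monomial (z *+ n) = laurent_monomial z ^+ n.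
Proof.
elim: n => [|n IHn]; last by rewrite mulrS laurent_monomialD IHn exprS.
by rewrite mulr0n expr0 /laurent_monomial big1 // => i _; rewrite mxE.
Qed.

Lemma laurent_monomial_nat m : laurent_monomial (mnm_col m) = tofrac 'X_[m].
Proof.
rewrite mpolyXE_id rmorph_prod; apply: eq_bigr => i _.
by rewrite mxE rmorphXn.
Qed.

Lemma mnm_colD m m' : mnm_col (m + m')%MM = mnm_col m + mnm_col m'.
Proof. by apply/colP => i; rewrite !mxE mnmDE PoszD. Qed.

Lemma mnm_col_inj : injective mnm_col.
Proof. by move=> m m' /colP E; apply/mnmP => i; have := E i; rewrite !mxE => -[]. Qed.

Lemma exponents_bounded (s : seq 'cV[int]_4) :
  exists N : 'X_{1..4}, {in s, forall z, exists m, z + mnm_col N = mnm_col m}.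
Proof.
elim: s => [|z s [N IHs]]; first by exists 0%MM.
pose Z := [multinom `|z i 0%R|%N | i < 4].
exists (N + Z)%MM => z'; rewrite inE => /orP[/eqP->|/IHs[m mE]]; last first.
  by exists (m + Z)%MM; rewrite !mnm_colD addrA mE.
exists [multinom (N i + absz (z i 0%R + `|z i 0%R|)%R)%N | i < 4].
by apply/colP => i; rewrite !mxE mnmDE !mnmE; move: (z i 0) (N i) => x y; lia.
Qed.

Lemma mulmx_mnm_col (A : 'M[int]_4) m : A *m mnm_col m = \sum_i col i A *+ m i.
Proof.
apply/colP => i; rewrite mxE summxE; apply: eq_bigr => j _.
by rewrite !mxE mulmxnE mxE -mulr_natr natz.
Qed.

(** The substituted polynomial has negative exponents a priori. Multiplication by one monomial
    ['X_[N]] makes all its exponents, and [b] as well, non-negative, so that coefficients can be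
    compared between true polynomials. *)
Lemma stable_coeff_substitution (k : nat) (F H : P) (psi : {rmorphism P -> K}) :
  (forall i, psi 'X_i = laurent_monomial (col i (stable_mx k))) ->
  psi F = tofrac H ->
  (forall m, stable_coeff k F (mnm_col m) = H@_m)
  /\ (forall b, (forall m, b != mnm_col m) -> stable_coeff k F b = 0).
Proof.
move=> psiX psiF.
suff coefE b : stable_coeff k F b = \sum_(m <- msupp H | mnm_col m == b) H@_m.
  split=> [m|b bm]; rewrite coefE; last first.
    by rewrite big1_seq // => m /andP[/eqP mb _]; have := bm m; rewrite -mb eqxx.
  rewrite [in RHS](mpolyE H) raddf_sum big_mkcond; apply: eq_bigr => m' _ /=.
  rewrite mcoeffZ mcoeffX (inj_eq mnm_col_inj).
  by case: eqP => _; rewrite ?mulr1 ?mulr0.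
have [N NE] := exponents_bounded (b :: [seq stable_exp k (mnm_col m) | m <- msupp F]).
have [g gE] := NE b (mem_head _ _).
have shift m : m \in msupp F -> exists m', stable_exp k (mnm_col m) + mnm_col N = mnm_col m'.
  by move=> Fm; apply: NE; rewrite inE; apply/orP; right; apply: map_f.
pose f m := [multinom absz ((stable_exp k (mnm_col m) + mnm_col N)%R i 0%R) | i < 4].
have fE m : m \in msupp F -> stable_exp k (mnm_col m) + mnm_col N = mnm_col (f m).
  move=> /shift[m' m'E]; rewrite m'E; congr mnm_col; apply/mnmP => i.
  by rewrite mnmE m'E mxE.
have eqF : \sum_(m <- msupp F) F@_m *: 'X_[f m] = H * 'X_[N].
  apply/eqP; rewrite -tofrac_eq tofracM -psiF raddf_sum /=; apply/eqP.
  rewrite [in RHS](mpolyE F) raddf_sum mulr_suml; apply: eq_big_seq => m Fm.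
  rewrite /= -!mul_mpolyC !rmorphM !rmorph_mpolyC -mulrA; congr (_ * _).
  rewrite -[LHS]/(tofrac 'X_[f m]) -!laurent_monomial_nat -fE // laurent_monomialD; congr (_ * _).
  rewrite stable_expE mulmx_mnm_col laurent_monomial_sum rmorph_mpolyX.
  by apply: eq_bigr => i _; rewrite laurent_monomialMn psiX.
have := congr1 (mcoeff g) eqF; rewrite [in X in _ = X -> _](mpolyE H) mulr_suml !raddf_sum /=.
move=> E; rewrite /stable_coeff big_mkcond [RHS]big_mkcond /=.
transitivity (\sum_(m <- msupp F) (F@_m *: 'X_[f m])@_g).
  apply: eq_big_seq => m Fm; rewrite mcoeffZ mcoeffX -(inj_eq mnm_col_inj) -fE // -gE.
  by rewrite (inj_eq (addIr _)); case: eqP => _; rewrite ?mulr1 ?mulr0.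
rewrite E; apply: eq_bigr => m _.
rewrite -scalerAl mcoeffZ -mpolyXD mcoeffX -(inj_eq mnm_col_inj) mnm_colD -gE.
by rewrite (inj_eq (addIr _)); case: eqP => _; rewrite ?mulr1 ?mulr0.
Qed.

End StableCoefficients.

(** The substitution sends [y_0 y_2] and [y_1 y_3] to their inverses, and [y_0] to
    [y_0 (y_0 y_2)^(k-1)], [y_1] to [y_1 (y_1 y_3)^(k-1)]. This reverses the order of the
    coefficients. *)
Lemma stable_mx_geom (k j : nat) (i i' : 'I_4) : (j < k)%N ->
  ((nat_of_ord i, nat_of_ord i') == (0, 2)%N) || ((nat_of_ord i, nat_of_ord i') == (1, 3)%N) ->
  let e (l : 'I_4) : 'cV[int]_4 := mnm_col U_(l) in
  col i (stable_mx k) + (col i (stable_mx k) + col i' (stable_mx k)) *+ j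
  = e i + (e i + e i') *+ (k.-1 - j).
Proof.
move=> jk ii' e; apply/colP => l.
rewrite !mxE !mulmxnE !mxE !mnm1E -!val_eqE /=.
case/orP: ii' => /eqP[-> ->]; case: l => [[|[|[|[|l]]]] //= _];
  rewrite ?addr0 ?add0r ?mul0rn //.
- have -> : k%:Z - (k%:Z + 1) = -1 by lia.
  by rewrite mulNrn -[1%Z *+ _]/(_%:R) !natz; lia.
- have -> : k%:Z - 1 - k%:Z = -1 by lia.
  by rewrite mulNrn -[1%Z *+ _]/(_%:R) !natz; lia.
- have -> : k%:Z - (k%:Z + 1) = -1 by lia.
  by rewrite mulNrn -[1%Z *+ _]/(_%:R) !natz; lia.
- have -> : k%:Z - 1 - k%:Z = -1 by lia.
  by rewrite mulNrn -[1%Z *+ _]/(_%:R) !natz; lia.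
Qed.

(** * Polynomial solutions of the recurrence and of its reversal *)

Section StablePolynomials.
Local Notation P := {mpoly int[4]}.
Local Notation K := {fraction P}.

Local Notation y i := ('X_(inord i%N) : P).

Lemma rmorph_mpoly_eq (S : comNzRingType) (f g : {rmorphism P -> S}) :
  (forall i, f 'X_i = g 'X_i) -> f =1 g.
Proof.
move=> fg; elim/mpoly_ring_ind => [c|i|p q fp fq|p q fp fq] //.
- by rewrite !rmorph_mpolyC.
- by rewrite !rmorphD fp fq.
- by rewrite !rmorphM fp fq.
Qed.

Definition coupled_recurrence (R : pzRingType) (c d A B : nat -> R) n :=
  forall j, (j < n)%N ->
    A j.+2 * A j = A j.+1 ^+ 2 + c j * B j.+1 ^+ 2
    /\ B j.+2 * B j = B j.+1 ^+ 2 + d j * A j.+1 ^+ 2.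

Definition starts_with_ones (R : pzRingType) (A B : nat -> R) :=
  [/\ A 0%N = 1, A 1%N = 1, B 0%N = 1 & B 1%N = 1].

(** The second pair is asked to satisfy the recurrence only where its terms are nonzero, since the
    labels are given by quotients; non-vanishing is carried over from the first pair during the
    induction. *)
Lemma coupled_recurrence_unique (F : fieldType) (c d A B A' B' : nat -> F) n :
  starts_with_ones A B -> starts_with_ones A' B' ->
  coupled_recurrence c d A B n ->
  (forall j, (j <= n.+1)%N -> A j != 0 /\ B j != 0) ->
  (forall j, (j < n)%N -> A' j != 0 -> B' j != 0 ->
    A' j.+2 * A' j = A' j.+1 ^+ 2 + c j * B' j.+1 ^+ 2
    /\ B' j.+2 * B' j = B' j.+1 ^+ 2 + d j * A' j.+1 ^+ 2) ->
  forall j, (j <= n.+1)%N -> A' j = A j /\ B' j = B j.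
Proof.
move=> [A0 A1 B0 B1] [A'0 A'1 B'0 B'1] rec nz rec' j.
elim/ltn_ind: j => -[|[|j]] IHj jn; rewrite ?A0 ?A1 ?B0 ?B1 //.
have [Aj Bj] := IHj j (leqnSn _) (ltnW (ltnW jn)).
have [Aj1 Bj1] := IHj j.+1 (leqnn _) (ltnW jn).
have [nzA nzB] := nz j (ltnW (ltnW jn)).
have [rA rB] := rec j jn.
have := rec' j jn; rewrite Aj Bj Aj1 Bj1 => /(_ nzA nzB)[rA' rB'].
by split; [apply: (mulIf nzA); rewrite rA | apply: (mulIf nzB); rewrite rB].
Qed.

(** In the variables [y_i] the element [1 - c j * d j] is in general linear in no variable, so
    [regular_1subX] does not apply. The Laurent property is therefore proved with four independent
    variables and pushed forward by a morphism that preserves constant terms. *)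
Lemma laurent_stable (e : nat -> nat) (n : nat) :
  (forall j, (j.+2 < n)%N -> (e j.+1 + e j.+1 = e j + e j.+2)%N) ->
  exists A B : nat -> P,
  [/\ starts_with_ones A B,
      coupled_recurrence (fun j => y 0 * (y 0 * y 2) ^+ e j)
                         (fun j => y 1 * (y 1 * y 3) ^+ e j) A B n
    & forall j, (j <= n.+1)%N ->
        meval (fun=> 0) (A j) = 1 /\ meval (fun=> 0) (B j) = 1].
Proof.
move=> /laurent_mpoly[A [B [[A0 A1] [B0 B1] rec AB]]].
have [f fX] := mpoly_morphism
  (fun i : 'I_4 => nth 0 [:: y 0; y 1; y 0 * y 2; y 1 * y 3] i).
have fXn i : (i < 4)%N -> f (y i) = nth 0 [:: y 0; y 1; y 0 * y 2; y 1 * y 3] i.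
  by move=> i4; rewrite fX inordK.
exists (f \o A), (f \o B); split=> [|j jn|j jn].
- by split; rewrite /= ?A0 ?A1 ?B0 ?B1 rmorph1.
- have [rA rB] := rec j jn; rewrite /= -!rmorphM rA rB.
  by rewrite !rmorphD !rmorphM !rmorphXn /= !fXn.
have [A1j B1j] := AB j jn.
have ev p : meval (fun=> 0) (f p) = meval (fun=> 0) p.
  apply: (rmorph_mpoly_eq (f := mpoly_eval (fun=> 0) \o f)
                          (g := mpoly_eval (fun=> 0))) => i /=.
  rewrite fX !mevalXU; case: i => [[|[|[|[|i]]]] ?] //=;
  by rewrite ?mevalM mevalXU ?mul0r.
by rewrite /= !ev.
Qed.

Lemma rec_nonzero (A : nat -> P) j : meval (fun=> 0) (A j) = 1 -> tofrac (A j) != 0.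
Proof.
move=> A1; rewrite tofrac_eq0; apply: contra_eq_neq A1 => ->.
by rewrite meval0 eq_sym oner_eq0.
Qed.

(** The Laurent property is used twice, for the exponents [j] and for [k.-1 - j]. By uniqueness the
    change of exponents carries the first solution to the second one, which is again polynomial. *)
Lemma stable_coeff_cluster : exists F : nat -> P,
  (forall k, (1 <= k)%N -> tofrac (F k) = cluster_var k) /\
  forall k, (1 <= k)%N -> exists A B : nat -> P,
  [/\ starts_with_ones A B,
      coupled_recurrence (fun j => y 0 * (y 0 * y 2) ^+ (k.-1 - j))
                         (fun j => y 1 * (y 1 * y 3) ^+ (k.-1 - j)) A B k,
      forall m, stable_coeff k (F k) (mnm_col m) = (B k.+1)@_m
    & forall b, (forall m, b != mnm_col m) -> stable_coeff k (F k) b = 0].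
Proof.
have /choice[F HF] : forall k : nat, exists Fk : P, (1 <= k)%N ->
  tofrac Fk = cluster_var k /\ exists A B : nat -> P,
  [/\ starts_with_ones A B,
      coupled_recurrence (fun j => y 0 * (y 0 * y 2) ^+ (k.-1 - j))
                         (fun j => y 1 * (y 1 * y 3) ^+ (k.-1 - j)) A B k,
      forall m, stable_coeff k Fk (mnm_col m) = (B k.+1)@_m
    & forall b, (forall m, b != mnm_col m) -> stable_coeff k Fk b = 0];
  last by exists F; split=> k k1; case: (HF k k1).
move=> k.
have [A [B [AB1 rec AB]]] := @laurent_stable id k (fun _ _ => ltac:(lia)).
have [A' [B' [AB1' rec' AB']]] : exists A B : nat -> P,
  [/\ starts_with_ones A B,
      coupled_recurrence (fun j => y 0 * (y 0 * y 2) ^+ (k.-1 - j))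
                         (fun j => y 1 * (y 1 * y 3) ^+ (k.-1 - j)) A B k
    & forall j, (j <= k.+1)%N ->
        meval (fun=> 0) (A j) = 1 /\ meval (fun=> 0) (B j) = 1].
  by apply: laurent_stable => j jk; lia.
have tofrac_ones (C D : nat -> P) :
    starts_with_ones C D -> starts_with_ones (fun j => tofrac (C j)) (fun j => tofrac (D j)).
  by case=> C0 C1 D0 D1; split; rewrite /= ?C0 ?C1 ?D0 ?D1 rmorph1.
have recF : coupled_recurrence (fun j => tofrac (y 0 * (y 0 * y 2) ^+ j))
    (fun j => tofrac (y 1 * (y 1 * y 3) ^+ j)) (fun j => tofrac (A j)) (fun j => tofrac (B j)) k.
  move=> j jk; have [rA rB] := rec j jk; rewrite /= -!rmorphM rA rB.
  by rewrite !rmorphD !rmorphM !rmorphXn.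
exists (B k.+1) => k1; split.
  rewrite cluster_varE //; symmetry.
  have nz j : (j <= k.+1)%N -> tofrac (A j) != 0 /\ tofrac (B j) != 0.
    by move=> /AB[a b]; split; apply: rec_nonzero.
  apply: (coupled_recurrence_unique (tofrac_ones _ _ AB1) label_initial recF nz
    _ (leqnn k.+1)).2 => j jk nzA nzB.
  have [rA rB] := label_recurrence j.
  by rewrite rA rB !divfK // !tofracM !tofracXn !tofracM.
have [psi psiX] := mpoly_morphism (fun i => laurent_monomial (col i (stable_mx k))).
suff psiB : psi (B k.+1) = tofrac (B' k.+1).
  by have [E1 E2] := stable_coeff_substitution psiX psiB; exists A', B'.
have nz j : (j <= k.+1)%N -> tofrac (A' j) != 0 /\ tofrac (B' j) != 0.
  by move=> /AB'[a b]; split; apply: rec_nonzero.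
have psi_ones : starts_with_ones (fun j => psi (A j)) (fun j => psi (B j)).
  by case: AB1 => A0 A1 B0 B1; split; rewrite /= ?A0 ?A1 ?B0 ?B1 rmorph1.
have recF' : coupled_recurrence (fun j => tofrac (y 0 * (y 0 * y 2) ^+ (k.-1 - j)))
    (fun j => tofrac (y 1 * (y 1 * y 3) ^+ (k.-1 - j))) (fun j => tofrac (A' j)) (fun j => tofrac (B' j)) k.
  move=> j jk; have [rA rB] := rec' j jk; rewrite /= -!rmorphM rA rB.
  by rewrite !rmorphD !rmorphM !rmorphXn.
apply: (coupled_recurrence_unique (tofrac_ones _ _ AB1') psi_ones recF' nz
    _ (leqnn k.+1)).2 => j jk _ _.
have [rA rB] := rec j jk; rewrite /= -!rmorphM rA rB !rmorphD !rmorphM !rmorphXn /=.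
have psi_geom (i i' : nat) : ((i, i') == (0, 2)%N) || ((i, i') == (1, 3)%N) ->
    psi (y i) * (psi (y i) * psi (y i')) ^+ j
    = tofrac (y i * (y i * y i') ^+ (k.-1 - j)).
  move=> ii'; rewrite tofracM tofracXn tofracM; set u := tofrac (y i); set v := tofrac (y i').
  rewrite /u /v -!laurent_monomial_nat !psiX -!laurent_monomialD -!laurent_monomialMn.
  rewrite -!laurent_monomialD stable_mx_geom //.
  by case/orP: ii' => /eqP[-> ->]; rewrite !inordK.
by rewrite !rmorphM (psi_geom 0 2)%N // (psi_geom 1 3)%N // !tofracM !tofracXn !tofracM.
Qed.
End StablePolynomials.

(** * Hankel determinants and sums over shapes *)

Section CauchyBinet.
Variables (R : comNzRingType) (i M : nat).
Implicit Types (S : {set 'I_M.+1}) (A : 'M[R]_(i, M.+1)) (B : 'M[R]_(M.+1, i)).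

Definition enum_set n S (k : 'I_n) : 'I_M.+1 := nth ord0 (enum S) k.

Lemma enum_set_in S (k : 'I_i) : #|S| = i -> enum_set S k \in S.
Proof. by move=> Si; rewrite -mem_enum mem_nth // -cardE Si. Qed.

Lemma enum_set_inj S : #|S| = i -> injective (@enum_set i S).
Proof.
move=> Si k l /eqP; rewrite nth_uniq ?enum_uniq -?cardE ?Si //.
by move/eqP/val_inj.
Qed.

Lemma enum_set_lt S (k l : 'I_i) : #|S| = i ->
  (enum_set S k < enum_set S l)%N = (k < l)%N.
Proof.
move=> Si; have sorted_S : sorted ltn (map val (enum S)).
  rewrite sorted_map [enum S]/(enum_mem _) sorted_filter //.
    by move=> x y z; apply: ltn_trans.
  by rewrite -sorted_map -enumT val_enum_ord iota_ltn_sorted.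
have lt_of (k' l' : 'I_i) : (k' < l')%N -> (enum_set S k' < enum_set S l')%N.
  move=> kl; have := sorted_ltn_nth ltn_trans 0%N sorted_S.
  move=> /(_ k' l'); rewrite !inE size_map -cardE Si !ltn_ord => /(_ isT isT kl).
  by rewrite !(nth_map ord0) // -cardE Si.
have [kl|lk|/val_inj->] := ltngtP k l; [exact: lt_of | | by rewrite ltnn].
by apply/negbTE; rewrite -leqNgt ltnW ?lt_of.
Qed.

(** Expanding the rows of the product gives a sum over functions [f] that choose rows of [B]. A
    repeated row kills the non-injective ones, and the injective ones with image [S] are
    [enum_set S] composed with a permutation. *)
Lemma Cauchy_Binet A B :
  \det (A *m B) = \sum_(S : {set 'I_M.+1} | #|S| == i)
    \det (colsub (enum_set S) A) * \det (rowsub (enum_set S) B).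
Proof.
pose F := {ffun 'I_i -> 'I_M.+1}.
transitivity (\sum_(f : F) (\prod_k A k (f k)) * \det (rowsub f B)).
  transitivity (\sum_(f : F) \sum_(s : 'S_i)
      (-1) ^+ s * \prod_k (A k (f k) * B (f k) (s k))).
    rewrite exchange_big; apply: eq_bigr => /= s _; rewrite -big_distrr /=.
    congr (_ * _); rewrite -(bigA_distr_bigA (fun k x => A k x * B x (s k))) /=.
    by apply: eq_bigr => x _; rewrite mxE.
  apply: eq_bigr => f _; rewrite big_distrr /=; apply: eq_bigr => s _.
  rewrite big_split /= mulrCA; congr (_ * (_ * _)).
  by apply: eq_bigr => k _; rewrite mxE.
rewrite (bigID (fun f : F => injectiveb f)) /= addrC big1 ?add0r => [|f]; last first.
  case/injectivePn => k [l kl fkl].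
  by rewrite (determinant_alternate kl) ?mulr0 // => j; rewrite !mxE fkl.
rewrite (partition_big (fun f : F => f @: 'I_i) (fun S => #|S| == i)) /=;
  last first.
  by move=> f /injectiveP f_inj; rewrite card_imset // card_ord.
apply: eq_bigr => S /eqP Si; pose e := @enum_set i S.
have e_inj := enum_set_inj Si.
pose of_perm (s : 'S_i) : F := [ffun k => e (s k)].
(* For an injective [f] with image [S] the defaults of [insubd] are not reached; they only make
   [to_perm] total. *)
pose to_perm (f : F) : 'S_i :=
  insubd (1%g : 'S_i) [ffun k => insubd k (index (f k) (enum S))].
have to_permK (f : F) : injectiveb f -> f @: 'I_i == S ->
    of_perm (to_perm f) = f.
  move=> /injectiveP f_inj /eqP fS.
  have fk k : f k \in enum S by rewrite mem_enum -fS imset_f.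
  have idx k : (index (f k) (enum S) < i)%N by rewrite -[X in (_ < X)%N]Si cardE index_mem.
  pose g : {ffun 'I_i -> 'I_i} := [ffun k => insubd k (index (f k) (enum S))].
  have gE k : val (g k) = index (f k) (enum S) by rewrite ffunE val_insubd idx.
  have g_inj : injectiveb g.
    apply/injectiveP => k l /(congr1 val); rewrite !gE => kl; apply: f_inj.
    by have := congr1 (nth ord0 (enum S)) kl; rewrite !nth_index.
  have to_permE : pval (to_perm f) = g by apply: (insubdK (1%g : 'S_i)).
  apply/ffunP => k; rewrite ffunE -pvalE to_permE.
  by rewrite /e /enum_set gE nth_index.
have of_perm_inj s : injectiveb (of_perm s).
  by apply/injectiveP => k l; rewrite !ffunE => /e_inj/perm_inj.
have of_perm_im s : of_perm s @: 'I_i == S.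
  rewrite eqEcard card_imset ?card_ord ?Si ?leqnn ?andbT; last exact/injectiveP.
  by apply/fintype.subsetP => x /imsetP[k _ ->]; rewrite ffunE enum_set_in.
rewrite (reindex_onto of_perm to_perm) /=; last first.
  by move=> f /andP[f_inj fS]; apply: to_permK.
rewrite [\det (colsub _ _)]/determinant big_distrl /=; apply: eq_big => [s|s _].
  rewrite of_perm_inj of_perm_im /=; apply/eqP/permP => k; apply: e_inj.
  have := to_permK _ (of_perm_inj s) (of_perm_im s).
  by move/ffunP/(_ k); rewrite !ffunE.
have -> : rowsub (of_perm s) B = row_perm s (rowsub e B).
  by apply/matrixP => k l; rewrite !mxE ffunE.
rewrite row_permE det_mulmx det_perm mulrCA mulrA; congr (_ * _ * _).
by apply: eq_bigr => k _; rewrite mxE ffunE.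
Qed.

End CauchyBinet.

(** * The Toda equation for Hankel determinants *)

Section Hankel.
Variable F : fieldType.

Lemma det_block_schur m n (D : 'M[F]_m) (C : 'M_(m, n)) (B : 'M_(n, m)) (A : 'M_n) :
  \det A != 0 ->
  \det (block_mx D C B A) = \det A * \det (D - C *m invmx A *m B).
Proof.
move=> A0; have uA : A \in unitmx by rewrite unitmxE unitfE.
have -> : block_mx D C B A
  = block_mx (1%:M) (C *m invmx A) 0 1%:M *m block_mx (D - C *m invmx A *m B) 0 B A.
  by rewrite mulmx_block !mul1mx !mul0mx !add0r mulmxKV // subrK.
by rewrite det_mulmx det_ublock !det1 det_lblock !mul1r mulrC.
Qed.

Lemma det_reindex_rows m (s : 'I_m -> 'I_m) (A : 'M[F]_m) : injective s ->
  (\det (\matrix_(a, b) A (s a) b)) ^+ 2 = (\det A) ^+ 2.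
Proof.
move=> s_inj; have -> : \matrix_(a, b) A (s a) b = row_perm (perm s_inj) A.
  by apply/matrixP => a b; rewrite !mxE permE.
by rewrite row_permE det_mulmx det_perm exprMn sqrr_sign mul1r.
Qed.

Lemma det_reindex m (s : 'I_m -> 'I_m) (A : 'M[F]_m) : injective s ->
  \det (\matrix_(a, b) A (s a) (s b)) = \det A.
Proof.
move=> s_inj; have -> : \matrix_(a, b) A (s a) (s b)
    = row_perm (perm s_inj) (col_perm (perm s_inj) A).
  by apply/matrixP => a b; rewrite !mxE !permE.
rewrite row_permE col_permE !det_mulmx !det_perm odd_permV.
by rewrite mulrCA -expr2 sqrr_sign mulr1.
Qed.

Lemma det_mx2 (T : 'M[F]_2) : \det T = T 0 0 * T 1 1 - T 0 1 * T 1 0.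
Proof.
rewrite (expand_det_row T 0) !big_ord_recl big_ord0 addr0 /cofactor !det_mx11 !mxE /=.
rewrite expr0 expr1 mul1r mulN1r mulrN.
by congr (T _ _ * T _ _ - T _ _ * T _ _); apply: val_inj.
Qed.

Definition hankel (h : nat -> F) n r := \det (\matrix_(a < n, b < n) h (r + a + b)%N).

(* The Desnanot-Jacobi identity, read off the Schur complement of the inner
   block of the larger matrix. *)
Lemma hankel_toda h n r : hankel h n r.+2 != 0 ->
  hankel h n.+2 r * hankel h n r.+2
  = hankel h n.+1 r * hankel h n.+1 r.+2 - hankel h n.+1 r.+1 ^+ 2.
Proof.
(* [e] gives the two outer rows, 0 and [n.+1]; [A] is the inner block, hence the shift of the index
   by 2. *)
rewrite {1}/hankel; set A := \matrix_(_, _) _ => A0; pose e (u : 'I_2) := (u * n.+1)%N.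
pose D : 'M[F]_2 := \matrix_(u, v) h (r + e u + e v)%N.
pose C : 'M[F]_(2, n) := \matrix_(u, b) h (r + e u + b.+1)%N.
pose B : 'M[F]_(n, 2) := \matrix_(a, v) h (r + a.+1 + e v)%N.
pose S := D - C *m invmx A *m B.
pose minor u v := \det (block_mx (D u v)%:M (row u C) (col v B) A).
have mxB m1 m2 (X Y : 'M[F]_(m1, m2)) a b : (X - Y) a b = X a b - Y a b.
  by rewrite !mxE.
have minorE u v : minor u v = \det A * S u v.
  have rowcol : (row u C *m invmx A *m col v B) 0 0 = (C *m invmx A *m B) u v.
    rewrite -row_mul [LHS]mxE [RHS]mxE; apply: eq_bigr => k _.
    by rewrite [row _ _ _ _]mxE [col _ _ _ _]mxE.
  rewrite /minor det_block_schur // det_mx11 mxB rowcol /S mxB.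
  by rewrite [(D u v)%:M 0 0]mxE eqxx.
have full : hankel h n.+2 r = \det A * \det S.
  rewrite -det_block_schur // /hankel.
  (* The rows are listed as 0, [n.+1], 1, ..., [n], so that the outer ones form the first block. *)
  pose f (a : 'I_n.+2) := (if a == 0 :> nat then 0 else if a == 1 :> nat then n.+1 else a.-1)%N.
  pose s (a : 'I_n.+2) : 'I_n.+2 := inord (f a).
  have sE a : nat_of_ord (s a) = f a by rewrite /s inordK // /f; case: a => -[|[|a]] /= an; lia.
  have s_inj : injective s.
    move=> a b /(congr1 (@nat_of_ord _)); rewrite !sE /f => ab; apply: val_inj.
    by move: ab; case: a b => -[|[|a]] /= an [[|[|b]] /= bn]; lia.
  rewrite -(det_reindex _ s_inj); congr (\det _); apply/matrixP => a b; rewrite !mxE.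
  case: splitP => [[[|[|//]] ? /= aE]|k aE]; rewrite !mxE;
    (case: splitP => [[[|[|//]] ? /= bE]|l bE]);
    rewrite !mxE !sE /f aE bE /e /=; congr h; lia.
have m00 : hankel h n.+1 r = minor 0 0.
  congr (\det _); apply/matrixP => a b; rewrite !mxE.
  case: splitP => [[[|//] ? /= aE]|k aE]; rewrite !mxE;
    (case: splitP => [[[|//] ? /= bE]|l bE]);
    rewrite !mxE ?aE ?bE /e /=; congr h; lia.
pose f (a : 'I_n.+1) := (if a == 0 :> nat then n else a.-1)%N.
pose s (a : 'I_n.+1) : 'I_n.+1 := inord (f a).
have sE a : nat_of_ord (s a) = f a by rewrite /s inordK // /f; case: a => -[|a] /= an; lia.
have s_inj : injective s.
  move=> a b /(congr1 (@nat_of_ord _)); rewrite !sE /f => ab; apply: val_inj.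
  by move: ab; case: a b => -[|a] /= an [[|b] /= bn]; lia.
have m11 : hankel h n.+1 r.+2 = minor 1 1.
  rewrite /hankel -(det_reindex _ s_inj).
  congr (\det _); apply/matrixP => a b; rewrite !mxE !sE /f.
  case: splitP => [[[|//] ? /= aE]|k aE]; rewrite !mxE;
    (case: splitP => [[[|//] ? /= bE]|l bE]);
    rewrite !mxE ?aE ?bE /e /=; congr h; lia.
(* The two mixed minors agree by symmetry and equal the shifted determinant up to the sign of a
   permutation of the rows, which the square removes. *)
have m01 : hankel h n.+1 r.+1 ^+ 2 = minor 0 1 * minor 1 0.
  have -> : minor 0 1 = minor 1 0.
    rewrite -[RHS]det_tr; congr (\det _); apply/matrixP => a b; rewrite !mxE.
    case: splitP => [[[|//] ? /= aE]|k aE]; rewrite !mxE;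
      (case: splitP => [[[|//] ? /= bE]|l bE]);
      rewrite !mxE;
      (case: splitP => [[[|//] ? /= aE']|k' aE']);
      rewrite !mxE ?eqxx /e /= ?mulr1n; congr h; lia.
  rewrite -expr2 /hankel -(det_reindex_rows _ s_inj); congr (_ ^+ 2).
  congr (\det _); apply/matrixP => a b; rewrite !mxE !sE /f.
  case: splitP => [[[|//] ? /= aE]|k aE]; rewrite !mxE;
    (case: splitP => [[[|//] ? /= bE]|l bE]);
    rewrite !mxE ?aE ?bE /e /=; congr h; lia.
rewrite full m00 m11 m01 !minorE -/(hankel h n r.+2) [hankel h n r.+2]/hankel -/A det_mx2.
ring.
Qed.
End Hankel.

(** * Moments on sites: Hankel determinants as sums over Young diagrams *)

Section TodaSum.
Variables (F : fieldType) (M : nat) (c x : nat -> F).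
Implicit Types (S : {set 'I_M.+1}).

(** A set of [i] sites among 0, ..., [M] is the Maya diagram of a Young diagram, the sites below [i]
    giving the empty one. The step from site [e - 1] to site [e] carries the boxes of content
    [e - i]. A hook is an empty site below an occupied one, and the quotient of their [site] values
    is the product of [x] over the steps between them. *)
Definition site s := \prod_(e < s) x e.+1.

Definition above S e := #|[set s in S | (e <= s)%N]|%SET.

Definition hook_prod S : F :=
  \prod_(b in S) \prod_(a < M.+1 | (a \notin S) && (a < b)%N) (1 - site b / site a) ^- 2.

(* With [n] sites of [S] above [e], the shape has [n - (i - e)] boxes of content
   [e - i]; [t] counts them from the first one outwards. *)
Definition box_prod i r S : F :=
  \prod_(e < M) \prod_(t < above S e.+1 - (i - e.+1))
    (c e.+1 * x e.+1 ^+ (r + ((e.+1 - i) + (i - e.+1)) + t.*2)).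

Definition shape_sum i r : F :=
  \sum_(S : {set 'I_M.+1} | #|S| == i) box_prod i r S * hook_prod S.

Hypothesis c_neq0 : forall e, c e != 0.
Hypothesis x_neq0 : forall e, x e != 0.
Hypothesis site_neq : forall a b, (a < b <= M)%N -> site a != site b.

Let site_neq0 s : site s != 0.
Proof. by apply/prodf_neq0 => e _. Qed.

(** The measure is designed so that weights times a squared Vandermonde determinant become a product
    over boxes and hooks. The last factor runs over all lower sites; its part at occupied sites is
    cancelled by the Vandermonde determinant. *)
Definition site_weight s : F :=
  (\prod_(e < s) (c e.+1 * x e.+1 ^+ e.+1)) / site s ^+ M.+1
  * \prod_(a < s) (1 - site s / site a) ^- 2.

Definition site_moment r : F := \sum_(s < M.+1) site_weight s * site s ^+ r.

Lemma prod_enum_set i S (G : 'I_M.+1 -> F) (P : pred 'I_M.+1) : #|S| = i ->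
  \prod_(s in S | P s) G s
  = \prod_(k < i | P (@enum_set M i S k)) G (@enum_set M i S k).
Proof.
move=> Si; rewrite -big_enum_cond (big_nth ord0) big_mkord -cardE /enum_set.
by case: i / Si.
Qed.

(** The Hankel matrix of the moments factors through the sites, and both minors on [S] are
    Vandermonde determinants up to a diagonal matrix. *)
Lemma hankel_site_moment i r :
  hankel site_moment i r = \sum_(S : {set 'I_M.+1} | #|S| == i)
    (\prod_(s in S) (site_weight s * site s ^+ r)
     * \prod_(s in S) \prod_(t in S | (s < t)%N) (site t - site s) ^+ 2).
Proof.
pose A : 'M[F]_(i, M.+1) := \matrix_(k, s) (site_weight s * site s ^+ (r + k)).
pose B : 'M[F]_(M.+1, i) := \matrix_(s, l) (site s ^+ l).
have -> : hankel site_moment i r = \det (A *m B).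
  congr (\det _); apply/matrixP => k l; rewrite !mxE; apply: eq_bigr => s _.
  by rewrite !mxE -mulrA -exprD.
rewrite Cauchy_Binet; apply: eq_bigr => S /eqP Si; pose e := @enum_set M i S; rewrite -/e.
pose a : 'rV[F]_i := \row_k site (e k).
pose V := Vandermonde i a.
have enumE G P := prod_enum_set G P Si.
have enumE' (G : 'I_M.+1 -> F) : \prod_(s in S) G s = \prod_(k < i) G (e k).
  by rewrite -(enumE G predT); apply: eq_bigl => s; rewrite andbT.
have -> : colsub e A = V *m diag_mx (\row_k (site_weight (e k) * site (e k) ^+ r)).
  apply/matrixP => k l; rewrite !mxE (bigD1 l) //= big1 ?addr0 => [|l' l'l].
    by rewrite !mxE eqxx mulr1n exprD mulrA mulrC.
  by rewrite !mxE (negbTE l'l) mulr0.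
have -> : rowsub e B = V^T by apply/matrixP => k l; rewrite !mxE.
rewrite det_tr det_mulmx det_diag det_Vandermonde mulrAC mulrC; congr (_ * _).
  by rewrite enumE'; apply: eq_bigr => k _; rewrite mxE.
rewrite -expr2 enumE' -prodrXl; apply: eq_bigr => k _.
rewrite -prodrXl enumE; apply: eq_big => [l|l _]; last by rewrite !mxE.
by rewrite enum_set_lt.
Qed.

Let above_pairs S e :
  (\sum_(s in S | e <= s) \sum_(t in S | s < t) 2 = above S e * (above S e).-1)%N.
Proof.
set A := [set s in S | (e <= s)%N]%SET.
have AE s : (s \in A) = (s \in S) && (e <= s)%N by rewrite inE.
transitivity (\sum_(s in A) \sum_(t in A | s < t) 2)%N.
  apply: eq_big => [s|s /andP[_ es]]; first by rewrite AE.
  apply: eq_bigl => t; rewrite AE; case: (ltnP s t) => st; rewrite ?andbF //.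
  by rewrite (leq_trans es (ltnW st)) !andbT.
have swap : (\sum_(s in A) \sum_(t in A | s < t) 1 = \sum_(s in A) \sum_(t in A | t < s) 1)%N.
  rewrite (exchange_big_dep (mem A)) => [|s t _ /andP[]//].
  by apply: eq_bigr => t tA; apply: eq_bigl => s; rewrite [t \in A]tA.
have -> : (\sum_(s in A) \sum_(t in A | s < t) 2
    = \sum_(s in A) (\sum_(t in A | s < t) 1 + \sum_(t in A | t < s) 1))%N.
  rewrite big_split /= -swap -big_split; apply: eq_bigr => s _ /=.
  by rewrite -big_split.
rewrite /above -/A -sum_nat_const; apply: eq_bigr => s sA.
rewrite sum1_card [X in (_ + X)%N]sum1_card.
have := cardD1 s A; rewrite sA add1n => ->; rewrite /= -cardUI [X in (_ + X)%N]eq_card0.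
  rewrite addn0; apply: eq_card => t; rewrite !inE.
  rewrite -[LHS]/((t \in A) && (s < t)%N || (t \in A) && (t < s)%N) AE -(inj_eq val_inj) /=.
  by case: (t \in S); case: (e <= t)%N; case: (ltngtP t s).
move=> t; rewrite -[LHS]/(((t \in A) && (s < t)%N) && ((t \in A) && (t < s)%N)) AE inE.
by case: (ltngtP s t); rewrite ?andbF.
Qed.

Let above_ge S e : (e <= M.+1)%N -> (#|S| - e <= above S e)%N.
Proof.
move=> eM; rewrite leq_subLR.
have -> : #|S| = (#|[set s in S | (s < e)%N]%SET| + above S e)%N.
  rewrite /above -cardUI [X in (_ + X)%N]eq_card0 ?addn0 => [|s].
    by apply: eq_card => s; rewrite !inE; case: (ltnP s e); rewrite ?andbT ?andbF ?orbF.
  by rewrite !inE; case: (ltnP s e); rewrite ?andbF ?andbT // andbF.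
rewrite leq_add2r; apply: (@leq_trans #|[pred s : 'I_M.+1 | (s < e)%N]|).
  by apply/subset_leq_card/fintype.subsetP => s; rewrite !inE => /andP[].
by rewrite -sum1_card -(big_ord_widen _ (fun=> 1%N)) // sum1_card card_ord.
Qed.

Let slice S (G : nat -> F) :
  \prod_(s in S) \prod_(e < s) G e = \prod_(e < M) G e ^+ above S e.+1.
Proof.
transitivity (\prod_(s in S) \prod_(e < M | (e < s)%N) G e).
  by apply: eq_bigr => s _; rewrite -(big_ord_widen _ G) // -ltnS.
rewrite (exchange_big_dep predT) //=; apply: eq_bigr => e _.
rewrite prodr_const; congr (_ ^+ _); apply: eq_card => s.
by rewrite !inE.
Qed.

Let slice_pairs S : \prod_(s in S) \prod_(t in S | (s < t)%N) site s ^+ 2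
  = \prod_(e < M) x e.+1 ^+ (above S e.+1 * (above S e.+1).-1).
Proof.
transitivity (\prod_(s in S) \prod_(e < M | (e < s)%N)
    \prod_(t in S | (s < t)%N) x e.+1 ^+ 2).
  apply: eq_bigr => s _; rewrite exchange_big; apply: eq_bigr => t _.
  by rewrite prodrXl -(big_ord_widen _ (fun e => x e.+1)) // -ltnS.
rewrite (exchange_big_dep predT) //=; apply: eq_bigr => e _.
rewrite -above_pairs; under eq_bigr do rewrite prodrXr.
by rewrite prodrXr.
Qed.

(** The contribution of the empty diagram, which has [i - e.+1] sites above step [e.+1]. Once it is
    factored out, the empty diagram contributes 1 to [shape_sum]. *)
Let vacuum i r : F := \prod_(e < M) (c e.+1 * x e.+1 ^+ r / x e.+1) ^+ (i - e.+1).

Let vacuum_neq0 i r : vacuum i r != 0.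
Proof.
apply/prodf_neq0 => e _; apply: expf_neq0.
by rewrite !mulf_neq0 ?invr_eq0 ?expf_neq0.
Qed.

(** The total exponent of [z] is [N * (e - i + r + N - 1)] over the integers. With [N] split into
    the sites of the empty diagram and the boxes, the boxes of the diagonal get [r] plus the
    distance of [e] to [i] plus [2 t]. The powers of order [M.+1] only keep the index
    [r + (M.+1 - i)] non-negative. *)
Let slice_identity (u z : F) (e N i r : nat) : u != 0 -> z != 0 ->
  (i <= M.+1)%N -> (i - e <= N)%N ->
  (u * z ^+ e) ^+ N / (z ^+ M.+1) ^+ N * (z ^+ (r + (M.+1 - i))) ^+ N * z ^+ (N * N.-1)
  = (u * z ^+ r / z) ^+ (i - e)
    * \prod_(t < N - (i - e)) (u * z ^+ (r + ((e - i) + (i - e)) + t.*2)).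
Proof.
move=> u0 z0 iM eN; set N0 := (i - e)%N; set n := (N - N0)%N.
have prodE k m : \prod_(t < m) (u * z ^+ (k + t.*2)) = u ^+ m * z ^+ (k * m + m * m.-1).
  elim: m => [|m IHm]; first by rewrite big_ord0 muln0 !expr0 mulr1.
  rewrite big_ord_recr /= IHm mulrACA -exprSr -exprD; congr (_ * z ^+ _).
  by case: m {IHm} => [|m]; rewrite /= ?doubleS; lia.
have NE : N = (N0 + n)%N by rewrite /n /N0; lia.
have key : (e * N + (r + (M.+1 - i)) * N + N * N.-1 + N0
    = r * N0 + ((r + ((e - i) + N0)) * n + n * n.-1) + M.+1 * N)%N.
  have [l lE] : exists l, (M.+1 = i + l)%N by exists (M.+1 - i)%N; lia.
  rewrite NE lE addKn; case: (leqP i e) => ie.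
    have [k kE] : exists k, (e = i + k)%N by exists (e - i)%N; lia.
    have -> : N0 = 0%N by rewrite /N0; lia.
    by rewrite kE addKn; lia.
  have [k kE] : exists k, (i = e + k.+1)%N by exists (i - e).-1; lia.
  have -> : N0 = k.+1 by rewrite /N0; lia.
  have -> : (e - i = 0)%N by lia.
  by rewrite kE; case: (n) => [|m] /=; lia.
rewrite prodE !exprMn exprVn -!exprM.
have nzE m : z ^+ m != 0 by rewrite expf_neq0.
apply: (mulIf (nzE N0)); apply: (mulIf (nzE (M.+1 * N)%N)).
have := congr1 (fun m => z ^+ m) key; rewrite !exprD => E.
have -> : u ^+ N = u ^+ N0 * u ^+ n by rewrite -exprD -NE.
transitivity (u ^+ N0 * u ^+ n
    * (z ^+ (e * N) * z ^+ ((r + (M.+1 - i)) * N) * z ^+ (N * N.-1) * z ^+ N0)).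
  by field; rewrite !nzE.
by rewrite E; field; rewrite !nzE.
Qed.

(** Each Vandermonde factor is split as [site s ^+ 2 * (1 - site t / site s) ^+ 2] for [s < t]. The
    second part cancels the pairs of occupied sites in the weights and leaves the hooks; the first
    adds to the exponents of the boxes. *)
Lemma site_product i r S : #|S| = i ->
  (\prod_(s in S) (site_weight s * site s ^+ (r + (M.+1 - i)))
   * \prod_(s in S) \prod_(t in S | (s < t)%N) (site t - site s) ^+ 2)
  = vacuum i r * (box_prod i r S * hook_prod S).
Proof.
move=> Si; have iM : (i <= M.+1)%N by rewrite -Si -[X in (_ <= X)%N]card_ord max_card.
pose g (s t : 'I_M.+1) := 1 - site t / site s.
have g_neq0 (s t : 'I_M.+1) : (s < t)%N -> g s t != 0.
  move=> st; rewrite /g subr_eq0 eq_sym; apply/eqP => /(congr1 (fun u => u * site s)).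
  by rewrite divfK // mul1r => /esym/eqP; apply/negP/site_neq; rewrite st -ltnS /=.
have pairE (s t : 'I_M.+1) : (site t - site s) ^+ 2 = site s ^+ 2 * g s t ^+ 2.
  by rewrite -exprMn /g mulrBr mulr1 mulrCA divff // mulr1 -(sqrrN (_ - _)) opprB.
have -> : \prod_(s in S) \prod_(t in S | (s < t)%N) (site t - site s) ^+ 2
    = (\prod_(s in S) \prod_(t in S | (s < t)%N) site s ^+ 2)
      * \prod_(t in S) \prod_(s in S | (s < t)%N) g s t ^+ 2.
  rewrite [X in _ * X](exchange_big_dep (mem S)) => [|s t _ /andP[]//] /=.
  rewrite -big_split; apply: eq_bigr => s sS /=; rewrite sS -big_split.
  by apply: eq_bigr => t _; rewrite pairE.
have hookE : \prod_(s in S) \prod_(a < s) (1 - site s / site a) ^- 2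
    * \prod_(t in S) \prod_(s in S | (s < t)%N) g s t ^+ 2 = hook_prod S.
  rewrite -big_split; apply: eq_bigr => b bS /=.
  rewrite (@big_ord_widen F 1 *%R b M.+1 (fun a => (1 - site b / site a) ^- 2)); last exact: ltnW.
  rewrite (bigID (mem S)) /= mulrAC [X in X * _](_ : _ = 1) ?mul1r.
    by apply: eq_bigl => a; rewrite andbC.
  rewrite [X in X * _](_ : _ = \prod_(s in S | (s < b)%N) g s b ^- 2); last first.
    by apply: eq_bigl => a; rewrite andbC.
  by rewrite -big_split big1 //= => s /andP[_ sb]; rewrite mulVf ?expf_neq0 ?g_neq0.
pose G e := c e.+1 * x e.+1 ^+ e.+1 / x e.+1 ^+ M.+1 * x e.+1 ^+ (r + (M.+1 - i)).
have weightE (s : 'I_M.+1) : site_weight s * site s ^+ (r + (M.+1 - i))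
    = (\prod_(e < s) G e) * \prod_(a < s) (1 - site s / site a) ^- 2.
  have siteV : \prod_(e < s) x e.+1 ^- M.+1 = site s ^- M.+1 by rewrite prodfV prodrXl.
  by rewrite /site_weight mulrAC /G !big_split /= siteV !prodrXl.
rewrite (eq_bigr _ (fun s _ => weightE s)) big_split /= slice slice_pairs.
rewrite mulrACA hookE mulrA; congr (_ * _); rewrite -!big_split; apply: eq_bigr => e _ /=.
rewrite -slice_identity //; first by rewrite /G !exprMn exprVn.
by rewrite -Si above_ge // leqW.
Qed.

Lemma hankel_shape_sum i r :
  hankel site_moment i (r + (M.+1 - i)) = vacuum i r * shape_sum i r.
Proof.
rewrite hankel_site_moment /shape_sum mulr_sumr; apply: eq_bigr => S /eqP Si.
exact: site_product.
Qed.

(** The index shift [M.+1 - i] drops by one per site, which centres all the terms of the Hankel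
    identity at [r.+1]. The vacuum factors are geometric in [r]; comparing sizes [i], [i.+1] and
    [i.+2], they differ only at step [i.+1], which supplies the coefficient. *)
Theorem shape_sum_toda i r : (i < M)%N -> shape_sum i r.+1 != 0 ->
  shape_sum i.+1 r * shape_sum i.+1 r.+2 = shape_sum i.+1 r.+1 ^+ 2
    + c i.+1 * x i.+1 ^+ r * (shape_sum i r.+1 * shape_sum i.+2 r.+1).
Proof.
move=> iM nz; pose R := (r + (M.+1 - i.+1))%N.
have := hankel_toda (h := site_moment) (n := i) (r := R).
have -> : hankel site_moment i R.+2 = vacuum i r.+1 * shape_sum i r.+1.
  by rewrite -hankel_shape_sum; congr hankel; rewrite /R; lia.
have -> : hankel site_moment i.+2 R = vacuum i.+2 r.+1 * shape_sum i.+2 r.+1.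
  by rewrite -hankel_shape_sum; congr hankel; rewrite /R; lia.
have -> : hankel site_moment i.+1 R.+2 = vacuum i.+1 r.+2 * shape_sum i.+1 r.+2.
  by rewrite -hankel_shape_sum.
have -> : hankel site_moment i.+1 R.+1 = vacuum i.+1 r.+1 * shape_sum i.+1 r.+1.
  by rewrite -hankel_shape_sum.
rewrite hankel_shape_sum => /(_ (mulf_neq0 (vacuum_neq0 _ _) nz)) toda.
have vac1 : vacuum i.+1 r * vacuum i.+1 r.+2 = vacuum i.+1 r.+1 ^+ 2.
  rewrite /vacuum -prodrXl -big_split; apply: eq_bigr => e _ /=.
  by rewrite -exprMn -exprM mulnC exprM; congr (_ ^+ _); rewrite !exprS; field.
have vac2 : vacuum i.+2 r.+1 * vacuum i r.+1 = c i.+1 * x i.+1 ^+ r * vacuum i.+1 r.+1 ^+ 2.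
  rewrite /vacuum -prodrXl -big_split /= (bigD1 (Ordinal iM)) // [in RHS](bigD1 (Ordinal iM)) //=.
  have -> : (i.+2 - i.+1 = 1)%N by lia.
  rewrite subnn (_ : i - i.+1 = 0)%N ?expr1 ?expr0 ?expr1n ?mul1r ?mulr1; last by lia.
  rewrite exprSr mulrA mulfK //; congr (_ * _); apply: eq_bigr => e.
  rewrite -(inj_eq val_inj) /= => ei; rewrite -exprD -exprM; congr (_ ^+ _); lia.
apply: (mulfI (expf_neq0 2 (vacuum_neq0 i.+1 r.+1))).
set T := shape_sum in nz toda *.
transitivity (vacuum i.+2 r.+1 * T i.+2 r.+1 * (vacuum i r.+1 * T i r.+1)
    + (vacuum i.+1 r.+1 * T i.+1 r.+1) ^+ 2).
  by rewrite toda subrK -vac1 mulrACA.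
by rewrite [X in X + _]mulrACA vac2; ring.
Qed.

End TodaSum.

(** * Expansions up to a given degree *)

Section Expansion.
Variable n : nat.
Local Notation P := {mpoly int[n]}.
Local Notation K := {fraction P}.
Implicit Types (p q : P) (z : K) (d : nat).

Definition small d p := forall m, (mdeg m < d)%N -> p@_m = 0.

Lemma small0 d : small d 0.
Proof. by move=> m _; rewrite mcoeff0. Qed.

Lemma smallD d p q : small d p -> small d q -> small d (p + q).
Proof. by move=> sp sq m md; rewrite mcoeffD sp ?sq ?addr0. Qed.

Lemma smallN d p : small d p -> small d (- p).
Proof. by move=> sp m md; rewrite mcoeffN sp ?oppr0. Qed.

Lemma smallB d p q : small d p -> small d q -> small d (p - q).
Proof. by move=> sp sq; apply: smallD => //; apply: smallN. Qed.

Lemma small_sum d (I : Type) (r : seq I) (Q : pred I) (F : I -> P) :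
  (forall i, Q i -> small d (F i)) -> small d (\sum_(i <- r | Q i) F i).
Proof.
by move=> sF; elim/big_ind: _ => //; [exact: small0 | move=> *; exact: smallD].
Qed.

Lemma smallM d e p q : small d p -> small e q -> small (d + e) (p * q).
Proof.
move=> sp sq m md; rewrite mcoeffM big1 // => k /eqP mE.
have kd : (mdeg k.1 + mdeg k.2 < d + e)%N by rewrite -mdegD -mE.
have [k1|k1] := ltnP (mdeg k.1) d; first by rewrite sp ?mul0r.
rewrite [q@_ _]sq ?mulr0 // -(ltn_add2l d).
exact: leq_ltn_trans (leq_add k1 (leqnn _)) kd.
Qed.

Lemma smallMl d p q : small d p -> small d (p * q).
Proof. by move=> sp; rewrite -[d]addn0; apply: smallM. Qed.

Lemma small_leq d e p : (d <= e)%N -> small e p -> small d p.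
Proof. by move=> de sp m md; apply: sp; apply: leq_trans de. Qed.

Lemma smallX d p k : small d p -> small (d * k) (p ^+ k).
Proof.
move=> sp; elim: k => [|k IHk]; first by rewrite muln0.
by rewrite exprS mulnS; apply: smallM.
Qed.

Lemma small_X m : small (mdeg m) 'X_[m].
Proof. by move=> m' m'm; rewrite mcoeffX; case: eqP => // mE; rewrite mE ltnn in m'm. Qed.

Lemma small1 p : p@_0%MM = 0 -> small 1 p.
Proof. by move=> p0 m; rewrite ltnS leqn0 mdeg_eq0 => /eqP->. Qed.

Lemma mcoeff0M p q : (p * q)@_0%MM = p@_0%MM * q@_0%MM.
Proof.
have m0E (r : P) : r@_0%MM = meval (fun=> 0) r.
  rewrite mevalE; have -> : r@_0%MM = \sum_(m <- msupp r) r@_m * (m == 0%MM)%:R.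
    rewrite {1}(mpolyE r) raddf_sum; apply: eq_bigr => m _.
    by rewrite /= mcoeffZ mcoeffX.
  apply: eq_bigr => m _; congr (_ * _); case: eqP => [->|m0].
    by rewrite big1 // => i _; rewrite mnm0E.
  have [i mi] : exists i, m i != 0%N.
    apply/existsP; apply: contra_notT m0 => /existsPn m0; apply/mnmP => i.
    by have := m0 i; rewrite negbK mnm0E => /eqP.
  by rewrite (bigD1 i) //= expr0n (negbTE mi) mul0r.
by rewrite !m0E mevalM.
Qed.

(** In [p = p * q + p * (1 - q)] the factor [1 - q] has no constant term, so a bound for [p]
    improves by one degree at a time. *)
Lemma small_unit d p q : q@_0%MM = 1 -> small d (p * q) -> small d p.
Proof.
move=> q1; have sq : small 1 (1 - q).
  by apply: small1; rewrite mcoeffB q1 mcoeff1 eqxx subrr.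
elim: d => [|d IHd] spq //.
have -> : p = p * q + p * (1 - q) by ring.
apply: smallD => //; rewrite -addn1; apply: smallM => //; apply: IHd.
by apply: small_leq spq.
Qed.

Section Truncation.
Variable D : nat.

(* [z] is a quotient with constant term 1 in the denominator and [p] agrees
   with its power series up to degree [D - 1]. *)
Definition expands z p :=
  exists N Q, [/\ Q@_0%MM = 1, z * tofrac Q = tofrac N & small D (N - p * Q)].

Lemma expands_tofrac p : expands (tofrac p) p.
Proof.
by exists p, 1; rewrite mcoeff1 eqxx !mulr1 subrr; split=> //; apply: small0.
Qed.

Lemma expands_congr z p q : small D (p - q) -> expands z p -> expands z q.
Proof.
move=> spq [N [Q [Q1 zQ sN]]]; exists N, Q; split=> //.
have -> : N - q * Q = (N - p * Q) + (p - q) * Q by ring.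
by apply: smallD => //; apply: smallMl.
Qed.

Lemma expandsD z z' p p' : expands z p -> expands z' p' -> expands (z + z') (p + p').
Proof.
move=> [N [Q [Q1 zQ sN]]] [N' [Q' [Q'1 zQ' sN']]].
exists (N * Q' + N' * Q), (Q * Q'); split; first by rewrite mcoeff0M Q1 Q'1.
  by rewrite tofracD !tofracM -zQ -zQ'; ring.
have -> : N * Q' + N' * Q - (p + p') * (Q * Q')
  = (N - p * Q) * Q' + (N' - p' * Q') * Q by ring.
by apply: smallD; apply: smallMl.
Qed.

Lemma expandsM z z' p p' : expands z p -> expands z' p' -> expands (z * z') (p * p').
Proof.
move=> [N [Q [Q1 zQ sN]]] [N' [Q' [Q'1 zQ' sN']]].
exists (N * N'), (Q * Q'); split; first by rewrite mcoeff0M Q1 Q'1.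
  by rewrite !tofracM -zQ -zQ'; ring.
have -> : N * N' - p * p' * (Q * Q')
  = (N - p * Q) * N' + (N' - p' * Q') * (p * Q) by ring.
by apply: smallD; apply: smallMl.
Qed.

Lemma expands_sum (I : Type) (r : seq I) (C : pred I) (z : I -> K) (p : I -> P) :
  (forall i, C i -> expands (z i) (p i)) ->
  expands (\sum_(i <- r | C i) z i) (\sum_(i <- r | C i) p i).
Proof.
move=> zp; elim/big_rec2: _ => [|i q y Ci]; last by apply: expandsD; apply: zp.
by rewrite -tofrac0; apply: expands_tofrac.
Qed.

Lemma expands_prod (I : Type) (r : seq I) (C : pred I) (z : I -> K) (p : I -> P) :
  (forall i, C i -> expands (z i) (p i)) ->
  expands (\prod_(i <- r | C i) z i) (\prod_(i <- r | C i) p i).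
Proof.
move=> zp; elim/big_rec2: _ => [|i q y Ci]; last by apply: expandsM; apply: zp.
by rewrite -tofrac1; apply: expands_tofrac.
Qed.

Lemma expands_inv p q : p@_0%MM = 1 -> small D (1 - q * p) -> expands (tofrac p)^-1 q.
Proof.
move=> p1 spq; exists 1, p; split=> //; rewrite mulVf ?tofrac1 // tofrac_eq0.
by apply: contra_eq_neq p1 => ->; rewrite mcoeff0 eq_sym oner_eq0.
Qed.

Lemma expands_uniq z p q : expands z p -> expands z q -> small D (p - q).
Proof.
move=> [N [Q [Q1 zQ sN]]] [N' [Q' [Q'1 zQ' sN']]].
apply: (@small_unit _ _ (Q * Q')); first by rewrite mcoeff0M Q1 Q'1.
have NN' : N * Q' = N' * Q.
  by apply/eqP; rewrite -tofrac_eq !tofracM -zQ -zQ'; apply/eqP; ring.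
have -> : (p - q) * (Q * Q') = (N' - q * Q') * Q - (N - p * Q) * Q' + (N * Q' - N' * Q).
  by ring.
by rewrite NN' subrr addr0; apply: smallB; apply: smallMl.
Qed.

Hypothesis D_gt0 : (0 < D)%N.

Lemma expands_neq0 z p : p@_0%MM = 1 -> expands z p -> z != 0.
Proof.
move=> p1 [N [Q [Q1 zQ sN]]]; apply/eqP => z0; have := sN 0%MM.
move/eqP: zQ; rewrite z0 mul0r eq_sym tofrac_eq0 => /eqP->.
by rewrite mdeg0 mcoeffB mcoeff0 mcoeff0M p1 Q1 => /(_ D_gt0)/eqP.
Qed.

Lemma expands_div z z' p p' : p'@_0%MM = 1 ->
  expands z' p' -> expands (z * z') (p * p') -> expands z p.
Proof.
move=> p'1 [N' [Q' [Q'1 zQ' sN']]] [N [Q [Q1 zQ sN]]].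
have N'1 : N'@_0%MM = 1.
  have := sN' 0%MM; rewrite mdeg0 mcoeffB mcoeff0M p'1 Q'1 mulr1 => /(_ D_gt0)/eqP.
  by rewrite subr_eq0 => /eqP.
exists (N * Q'), (N' * Q); split; first by rewrite mcoeff0M N'1 Q1.
  by rewrite !tofracM -zQ' -zQ; ring.
have -> : N * Q' - p * (N' * Q)
  = (N - p * p' * Q) * Q' - (N' - p' * Q') * (p * Q) by ring.
by apply: smallB; apply: smallMl.
Qed.

End Truncation.

End Expansion.

(** * Shape sums as truncated power series *)

Section ShapePolynomial.
Variables (M D i0 : nat).
Local Notation P := {mpoly int[4]}.
Local Notation K := {fraction P}.
Implicit Types (S : {set 'I_M.+1}).

(* [y_1] and [y_1 y_3] on contents of the parity of the corner box, [y_0] and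
   [y_0 y_2] on the others. *)
Definition mnm_c (e : nat) : 'X_{1..4} :=
  if odd e == odd i0 then U_(inord 1)%MM else U_(inord 0)%MM.
Definition mnm_x (e : nat) : 'X_{1..4} :=
  if odd e == odd i0 then (U_(inord 1) + U_(inord 3))%MM
  else (U_(inord 0) + U_(inord 2))%MM.

Definition box_mnm i r S : 'X_{1..4} :=
  (\sum_(e < M) \sum_(t < above S e.+1 - (i - e.+1))
    (mnm_c e.+1 + mnm_x e.+1 *+ (r + ((e.+1 - i) + (i - e.+1)) + t.*2)))%MM.

Definition hook_mnm (a b : nat) : 'X_{1..4} :=
  (\sum_(e < M | (a <= e < b)%N) mnm_x e.+1)%MM.

(** Each geometric series is cut after [D] terms; this is exact below degree [D] because hook
    monomials have positive degree. *)
Definition shape_poly i r : P :=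
  \sum_(S : {set 'I_M.+1} | #|S| == i) 'X_[box_mnm i r S]
    * \prod_(b in S) \prod_(a < M.+1 | (a \notin S) && (a < b)%N)
        (\sum_(j < D) 'X_[hook_mnm a b *+ j]) ^+ 2.

Let c e : K := tofrac 'X_[mnm_c e].
Let x e : K := tofrac 'X_[mnm_x e].

Lemma mdeg_mnm_c e : mdeg (mnm_c e) = 1%N.
Proof. by rewrite /mnm_c; case: ifP => _; rewrite mdeg1. Qed.

Lemma mdeg_mnm_x e : mdeg (mnm_x e) = 2.
Proof. by rewrite /mnm_x; case: ifP => _; rewrite mdegD !mdeg1. Qed.

Lemma siteE s : (s <= M)%N -> site x s = tofrac 'X_[\sum_(e < M | (e < s)%N) mnm_x e.+1].
Proof.
move=> sM; rewrite -mprodXE rmorph_prod /site.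
by rewrite (big_ord_widen M (fun e => x e.+1)).
Qed.

Lemma site_ratio a b : (a < b <= M)%N -> site x b = site x a * tofrac 'X_[hook_mnm a b].
Proof.
move=> /andP[ab bM]; rewrite !siteE //; last exact: leq_trans (ltnW ab) bM.
rewrite -tofracM -mpolyXD; congr (tofrac 'X_[_]).
rewrite (bigID (fun e : 'I_M => (e < a)%N)) /=; congr (_ + _)%MM; apply: eq_bigl => e.
  by case: (ltnP e a) => ea; rewrite ?andbF // (ltn_trans ea ab).
by rewrite andbC -leqNgt.
Qed.

Lemma hook_mnm_neq0 a b : (a < b <= M)%N -> (0 < mdeg (hook_mnm a b))%N.
Proof.
move=> /andP[ab bM]; rewrite /hook_mnm (bigD1 (Ordinal (leq_trans ab bM))) /= ?leqnn ?ab //.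
by rewrite mdegD mdeg_mnm_x.
Qed.

Lemma x_neq0 e : x e != 0.
Proof. by rewrite /x tofrac_eq0 mpolyX_neq0. Qed.

Lemma c_neq0 e : c e != 0.
Proof. by rewrite /c tofrac_eq0 mpolyX_neq0. Qed.

Lemma site_neq a b : (a < b <= M)%N -> site x a != site x b.
Proof.
move=> ab; have sa : site x a != 0 by apply/prodf_neq0 => e _; apply: x_neq0.
rewrite (site_ratio ab) -{1}[site x a]mulr1 (inj_eq (mulfI sa)) -tofrac1 tofrac_eq.
apply/eqP => /(congr1 (mcoeff 0%MM)); rewrite mcoeff1 mcoeffX eqxx.
by have := hook_mnm_neq0 ab; rewrite lt0n mdeg_eq0 => /negbTE->.
Qed.

Lemma expands_hook a b : (a < b <= M)%N ->
  expands D ((1 - site x b / site x a) ^- 2) ((\sum_(j < D) 'X_[hook_mnm a b *+ j]) ^+ 2).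
Proof.
move=> ab; have sa : site x a != 0 by apply/prodf_neq0 => e _; apply: x_neq0.
rewrite (site_ratio ab) mulrAC divff // mul1r -tofrac1 -tofracB -exprVn.
have H : expands D (tofrac (1 - 'X_[hook_mnm a b]))^-1 (\sum_(j < D) 'X_[hook_mnm a b *+ j]).
  apply: expands_inv.
    rewrite mcoeffB mcoeff1 mcoeffX eqxx.
    by have := hook_mnm_neq0 ab; rewrite lt0n mdeg_eq0 => /negbTE->; rewrite subr0.
  have -> : \sum_(j < D) 'X_[hook_mnm a b *+ j]
      = \sum_(j < D) ('X_[hook_mnm a b] : P) ^+ j.
    by apply: eq_bigr => j _; rewrite mpolyXn.
  set h : P := 'X_[hook_mnm a b].
  have -> : 1 - (\sum_(j < D) h ^+ j) * (1 - h) = h ^+ D.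
    by rewrite -[RHS](subrK 1) subrX1; ring.
  apply: (@small_leq _ _ (mdeg (hook_mnm a b) * D)%N); last exact/smallX/small_X.
  by rewrite leq_pmull // hook_mnm_neq0.
by rewrite !expr2; apply: expandsM.
Qed.

Lemma box_prodE i r S : box_prod c x i r S = tofrac 'X_[box_mnm i r S].
Proof.
rewrite /box_mnm -mprodXE rmorph_prod; apply: eq_bigr => e _.
rewrite -mprodXE rmorph_prod; apply: eq_bigr => t _ /=.
by rewrite mpolyXD -mpolyXn tofracM tofracXn.
Qed.

Lemma expands_shape i r : expands D (shape_sum M c x i r) (shape_poly i r).
Proof.
apply: expands_sum => S _; apply: expandsM.
  by rewrite box_prodE; apply: expands_tofrac.
apply: expands_prod => b _; apply: expands_prod => a /andP[_ ab].
by apply: expands_hook; rewrite ab -ltnS /=.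
Qed.

(** Every diagram other than the empty one has a box, and a box alone has degree at least
    [2 r + 1]. *)
Lemma shape_poly_initial i r : (i <= M.+1)%N -> (D <= r.+1)%N -> small D (shape_poly i r - 1).
Proof.
move=> iM Dr; pose S0 := [set s : 'I_M.+1 | (s < i)%N]%SET.
have S0i : #|S0| = i.
  rewrite -sum1_card (eq_bigl (fun s : 'I_M.+1 => (s < i)%N)) => [|s]; last by rewrite inE.
  by rewrite -(big_ord_widen _ (fun=> 1%N)) // sum1_card card_ord.
have above0 e : (above S0 e <= i - e)%N.
  rewrite /above -sum1_card.
  rewrite (eq_bigl (fun s : 'I_M.+1 => (e <= s)%N && (s < i)%N)) => [|s]; last by rewrite !inE andbC.
  rewrite -(big_ord_widen_cond _ (fun s => (e <= s)%N) (fun=> 1%N)) //.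
  by rewrite -(big_geq_mkord e i predT (fun=> 1%N)) sum_nat_const_nat muln1.
have S0_term : 'X_[box_mnm i r S0] * \prod_(b in S0)
    \prod_(a < M.+1 | (a \notin S0) && (a < b)%N) (\sum_(j < D) 'X_[hook_mnm a b *+ j]) ^+ 2
    = 1 :> P.
  rewrite /box_mnm big1 => [|e _]; last first.
    by apply: big1 => t; have := ltn_ord t; rewrite ltn_subRL ltnNge (leq_trans (above0 _)) // leq_addr.
  rewrite mpolyX0 mul1r; apply: big1 => b; rewrite inE => bi.
  by apply: big1 => a; rewrite inE => /andP[ai ab]; rewrite (ltn_trans ab bi) in ai.
rewrite /shape_poly (bigD1 S0) ?S0i //= S0_term addrAC subrr add0r.
apply: small_sum => S /andP[/eqP Si SS0]; apply: smallMl.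
have [s sS si] : exists2 s : 'I_M.+1, s \in S & (i <= s)%N.
  apply/exists_inP; apply: contraNT SS0 => /exists_inPn Sle.
  rewrite eqEcard Si S0i leqnn andbT; apply/fintype.subsetP => s /Sle.
  by rewrite inE -ltnNge.
have s0 : (0 < s)%N.
  rewrite lt0n; apply: contraL sS => /eqP s0; move: si; rewrite s0 leqn0 => /eqP i_0.
  by move/eqP: Si; rewrite i_0 cards_eq0 => /eqP->; rewrite inE.
have sM : (s.-1 < M)%N by rewrite -ltnS prednK.
have n_gt0 : (0 < above S s.-1.+1 - (i - s.-1.+1))%N.
  rewrite prednK // (eqP (_ : i - s == 0)%N) ?subn0 //.
  by rewrite /above card_gt0; apply/set0Pn; exists s; rewrite inE sS leqnn.
apply: (small_leq _ (@small_X _ _)); rewrite /box_mnm (bigD1 (Ordinal sM)) //=.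
rewrite (bigD1 (Ordinal n_gt0)) //= !mdegD mdegMn mdeg_mnm_c mdeg_mnm_x.
apply: leq_trans Dr _; lia.
Qed.

End ShapePolynomial.

(** * Comparison of the recurrence with the Toda equation *)

Section StableLimit.
Local Notation P := {mpoly int[4]}.
Local Notation y i := ('X_(inord i%N) : P).
Variables (k : nat) (A B : nat -> P).
Hypothesis ones : starts_with_ones A B.
Hypothesis rec : coupled_recurrence (fun j => y 0 * (y 0 * y 2) ^+ (k.-1 - j))
                                    (fun j => y 1 * (y 1 * y 3) ^+ (k.-1 - j)) A B k.

(** The value at time [k.+1] depends on the sizes at distance at most [k.+1] from [i0]; with these
    constants they fill exactly the range 0, ..., [M.+1]. *)
Let M := (k + k).+1.
Let i0 := k.+1.
Let mixed j i := if odd i == odd i0 then B j else A j.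

Let mixed0 j i : (j <= k.+1)%N -> (mixed j i)@_0%MM = 1.
Proof.
suff AB l : (l <= k.+1)%N -> (A l)@_0%MM = 1 /\ (B l)@_0%MM = 1.
  by move=> /AB[a b]; rewrite /mixed; case: ifP.
case: ones => A0 A1 B0 B1.
elim/ltn_ind: l => -[|[|l]] IHl lk; rewrite ?A0 ?A1 ?B0 ?B1 ?mcoeff1 ?eqxx //.
have [rA rB] := rec lk.
have [a b] := IHl l (leqnSn _) (ltnW (ltnW lk)).
have [a' b'] := IHl l.+1 (ltnSn _) (ltnW lk).
have X0 n : ('X_(inord n) : P)@_0%MM = 0 by rewrite mcoeffX mnm1_eq0.
have := congr1 (mcoeff 0%MM) rA; have := congr1 (mcoeff 0%MM) rB.
rewrite !mcoeffD !expr2 !mcoeff0M a b a' b' !X0 !mul0r addr0 !mulr1 => -> ->.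
by [].
Qed.

Theorem stable_limit m : (mdeg m <= k)%N ->
  (B k.+1)@_m = (shape_poly M k.+1 i0 i0 0)@_m.
Proof.
pose c e := tofrac ('X_[mnm_c i0 e] : P); pose x e := tofrac ('X_[mnm_x i0 e] : P).
have toda := @shape_sum_toda _ M c x (fun e => c_neq0 i0 e) (fun e => x_neq0 i0 e)
  (fun a b => @site_neq M i0 a b).
(* Time [j] of the recurrence is the parameter [k.+1 - j] of the shape sums. The bounds on [i]
   describe the triangle on which both neighbouring sizes are known one unit of time earlier. *)
have claim j : (j <= k.+1)%N -> forall i, (j <= i)%N -> (i + j <= M.+1)%N ->
    expands k.+1 (shape_sum M c x i (k.+1 - j)) (mixed j i).
  elim/ltn_ind: j => j IHj jk i ji iM.
  have [j1|j1] := leqP j 1.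
    have -> : mixed j i = 1.
      by case: ones => A0 A1 B0 B1; case: j j1 {IHj jk ji iM} => [|[|]] // _;
        rewrite /mixed; case: ifP.
    apply: (expands_congr (p := shape_poly M k.+1 i0 i (k.+1 - j))).
      by apply: shape_poly_initial; lia.
    exact: expands_shape.
  case: j j1 IHj jk ji iM => [|[|j]] // _ IHj jk ji iM.
  case: i ji iM => [|i] // ji iM.
  (* Both equations give the product with the value two units of time earlier, which has constant
     term 1 and can be divided out. *)
  apply: (@expands_div _ k.+1 isT _ (shape_sum M c x i.+1 (k.+1 - j)) _ (mixed j i.+1)) => //.
  - by apply: mixed0; lia.
  - by apply: IHj => //; lia.
  have -> : (k.+1 - j = (k.+1 - j.+2).+2)%N by lia.
  rewrite toda; last 2 first.
  - by move: iM; rewrite /M; lia.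
  - have -> : ((k.+1 - j.+2).+1 = k.+1 - j.+1)%N by lia.
    apply: (@expands_neq0 _ k.+1 isT _ (mixed j.+1 i)) => //; first by apply: mixed0; lia.
    by apply: IHj => //; lia.
  have -> : ((k.+1 - j.+2).+1 = k.+1 - j.+1)%N by lia.
  have -> : mixed j.+2 i.+1 * mixed j i.+1 = mixed j.+1 i.+1 ^+ 2
      + 'X_[mnm_c i0 i.+1] * 'X_[mnm_x i0 i.+1] ^+ (k.+1 - j.+2)
        * (mixed j.+1 i * mixed j.+1 i.+2).
    have [rA rB] := rec jk.
    have -> : (k.+1 - j.+2 = k.-1 - j)%N by lia.
    rewrite /mixed /mnm_c /mnm_x /=; case: (odd i) (odd k) => -[] /=;
      by rewrite ?rA ?rB mpolyXD -?expr2.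
  apply: expandsD; rewrite ?expr2; apply: expandsM; try (by apply: IHj; lia).
    by rewrite /c /x -tofracXn -tofracM; apply: expands_tofrac.
  by apply: expandsM; apply: IHj; lia.
move=> mk; have := claim k.+1 (leqnn _) i0 (leqnn _).
rewrite subnn /mixed eqxx => /(_ _) expB.
have small_diff : small k.+1 (B k.+1 - shape_poly M k.+1 i0 i0 0).
  by apply: expands_uniq (expB _) (expands_shape _ _ _ _ _); rewrite /M /i0; lia.
by have := small_diff m mk; rewrite mcoeffB => /eqP; rewrite subr_eq0 => /eqP.
Qed.
End StableLimit.


(** * Shapes, reverse plane partitions and hooks *)

Section Configurations.
Variables (M i : nat).
Implicit Types (p : pred nat) (s e u v : nat).
Local Open Scope nat_scope.

Definition above_nat p e : nat := \sum_(e <= s < M.+1) p s.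

Definition config p := (forall s, p s -> s <= M) /\ above_nat p 0 = i.

Definition swap s a := if a == s then s.+1 else if a == s.+1 then s else a.

Lemma swapK s : involutive (swap s).
Proof.
move=> a; rewrite /swap; have [->|a1] := eqVneq a s; first by rewrite eqn_leq ltnn eqxx.
have [->|a2] := eqVneq a s.+1; first by rewrite eqxx.
by rewrite (negbTE a1) (negbTE a2).
Qed.

(** For [s] occupied and [s.+1] empty, this adds one corner box to the diagram. *)
Definition move s p : pred nat := fun a => p (swap s a).

Lemma moveK s p : move s (move s p) = p.
Proof. by apply/funext => a; rewrite /move swapK. Qed.

Lemma above_natS p e : e <= M -> above_nat p e = p e + above_nat p e.+1.
Proof. by move=> eM; rewrite /above_nat big_ltn. Qed.

Lemma above_nat_large p e : M < e -> above_nat p e = 0.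
Proof. by move=> eM; rewrite /above_nat big_geq. Qed.

Lemma above_nat_desc p e : above_nat p e.+1 <= above_nat p e <= (above_nat p e.+1).+1.
Proof.
have [eM|eM] := leqP e M; first by rewrite (@above_natS p e) //; case: (p e); rewrite ?add1n ?add0n leqnn leqnSn.
by rewrite !above_nat_large ?leqW.
Qed.

Lemma above_nat_bound p e : above_nat p 0 <= above_nat p e + e.
Proof. by elim: e => [|e IHe]; [rewrite addn0 | have := above_nat_desc p e; lia]. Qed.

Lemma above_nat_le p e : above_nat p e <= M.+1 - e.
Proof.
rewrite /above_nat -[_ - _]muln1 -sum_nat_const_nat; apply: leq_sum => s _.
by case: (p s).
Qed.

Lemma config_le p : config p -> i <= M.+1.
Proof. by case=> _ <-; have := above_nat_le p 0; rewrite subn0. Qed.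

Lemma above_nat_move p s e : p s -> ~~ p s.+1 -> s < M ->
  above_nat (move s p) e = above_nat p e + (e == s.+1).
Proof.
move=> ps pS sM; have [n] := ubnP (M.+1 - e); elim: n e => // n IHn e en.
have [eM|eM] := leqP e M; last first.
  by rewrite !above_nat_large // (_ : e == s.+1 = false) //; apply/eqP; lia.
rewrite !(@above_natS _ e) // IHn; last by lia.
rewrite /move /swap; case: eqP => [->|es]; first by rewrite eqxx ps (negbTE pS); case: eqP; lia.
by rewrite eqSS; case: eqP => [->|eS]; rewrite ?ps ?(negbTE pS); case: eqP; lia.
Qed.

(** Undoing a move lowers the sum of all [above_nat] by one. When no move can be undone, the
    occupied sites form an initial segment. *)
Lemma config_ind (Q : pred nat -> Prop) :
  (i <= M.+1 -> Q (fun s => s < i)) ->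
  (forall p s, config p -> p s -> ~~ p s.+1 -> s < M -> Q p -> Q (move s p)) ->
  forall p, config p -> Q p.
Proof.
move=> Q0 Qstep p; have [n] := ubnP (\sum_(e < M.+1) above_nat p e); elim: n p => // n IHn p pn pc.
have [|no_move] := pselect (exists s, [/\ p s.+1, ~~ p s & s < M]).
  move=> [s [pS ps sM]]; pose q := move s p.
  have qs : q s by rewrite /q /move /swap eqxx.
  have qS : ~~ q s.+1 by rewrite /q /move /swap eqxx; case: eqP => [|_ //]; lia.
  have pE : p = move s q by rewrite moveK.
  have aboveE e : above_nat p e = above_nat q e + (e == s.+1).
    by rewrite pE above_nat_move.
  have qc : config q.
    have [pM p0] := pc; split; last by rewrite -p0 aboveE addn0.
    move=> a; rewrite /q /move /swap; case: eqP => [->|_]; first by lia.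
    by case: eqP => [-> //|_ /pM].
  rewrite pE; apply: Qstep => //; apply: IHn => //.
  move: pn; under eq_bigr do rewrite aboveE.
  have sM' : s.+1 < M.+1 by [].
  by rewrite big_split /= [X in _ + X](bigD1 (Ordinal sM')) //= eqxx; lia.
have pM := pc.1.
have -> : p = (fun s => s < i); last by apply: Q0; apply: config_le pc.
have down s t : s <= t -> p t -> p s.
  move=> st; rewrite -(subnK st); elim: (t - s) => // d IHd pd; apply: IHd.
  apply/negPn/negP => pd'; apply: no_move; exists (d + s); split=> //.
  by have := pM _ pd; rewrite addSn.
have pE s : above_nat p s = i - s.
  elim: s => [|s IHs]; first by rewrite subn0 pc.2.
  have [sM|sM] := leqP s M; last first.
    by rewrite above_nat_large; have := config_le pc; lia.
  have := IHs; rewrite above_natS //; case ps: (p s) => /=; first by lia.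
  have -> : above_nat p s.+1 = 0; last by lia.
  rewrite /above_nat big_nat_cond big1 // => t /andP[/andP[st _] _].
  by case pt: (p t) => //; rewrite (down s t (ltnW st) pt) in ps.
apply/funext => s; apply/idP/idP => ps.
  have := pE s; rewrite above_natS ?pM // ps; lia.
apply/negPn/negP => ps'.
have := pE s; rewrite /above_nat big_nat_cond big1 => [|t /andP[/andP[st _] _]]; first by lia.
by case pt: (p t) => //; case/negP: ps'; apply: down st pt.
Qed.

(* The box in column [u] and row [v], both numbered from 1, has content
   [u - v], which is the step [i + u - v] between two sites. *)
Definition in_shape p u v := [&& 0 < u, 0 < v & v <= above_nat p (i + u - v)].

Lemma in_shape_initial u v : i <= M.+1 -> in_shape (fun s => s < i) u v = false.
Proof.
move=> iM; apply/negP => /and3P[u0 v0]; apply/negP; rewrite -ltnNge.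
have aboveE e : above_nat (fun s => s < i) e <= i - e.
  have [n] := ubnP (M.+1 - e); elim: n e => // n IHn e en.
  have [eM|eM] := leqP e M; last by rewrite above_nat_large.
  rewrite above_natS //; have := IHn e.+1 ltac:(lia).
  by case: (ltnP e i) => ei; lia.
by have := aboveE (i + u - v); lia.
Qed.

Definition corner_v p s := (above_nat p s.+1).+1.
Definition corner_u p s := corner_v p s + s.+1 - i.

Lemma corner_u_gt0 p s : config p -> 0 < corner_u p s.
Proof. by case=> _ pi; have := above_nat_bound p s.+1; rewrite /corner_u /corner_v pi; lia. Qed.

Lemma in_shape_move p s u v : config p -> p s -> ~~ p s.+1 -> s < M ->
  in_shape (move s p) u v
  = in_shape p u v || ((u == corner_u p s) && (v == corner_v p s)).
Proof.
move=> pc ps pS sM; have u0 := corner_u_gt0 s pc.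
have := above_nat_bound p s.+1; rewrite pc.2 => Ns.
rewrite /in_shape above_nat_move //.
case: u => [|u]; first by rewrite /= eq_sym; case: eqP u0 => // ->.
case: v => [|v]; first by rewrite /corner_v /= !andbF.
rewrite /=; case: eqP => [es|es].
  have -> : (u.+1 == corner_u p s) = (v.+1 == corner_v p s).
    by rewrite /corner_u /corner_v; apply/eqP/eqP; lia.
  by rewrite andbb es /corner_v; lia.
rewrite addn0; case: andP => [[/eqP u' /eqP v']|]; last by rewrite orbF.
by case: es; rewrite u' v' /corner_u /corner_v; lia.
Qed.

Lemma in_shape_left p u v : in_shape p u.+2 v -> in_shape p u.+1 v.
Proof.
move=> /and3P[_ v0 uv]; apply/and3P; split=> //; apply: leq_trans uv _.
have := above_nat_desc p (i + u.+1 - v) => /andP[le _].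
have [uv|uv] := leqP v (i + u.+1); last by rewrite (_ : i + u.+2 - v = i + u.+1 - v) //; lia.
by rewrite (_ : i + u.+2 - v = (i + u.+1 - v).+1) //; lia.
Qed.

Lemma in_shape_up p u v : in_shape p u v.+2 -> in_shape p u v.+1.
Proof.
move=> /and3P[u0 _ uv]; apply/and3P; split=> //.
have := above_nat_desc p (i + u - v.+2) => /andP[_ le].
have [uv'|uv'] := leqP v.+2 (i + u); last first.
  by rewrite (_ : i + u - v.+1 = i + u - v.+2) //; lia.
by rewrite (_ : i + u - v.+1 = (i + u - v.+2).+1) //; lia.
Qed.

Lemma in_shape_pos p u v : in_shape p u v -> 0 < u /\ 0 < v.
Proof. by case/and3P. Qed.

End Configurations.

(** * Toggling a diagonal of a reverse plane partition *)

Section Toggle.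
Local Open Scope nat_scope.
Implicit Types (L : nat -> nat -> bool) (f g : nat -> nat -> nat).

(* Boxes are numbered from 1 and a diagram is given by its indicator function. *)
Definition diagram L :=
  [/\ forall u v, L u v -> 0 < u /\ 0 < v,
      forall u v, L u.+2 v -> L u.+1 v & forall u v, L u v.+2 -> L u v.+1].

Lemma diagram_down L u v u' v' : diagram L -> L u v ->
  0 < u' <= u -> 0 < v' <= v -> L u' v'.
Proof.
case=> [pos left up] Luv /andP[u'0 u'u] /andP[v'0 v'v].
have : L u' v.
  move: Luv; rewrite -(subnKC u'u); elim: (u - u') => [|d IHd]; first by rewrite addn0.
  by rewrite addnS; case: u' u'0 {u'u} IHd => // u' _ IHd; rewrite addSn => /left /IHd.
rewrite -(subnKC v'v); elim: (v - v') => [|d IHd]; first by rewrite addn0.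
by rewrite addnS; case: v' v'0 {v'v} IHd => // v' _ IHd; rewrite addSn => /up /IHd.
Qed.

Definition rpp L f :=
  (forall u v, ~~ L u v -> f u v = 0) /\
  (forall u v, L u v -> f u.-1 v <= f u v /\ f u v.-1 <= f u v).

Variables (L L' : nat -> nat -> bool) (u0 v0 : nat).
Hypothesis (dL : diagram L) (dL' : diagram L').
Hypothesis LE : forall u v, L' u v = L u v || ((u == u0) && (v == v0)).
Hypothesis Ncorner : ~~ L u0 v0.

Let on u v := [&& 0 < u, u < u0, 0 < v & v + u0 == u + v0].

Let tog f u v := if on u v
  then minn (f u.+1 v) (f u v.+1) + maxn (f u.-1 v) (f u v.-1) - f u v else f u v.

(* Local transformation of the Robinson-Schensted-Knuth correspondence: when the
   corner box is added with excess [n] over its neighbours, the other entries on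
   its diagonal are reflected between the bounds imposed by their neighbours.
   Hence only the sum over that diagonal changes, see [trace_add_corner]. *)
Definition add_corner n f u v :=
  if (u == u0) && (v == v0) then n + maxn (f u0.-1 v0) (f u0 v0.-1) else tog f u v.

Definition remove_corner f u v :=
  if (u == u0) && (v == v0) then 0 else tog f u v.

Definition corner_excess f := f u0 v0 - maxn (f u0.-1 v0) (f u0 v0.-1).

Let corner_pos : 0 < u0 /\ 0 < v0.
Proof. by case: dL' => pos _ _; apply: pos; rewrite LE !eqxx orbT. Qed.

Let L'corner : L' u0 v0.
Proof. by rewrite LE !eqxx orbT. Qed.

Let on_lower u v : on u v -> [/\ L u v, L u.+1 v & L u v.+1].
Proof.
case/and4P=> up uu vp /eqP uv.
have L'd x y : 0 < x <= u.+1 -> 0 < y <= v.+1 -> L' x y.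
  by move=> xu yv; apply: (diagram_down dL' L'corner); lia.
have Ld x y : x <= u0 -> L' x y -> (x != u0) || (y != v0) -> L x y.
  by rewrite LE => _ /orP[//|/andP[/eqP-> /eqP->]]; rewrite !eqxx.
by split; apply: Ld; (try apply: L'd); lia.
Qed.

Let off u v : on u v -> [/\ on u.+1 v = false, on u v.+1 = false,
  on u.-1 v = false & on u v.-1 = false].
Proof. by case/and4P=> up uu vp /eqP uv; split; apply/negP => /and4P[_ _ _ /eqP]; lia. Qed.

Let mono f := forall u v, L u v -> f u.-1 v <= f u v /\ f u v.-1 <= f u v.

Let tog_bounds f u v : mono f -> on u v ->
  [/\ f u.-1 v <= f u v, f u v.-1 <= f u v, f u v <= f u.+1 v & f u v <= f u v.+1].
Proof.
move=> mf uv; have [a b c] := on_lower uv.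
by have [m1 m2] := mf _ _ a; have [m3 _] := mf _ _ b; have [_ m4] := mf _ _ c.
Qed.

Let tog_off f u v : on u v = false -> tog f u v = f u v.
Proof. by rewrite /tog => ->. Qed.

Let nbr_not_corner u v u' v' : L u v -> (u' = u.-1 /\ v' = v) \/ (u' = u /\ v' = v.-1) ->
  (u' == u0) && (v' == v0) = false.
Proof.
move=> Luv nbr; apply/negP => /andP[/eqP u'E /eqP v'E]; case/negP: Ncorner.
by apply: (diagram_down dL Luv); have [] := corner_pos; lia.
Qed.

(** Boxes of one diagonal are never adjacent, so every reflected entry stays between bounds that do
    not move. *)
Let tog_mono f : mono f -> mono (tog f).
Proof.
move=> mf u v Luv; have [up vp] : 0 < u /\ 0 < v by case: dL => pos _ _; apply: pos.
have [m1 m2] := mf _ _ Luv.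
have [uvon|uvoff] := boolP (on u v).
  have [_ _ off1 off2] := off uvon; have [b1 b2 b3 b4] := tog_bounds mf uvon.
  by rewrite (tog_off f off1) (tog_off f off2) /tog uvon; lia.
rewrite [tog f u v]tog_off ?(negbTE uvoff) //.
have above u' v' : (u' = u.-1 /\ v' = v) \/ (u' = u /\ v' = v.-1) -> tog f u' v' <= f u v.
  move=> nbr; rewrite /tog; case: ifP => [uvon|_]; last by case: nbr => -[-> ->].
  have [b1 b2 b3 b4] := tog_bounds mf uvon.
  have : f u v = f u'.+1 v' \/ f u v = f u' v'.+1.
    by case: nbr => -[-> ->]; [left | right]; rewrite prednK.
  by case=> ->; lia.
by split; apply: above; [left | right].
Qed.

Let not_corner u v : L u v -> (u == u0) && (v == v0) = false.
Proof. by move=> Luv; apply/negP => /andP[/eqP uE /eqP vE]; rewrite uE vE (negbTE Ncorner) in Luv. Qed.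

Let mono_sub f : rpp L' f -> mono f.
Proof. by case=> _ mf u v Luv; apply: mf; rewrite LE Luv. Qed.

Let near_corner : [/\ on u0.-1 v0 = false, on u0 v0.-1 = false,
  (u0.-1 == u0) && (v0 == v0) = false & (u0 == u0) && (v0.-1 == v0) = false].
Proof.
have [up vp] := corner_pos; split; apply/negP.
- by case/and4P=> _ _ _ /eqP; lia.
- by case/and4P=> _ _ _ /eqP; lia.
- by case/andP=> /eqP; lia.
- by case/andP=> _ /eqP; lia.
Qed.

Lemma add_corner_rpp n f : rpp L f -> rpp L' (add_corner n f).
Proof.
move=> [f0 mf]; split=> u v.
  rewrite LE negb_or => /andP[uv /negbTE uvc]; rewrite /add_corner uvc /tog.
  by case: ifP => [/on_lower[Luv]|_]; [rewrite Luv in uv | apply: f0].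
rewrite /add_corner; have [uvc|uvc] := boolP ((u == u0) && (v == v0)).
  case/andP: uvc => /eqP-> /eqP-> _; have [o1 o2 -> ->] := near_corner.
  by rewrite (tog_off f o1) (tog_off f o2); lia.
rewrite LE (negbTE uvc) orbF => Luv; have [t1 t2] := tog_mono mf Luv.
have cl : (u.-1 == u0) && (v == v0) = false.
  by apply: (nbr_not_corner Luv); left.
have cr : (u == u0) && (v.-1 == v0) = false.
  by apply: (nbr_not_corner Luv); right.
by rewrite cl cr.
Qed.

Lemma remove_corner_rpp f : rpp L' f -> rpp L (remove_corner f).
Proof.
move=> rf; have [f0 _] := rf; split=> u v.
  move=> uv; rewrite /remove_corner; case: ifP => // uvc; rewrite /tog.
  by case: ifP => [/on_lower[Luv]|_]; [rewrite Luv in uv | apply: f0; rewrite LE (negbTE uv) uvc].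
move=> Luv; have [t1 t2] := tog_mono (mono_sub rf) Luv.
have cl : (u.-1 == u0) && (v == v0) = false.
  by apply: (nbr_not_corner Luv); left.
have cr : (u == u0) && (v.-1 == v0) = false.
  by apply: (nbr_not_corner Luv); right.
by rewrite /remove_corner (not_corner Luv) cl cr.
Qed.

Let toggle_involution a b c d x : c <= x -> d <= x -> x <= a -> x <= b ->
  minn a b + maxn c d - (minn a b + maxn c d - x) = x.
Proof. lia. Qed.

Let on_nbr u v : on u v ->
  [/\ (u.+1 == u0) && (v == v0) = false, (u == u0) && (v.+1 == v0) = false,
      (u.-1 == u0) && (v == v0) = false, (u == u0) && (v.-1 == v0) = false
    & (u == u0) && (v == v0) = false].
Proof.
case/and4P=> up uu vp /eqP uv; split; apply/negP => /andP[/eqP uE /eqP vE]; lia.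
Qed.

Lemma add_cornerK n f : rpp L f -> remove_corner (add_corner n f) = f.
Proof.
move=> [f0 mf]; apply/funext => u; apply/funext => v; rewrite /remove_corner.
case: ifP => [/andP[/eqP-> /eqP->]|uvc]; first by rewrite f0.
rewrite {1}/tog; case: ifP => uvon; last by rewrite /add_corner uvc tog_off.
have [c1 c2 c3 c4 c5] := on_nbr uvon; have [o1 o2 o3 o4] := off uvon.
have [b1 b2 b3 b4] := tog_bounds mf uvon.
rewrite /add_corner c1 c2 c3 c4 c5 (tog_off f o1) (tog_off f o2) (tog_off f o3) (tog_off f o4).
by rewrite /tog uvon; exact: toggle_involution.
Qed.

Lemma corner_excess_add n f : rpp L f -> corner_excess (add_corner n f) = n.
Proof.
move=> rf; rewrite /corner_excess /add_corner; have [o1 o2 -> ->] := near_corner.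
by rewrite !eqxx (tog_off f o1) (tog_off f o2) addnK.
Qed.

Lemma remove_cornerK f : rpp L' f -> add_corner (corner_excess f) (remove_corner f) = f.
Proof.
move=> rf; have [f0 mf] := rf; apply/funext => u; apply/funext => v.
rewrite /add_corner; case: ifP => [/andP[/eqP-> /eqP->]|uvc].
  have [o1 o2 c1 c2] := near_corner; rewrite /remove_corner c1 c2.
  rewrite (tog_off f o1) (tog_off f o2) /corner_excess.
  by have [m1 m2] := mf _ _ L'corner; lia.
rewrite {1}/tog; case: ifP => uvon; last by rewrite /remove_corner uvc tog_off.
have [c1 c2 c3 c4 c5] := on_nbr uvon; have [o1 o2 o3 o4] := off uvon.
have [b1 b2 b3 b4] := tog_bounds (mono_sub rf) uvon.
rewrite /remove_corner c1 c2 c3 c4 c5 (tog_off f o1) (tog_off f o2) (tog_off f o3) (tog_off f o4).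
by rewrite /tog uvon; exact: toggle_involution.
Qed.

Variables (i e0 B : nat).
Hypothesis e0E : i + u0 = v0 + e0.
Hypothesis e0_gt0 : 0 < e0.
Hypothesis u0B : u0 <= B.

(** When [u + i < e] the truncated row index is 0, where a reverse plane partition vanishes, so such
    terms add nothing. *)
Definition trace e f := \sum_(u < B.+1) f u (u + i - e).

Lemma trace_add_corner_neq n f e : e != e0 -> trace e (add_corner n f) = trace e f.
Proof.
move=> ee0; apply: eq_bigr => u _; have [up vp] := corner_pos.
rewrite /add_corner; case: ifP => [/andP[/eqP uE /eqP vE]|_].
  by case/eqP: ee0; lia.
rewrite tog_off //; apply/negP => /and4P[_ _ vv /eqP uv]; case/eqP: ee0; lia.
Qed.

(** A toggled entry and its old value add up to the larger of its left and upper neighbours plus the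
    smaller of the other two. Consecutive boxes of the diagonal share two neighbours, whose maximum
    and minimum recombine into their sum; the corner adds [n] and its larger neighbour. *)
Lemma trace_add_corner n f : rpp L f ->
  trace e0 (add_corner n f) + trace e0 f = n + (trace e0.-1 f + trace e0.+1 f).
Proof.
move=> rf; have [f0 mf] := rf; have [up vp] := corner_pos.
have fu0 v : f 0 v = 0 by apply: f0; apply/negP; case: dL => pos _ _ /pos[].
have fv0 u : f u 0 = 0 by apply: f0; apply/negP; case: dL => pos _ _ /pos[].
have f_out u v : u0 <= u -> v0 <= v -> f u v = 0.
  move=> uu vv; apply: f0; apply: contra Ncorner => Luv.
  by apply: (diagram_down dL Luv); lia.
(* For the box of diagonal [e0] in column [u.+1], [P u] and [Q u] are its left and upper neighbours,
   [P u.+1] and [Q u.+1] its lower and right ones. *)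
pose P u := f u (u + i + 1 - e0); pose Q u := f u.+1 (u + i - e0).
have sum_cut (h : nat -> nat) m : (forall u, m <= u -> h u = 0) -> m <= B ->
    \sum_(u < B) h u = \sum_(u < m) h u.
  move=> h0 mB; rewrite (big_ord_widen B h mB) [LHS](bigID (fun u : 'I_B => u < m)) /=.
  by rewrite [X in _ + X]big1 ?addn0 // => u; rewrite -leqNgt => /h0.
have sum_last (h : nat -> nat) w : 0 < w -> \sum_(u < w) h u = \sum_(u < w.-1) h u + h w.-1.
  by case: w => // w _; rewrite big_ord_recr.
have trP : trace e0.-1 f = \sum_(u < u0) P u.
  rewrite /trace big_ord_recr /= [X in _ + X]f_out ?addn0; last 2 first; try lia.
  rewrite -(@sum_cut P u0) //; last by move=> u uu; apply: f_out; lia.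
  by apply: eq_bigr => u _; rewrite /P; congr f; lia.
have trQ : trace e0.+1 f = \sum_(u < u0) Q u.
  rewrite /trace big_ord_recl fu0 add0n -(@sum_cut Q u0) // => u uu.
  by apply: f_out; lia.
have tr0 : trace e0 f = \sum_(u < u0.-1) f u.+1 (u.+1 + i - e0).
  rewrite /trace big_ord_recl fu0 add0n.
  rewrite -(@sum_cut (fun u => f u.+1 (u.+1 + i - e0)) u0.-1); last 2 first; try lia.
    by move=> u uu; apply: f_out; lia.
  by apply: eq_bigr => u _; rewrite /= /bump /=; congr f; lia.
have [g0 _] := add_corner_rpp n rf.
set g := add_corner n f in g0 *.
have tr0' : trace e0 g = \sum_(u < u0.-1) g u.+1 (u.+1 + i - e0)
    + (n + maxn (P u0.-1) (Q u0.-1)).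
  rewrite /trace big_ord_recl {1}/g /add_corner /tog /on /= [0 == u0]eq_sym.
  rewrite (gtn_eqF up) /= fu0 add0n.
  transitivity (\sum_(u < u0) g u.+1 (u.+1 + i - e0)).
    rewrite -(@sum_cut (fun u => g u.+1 (u.+1 + i - e0)) u0) // => u uu.
    apply: g0; rewrite LE negb_or; apply/andP; split.
      by apply: contra Ncorner => Luv; apply: (diagram_down dL Luv); lia.
    by apply/negP => /andP[/eqP]; lia.
  rewrite (@sum_last (fun u => g u.+1 (u.+1 + i - e0)) u0) //; congr (_ + _).
  rewrite /g /add_corner prednK // eqxx (_ : u0 + i - e0 == v0); last by apply/eqP; lia.
  by rewrite /= /P /Q prednK //; congr (_ + maxn (f _ _) (f _ _)); lia.
have pair u : u < u0.-1 -> g u.+1 (u.+1 + i - e0) + f u.+1 (u.+1 + i - e0)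
    = maxn (P u) (Q u) + minn (P u.+1) (Q u.+1).
  move=> uu; have [uv|uv] := leqP (u.+1 + i) e0.
    have vE : u.+1 + i - e0 = 0 by lia.
    have w1 : u + i + 1 - e0 = 0 by lia.
    have w2 : u + i - e0 = 0 by lia.
    rewrite /P /Q vE w1 w2 !fv0 minn0 maxnn addn0 /g /add_corner /tog /on andbF.
    by rewrite [0 == v0]eq_sym (gtn_eqF vp) andbF /= fv0.
  have uvon : on u.+1 (u.+1 + i - e0) by apply/and4P; split; try apply/eqP; clear -uu uv e0E up vp; lia.
  have [_ _ _ _ c5] := on_nbr uvon.
  have [b1 b2 b3 b4] := tog_bounds mf uvon.
  rewrite /g /add_corner c5 /tog uvon.
  have -> : P u = f u (u.+1 + i - e0) by rewrite /P; congr f; lia.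
  have -> : Q u = f u.+1 (u.+1 + i - e0).-1 by rewrite /Q; congr f; lia.
  have -> : P u.+1 = f u.+1 (u.+1 + i - e0).+1 by rewrite /P; congr f; lia.
  have -> : Q u.+1 = f u.+2 (u.+1 + i - e0) by rewrite /Q; congr f; lia.
  by move: b1 b2 b3 b4 => /=; lia.
have telescope w : \sum_(u < w) (maxn (P u) (Q u) + minn (P u.+1) (Q u.+1)) + maxn (P w) (Q w)
    = \sum_(u < w.+1) (P u + Q u).
  elim: w => [|w IHw].
    by rewrite big_ord0 big_ord_recl big_ord0 /P fu0 max0n !add0n addn0.
  have mm a b : minn a b + maxn a b = a + b by lia.
  by rewrite big_ord_recr [RHS]big_ord_recr /= -IHw -!addnA mm.
have := telescope u0.-1; rewrite prednK // => tel.
have -> : trace e0.-1 f + trace e0.+1 f = \sum_(u < u0) (P u + Q u).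
  by rewrite trP trQ big_split.
rewrite -tel tr0 tr0' addnAC -big_split /=.
rewrite addnCA; congr (_ + (_ + _)); apply: eq_bigr => u _; exact: pair.
Qed.

End Toggle.

(** * From reverse plane partitions to arrays on hooks *)

Section HookBijection.
Variables (M i : nat).
Implicit Types (p : pred nat) (s e : nat) (k f : nat -> nat -> nat).
Local Open Scope nat_scope.

(* The hooks of a shape correspond to the pairs of an empty site [a] and an
   occupied site [b > a]. *)
Definition hook p a b := [&& ~~ p a, p b & a < b].

Definition hook_array p k := forall a b, ~~ hook p a b -> k a b = 0.

Definition hook_trace e k := \sum_(a < M.+1) \sum_(b < M.+1) k a b * (a < e <= b).

Definition shape_trace := trace i M.+1.

Lemma swap_le s a : s < M -> a <= M -> swap s a <= M.
Proof. by rewrite /swap; case: eqP => // _; case: eqP => // ->; lia. Qed.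

Lemma hook_trace_move p s k n e : config M i p -> p s -> ~~ p s.+1 -> s < M ->
  hook_array p k ->
  hook_trace e (fun a b => n * ((a == s) && (b == s.+1)) + k (swap s a) (swap s b))
  = n * (e == s.+1) + \sum_(a < M.+1) \sum_(b < M.+1) k a b * (swap s a < e <= swap s b).
Proof.
move=> pc ps pS sM kp; rewrite /hook_trace.
under eq_bigr => a _ do (under eq_bigr => b _ do rewrite mulnDl; rewrite big_split /=).
rewrite big_split /=; congr (_ + _).
  have s1 : s < M.+1 by lia.
  have s2 : s.+1 < M.+1 by lia.
  rewrite (bigD1 (Ordinal s1)) //= [X in _ + X]big1 ?addn0 => [|a]; last first.
    rewrite -(inj_eq val_inj) /= => /negbTE->.
    by apply: big1 => b _; rewrite andFb muln0.
  rewrite (bigD1 (Ordinal s2)) //= [X in _ + X]big1 ?addn0 => [|b]; last first.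
    by rewrite -(inj_eq val_inj) /= => /negbTE->; rewrite andbF muln0.
  by rewrite !eqxx muln1; congr (_ * nat_of_bool _); lia.
pose h (a : 'I_M.+1) : 'I_M.+1 := inord (swap s a).
have hE a : h a = swap s a :> nat by rewrite inordK // ltnS swap_le // -ltnS.
have hK : involutive h by move=> a; apply: val_inj; rewrite /= !hE swapK.
rewrite (reindex_inj (inv_inj hK)); apply: eq_bigr => a _.
rewrite (reindex_inj (inv_inj hK)); apply: eq_bigr => b _.
by rewrite !hE !swapK.
Qed.

Lemma hook_trace_move_neq p s k n e : config M i p -> p s -> ~~ p s.+1 -> s < M ->
  hook_array p k -> e != s.+1 ->
  hook_trace e (fun a b => n * ((a == s) && (b == s.+1)) + k (swap s a) (swap s b))
  = hook_trace e k.
Proof.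
move=> pc ps pS sM kp es; rewrite (hook_trace_move _ _ pc ps pS) // (negbTE es) muln0.
apply: eq_bigr => a _; apply: eq_bigr => b _; congr (_ * nat_of_bool _).
by rewrite /swap; do 2!case: eqP => ?; do 2?case: eqP => ?; lia.
Qed.

(** A hook [(a, b)] of [p] has [a != s] and [b != s.+1], and then the relation holds entry by entry.
    It is the relation of [trace_add_corner], so both kinds of trace evolve alike. *)
Lemma hook_trace_move_eq p s k n : config M i p -> p s -> ~~ p s.+1 -> s < M ->
  hook_array p k ->
  hook_trace s.+1 (fun a b => n * ((a == s) && (b == s.+1)) + k (swap s a) (swap s b))
    + hook_trace s.+1 k
  = n + (hook_trace s k + hook_trace s.+2 k).
Proof.
move=> pc ps pS sM kp; rewrite (hook_trace_move _ _ pc ps pS) // eqxx muln1 -addnA.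
congr (_ + _); rewrite -!big_split /=; apply: eq_bigr => a _.
rewrite -!big_split /=; apply: eq_bigr => b _; rewrite -!mulnDr.
have [|/kp->//] := boolP (hook p a b); case/and3P => pa pb ab; congr (_ * _).
have /eqP as_ : a != s :> nat by apply: contraNneq pa => ->.
have /eqP bs : b != s.+1 :> nat by apply: contraTneq pb => ->.
rewrite /swap; do 2?case: eqP => //= ?; do 2?case: eqP => //= ?; lia.
Qed.

Definition hook_bijection p (Phi Psi : (nat -> nat -> nat) -> nat -> nat -> nat) :=
  (forall f, rpp (in_shape M i p) f ->
    [/\ hook_array p (Phi f), Psi (Phi f) = f
      & forall e, shape_trace e f = hook_trace e (Phi f)]) /\
  (forall k, hook_array p k -> rpp (in_shape M i p) (Psi k) /\ Phi (Psi k) = k).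

Lemma in_shape_diagram p : diagram (in_shape M i p).
Proof.
by split; [apply: in_shape_pos | apply: in_shape_left | apply: in_shape_up].
Qed.

Lemma hook_move p s a b : p s -> ~~ p s.+1 ->
  hook (move s p) a b = hook p (swap s a) (swap s b) || ((a == s) && (b == s.+1)).
Proof.
move=> ps pS; rewrite /hook /move.
have [->|as_] := eqVneq a s; first have [->|bs] := eqVneq b s.+1.
- rewrite /swap !eqxx (_ : s.+1 == s = false) ?ps ?pS ?ltnSn ?orbT //.
  by apply/eqP; lia.
- rewrite andbF orbF; congr [&& _, _ & _].
  by rewrite /swap eqxx; do 2?case: eqP => ?; lia.
rewrite orbF; case paE: (p (swap s a)) => //=; case pbE: (p (swap s b)) => //=.
move: paE pbE; rewrite /swap (negbTE as_); case: eqP => [-> |aS]; first by rewrite ps.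
case: eqP => [->|bs]; first by rewrite (negbTE pS).
by case: eqP => [-> _ _|bS _ _] //; lia.
Qed.

(** A move exchanges [s] and [s.+1] in the old hooks and creates the hook [(s, s.+1)], which stores
    the excess of the new corner. *)
Theorem hook_bijection_exists p : config M i p -> exists Phi Psi, hook_bijection p Phi Psi.
Proof.
move: p; apply: config_ind => [iM|p s pc ps pS sM [Phi [Psi [bij1 bij2]]]].
  pose z (f : nat -> nat -> nat) (a b : nat) := 0; exists z, z.
  have z0 f : (forall u v, f u v = 0) -> z f = f.
    by move=> f0; apply/funext => u; apply/funext => v; rewrite f0.
  split=> f.
    case=> f0 _; have f0' u v : f u v = 0 by apply: f0; rewrite in_shape_initial.
    split=> //; first by rewrite z0 // z0.
    by move=> e; rewrite [LHS]big1 // [RHS]big1 // => a _; rewrite big1.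
  move=> fp; have f0 a b : f a b = 0 by apply: fp; rewrite /hook /=; lia.
  by rewrite !z0 //; split=> //; split=> // u v _; rewrite !f0.
pose u0 := corner_u M i p s; pose v0 := corner_v M p s.
have dL := in_shape_diagram p; have dL' := in_shape_diagram (move s p).
have LE u v : in_shape M i (move s p) u v = in_shape M i p u v || ((u == u0) && (v == v0)).
  by rewrite in_shape_move.
have u0_gt0 : 0 < u0 by apply: corner_u_gt0.
have v0E : v0 = (above_nat M p s.+1).+1 by [].
have u0E : i + u0 = v0 + s.+1.
  have := above_nat_bound M p s.+1; rewrite pc.2 /u0 /corner_u -/v0 v0E; lia.
have Ncorner : ~~ in_shape M i p u0 v0.
  apply/negP => /and3P[_ _]; rewrite u0E addKn v0E; lia.
have u0M : u0 <= M.+1.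
  have N2 : above_nat M p s.+1 = above_nat M p s.+2 by rewrite above_natS // (negbTE pS).
  by move: u0E (above_nat_le M p s.+2); rewrite v0E N2; lia.
have swap_s a : (swap s a == s) = (a == s.+1).
  rewrite /swap; have [->|a1] := eqVneq a s; first by rewrite eq_sym.
  by case: (eqVneq a s.+1) => _; rewrite ?eqxx ?(negbTE a1).
have swap_S a : (swap s a == s.+1) = (a == s).
  rewrite /swap; case: (eqVneq a s) => [_|a1]; first by rewrite eqxx.
  case: (eqVneq a s.+1) => [_|a2]; last exact: negbTE.
  by apply/negbTE/eqP; lia.
have not_hook : ~~ hook p s.+1 s by rewrite /hook; lia.
exists (fun f a b => corner_excess u0 v0 f * ((a == s) && (b == s.+1))
                     + Phi (remove_corner u0 v0 f) (swap s a) (swap s b)).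
(* The exchange would send the new hook to [(s.+1, s)], which is not a hook of [p]; that entry is
   reset to 0 before the old inverse is applied. *)
exists (fun k => add_corner u0 v0 (k s s.+1)
  (Psi (fun a b => if (a == s.+1) && (b == s) then 0 else k (swap s a) (swap s b)))).
split=> [f rf|k kp].
  have rg := remove_corner_rpp dL dL' LE Ncorner rf.
  have [Phig PsiPhi traceg] := bij1 _ rg.
  have fE := remove_cornerK dL' LE Ncorner rf.
  set n := corner_excess u0 v0 f in fE *; set g := remove_corner u0 v0 f in rg Phig PsiPhi traceg fE *.
  split.
  - move=> a b; rewrite hook_move // negb_or => /andP[hab /negbTE->].
    by rewrite /= muln0 Phig.
  - apply: etrans fE; rewrite !eqxx /= muln1; congr (add_corner _ _ _ _).
      by rewrite /swap !eqxx (_ : s.+1 == s = false) ?Phig ?addn0 //; apply/eqP; lia.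
    rewrite -[RHS]PsiPhi; congr Psi; apply/funext => a; apply/funext => b.
    rewrite swap_s swap_S !swapK; case: ifP => [/andP[/eqP-> /eqP->]|->]; first by rewrite Phig.
    by rewrite muln0.
  move=> e; have [->|es] := eqVneq e s.+1; last first.
    rewrite (hook_trace_move_neq n pc ps pS sM Phig es) -traceg -[in LHS]fE.
    by rewrite /shape_trace (trace_add_corner_neq dL' LE Ncorner u0E).
  have tr := trace_add_corner dL dL' LE Ncorner u0E (ltn0Sn _) u0M n rg.
  have htr := hook_trace_move_eq n pc ps pS sM Phig.
  have t0 := traceg s; have t1 := traceg s.+1; have t2 := traceg s.+2.
  rewrite /shape_trace in t0 t1 t2 *; rewrite fE /= t0 t1 t2 -htr in tr.
  exact: addIn tr.
pose k0 a b := if (a == s.+1) && (b == s) then 0 else k (swap s a) (swap s b).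
have k0p : hook_array p k0.
  move=> a b hab; rewrite /k0; case: ifP => // abs; apply: kp.
  by rewrite hook_move // !swapK swap_s swap_S abs orbF.
have [rPsi PhiPsi] := bij2 _ k0p; rewrite -/k0.
split; first by apply: (add_corner_rpp dL dL' LE Ncorner).
rewrite (add_cornerK dL' LE Ncorner _ rPsi).
rewrite (corner_excess_add dL' LE Ncorner _ rPsi) PhiPsi.
apply/funext => a; apply/funext => b; rewrite /k0 swap_S swap_s !swapK.
have [/andP[/eqP-> /eqP->]|_] := boolP ((a == s) && (b == s.+1)).
  by rewrite /= muln1 addn0.
by rewrite /= muln0.
Qed.

End HookBijection.

(** * Statistics as sums over boxes and over hooks *)

Section Boxes.
Variables (M i : nat).
Implicit Types (p q : pred nat) (e t u v : nat) (f g k l : nat -> nat -> nat).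
Local Open Scope nat_scope.

Definition diag_size p e := above_nat M p e - (i - e).

Definition boxes p : seq (nat * nat) :=
  [seq (e.+1 - i + t.+1, i - e.+1 + t.+1) | e <- iota 0 M, t <- iota 0 (diag_size p e.+1)].

Lemma above_nat_anti p e e' : e <= e' -> above_nat M p e' <= above_nat M p e.
Proof.
move=> ee; rewrite -(subnKC ee); elim: (e' - e) => [|d IHd]; first by rewrite addn0.
by rewrite addnS; apply: leq_trans IHd; have /andP[] := above_nat_desc M p (e + d).
Qed.

Lemma mem_boxes p u v : config M i p -> ((u, v) \in boxes p) = in_shape M i p u v.
Proof.
move=> [pM p0]; apply/allpairsPdep/idP => [[e [t [eM tn [-> ->]]]]|/and3P[u0 v0 vN]].
  move: eM tn; rewrite !mem_iota /diag_size => eM tn; apply/and3P; split; try lia.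
  by rewrite (_ : i + _ - _ = e.+1); lia.
have Ni := above_nat_anti p (leq0n (i + u - v)); rewrite p0 in Ni.
have NM := above_nat_le M p (i + u - v).
have sE : i + u - v = (i + u - v).-1.+1 by lia.
exists (i + u - v).-1, (minn u v).-1; rewrite !mem_iota /diag_size -sE.
by split; [lia | lia | congr (_, _); lia].
Qed.

Lemma boxes_uniq p : uniq (boxes p).
Proof.
apply: allpairs_uniq_dep; [exact: iota_uniq | by move=> e _; exact: iota_uniq |].
move=> [e t] [e' t'] _ _ /= [E1 E2]; have ee : e = e' by lia.
by rewrite ee in E1 E2 *; congr (Tagged _ _); lia.
Qed.

Lemma in_shape_inj p q : config M i p -> config M i q ->
  in_shape M i p =2 in_shape M i q -> p = q.
Proof.
move=> pc qc pq.
have le p' q' e : config M i p' -> config M i q' ->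
    in_shape M i p' =2 in_shape M i q' -> above_nat M q' e <= above_nat M p' e.
  move=> pc' qc' pq'; rewrite leqNgt; apply/negP => lt.
  have := above_nat_bound M p' e; rewrite pc'.2 => Ni.
  have := pq' (above_nat M q' e + e - i) (above_nat M q' e).
  by rewrite /in_shape (_ : i + _ - _ = e) => [|]; lia.
have pqN e : above_nat M p e = above_nat M q e.
  by apply/eqP; rewrite eqn_leq !le // => u v; rewrite pq.
apply/funext => e; have [eM|eM] := leqP e M.
  by have := pqN e; rewrite !(@above_natS M _ e) // pqN => /addIn; case: (p e); case: (q e).
by apply/idP/idP => [/pc.1|/qc.1]; rewrite leqNgt eM.
Qed.

Lemma shape_traceE p f e : rpp (in_shape M i p) f -> e < M ->
  shape_trace M i e.+1 f
  = \sum_(0 <= t < diag_size p e.+1) f (e.+1 - i + t.+1) (i - e.+1 + t.+1).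
Proof.
move=> [f0 _] eM; set n := diag_size p e.+1; rewrite /shape_trace /trace.
have nM : n <= M - e by have := above_nat_le M p e.+1; rewrite /n /diag_size; lia.
rewrite -(big_mkord predT (fun u => f u (u + i - e.+1))).
rewrite (@big_cat_nat _ _ _ (e.+1 - i).+1) //=; last by lia.
rewrite big_nat_cond big1 ?add0n => [|u /andP[/andP[_ ue] _]]; last first.
  by apply: f0; rewrite /in_shape; case: u ue => [|u] ue //=; rewrite (_ : _ - _ = 0) //; lia.
rewrite (@big_cat_nat _ _ _ ((e.+1 - i).+1 + n)) //=; try lia.
rewrite [X in _ + X]big_nat_cond [X in _ + X]big1 ?addn0; last first.
  move=> u /andP[/andP[ue uM] _]; apply: f0; rewrite /in_shape; apply/and3P => -[_ v0].
  by rewrite (_ : i + u - _ = e.+1) /n /diag_size; rewrite /n /diag_size in ue; lia.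
rewrite -[X in \sum_(X <= _ < _) _]add0n big_addn addKn; apply: eq_bigr => t _.
by congr f; lia.
Qed.

Variables (c x : nat -> nat).

Lemma sum_boxes p (h : nat -> nat -> nat) :
  \sum_(b <- boxes p) h b.1 b.2
  = \sum_(e < M) \sum_(0 <= t < diag_size p e.+1) h (e.+1 - i + t.+1) (i - e.+1 + t.+1).
Proof.
rewrite big_allpairs_dep /= -[in RHS](big_mkord predT (fun e =>
  \sum_(0 <= t < diag_size p e.+1) h (e.+1 - i + t.+1) (i - e.+1 + t.+1))).
by rewrite /index_iota subn0; apply: eq_bigr => e _; rewrite subn0.
Qed.

Lemma sum_boxes_trace p f : rpp (in_shape M i p) f ->
  \sum_(b <- boxes p) x (i + b.1 - b.2) * f b.1 b.2
  = \sum_(e < M) x e.+1 * shape_trace M i e.+1 f.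
Proof.
move=> rf; rewrite (sum_boxes p (fun u v => x (i + u - v) * f u v)).
apply: eq_bigr => e _; rewrite (shape_traceE rf) // big_distrr /=.
by rewrite !big_nat; apply: eq_bigr => t _; congr (x _ * _); lia.
Qed.

Lemma sum_hooks_trace k :
  \sum_(a < M.+1) \sum_(b < M.+1) (\sum_(e < M | a <= e < b) x e.+1) * k a b
  = \sum_(e < M) x e.+1 * hook_trace M e.+1 k.
Proof.
rewrite /hook_trace; under [RHS]eq_bigr => e _.
  rewrite big_distrr; under eq_bigr do rewrite big_distrr.
  over.
rewrite /= [RHS]exchange_big; apply: eq_bigr => a _; rewrite [RHS]exchange_big.
apply: eq_bigr => b _; rewrite big_distrl big_mkcond /=; apply: eq_bigr => e _.
by rewrite ltnS; case: ifP; rewrite ?muln1 ?muln0.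
Qed.

(** A statistic that is linear in the entries, with coefficients depending only on the content, sees
    [f] and [g] through their traces alone. Natural weights are taken in order to treat each
    coordinate of an exponent. *)
Lemma weight_hooks p f g k l : rpp (in_shape M i p) f -> rpp (in_shape M i p) g ->
  (forall e, shape_trace M i e f = hook_trace M e k) ->
  (forall e, shape_trace M i e g = hook_trace M e l) ->
  \sum_(b <- boxes p) (c (i + b.1 - b.2)
      + x (i + b.1 - b.2) * (b.1.-1 + b.2.-1 + f b.1 b.2 + g b.1 b.2))
  = \sum_(e < M) \sum_(0 <= t < diag_size p e.+1)
       (c e.+1 + x e.+1 * ((e.+1 - i) + (i - e.+1) + t.*2))
     + \sum_(a < M.+1) \sum_(b < M.+1)
         (\sum_(e < M | a <= e < b) x e.+1) * (k a b + l a b).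
Proof.
move=> rf rg fk gl.
have -> : \sum_(a < M.+1) \sum_(b < M.+1)
     (\sum_(e < M | a <= e < b) x e.+1) * (k a b + l a b)
   = \sum_(e < M) x e.+1 * hook_trace M e.+1 k + \sum_(e < M) x e.+1 * hook_trace M e.+1 l.
  rewrite -!sum_hooks_trace -big_split; apply: eq_bigr => a _.
  by rewrite -big_split; apply: eq_bigr => b _; rewrite mulnDr.
under [X in _ = _ + (X + _)]eq_bigr do rewrite -fk.
under [X in _ = _ + (_ + X)]eq_bigr do rewrite -gl.
rewrite -(sum_boxes_trace rf) -(sum_boxes_trace rg).
under [LHS]eq_bigr do rewrite -addnA mulnDr addnA (mulnDr _ (f _ _)).
rewrite !big_split /= [in RHS](eq_bigr (fun e : 'I_M =>
  \sum_(0 <= t < diag_size p e.+1) (c (i + (e.+1 - i + t.+1) - (i - e.+1 + t.+1))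
   + x (i + (e.+1 - i + t.+1) - (i - e.+1 + t.+1)) *
     ((e.+1 - i + t.+1).-1 + (i - e.+1 + t.+1).-1)))); last first.
  move=> e _; rewrite !big_nat; apply: eq_bigr => t _.
  by congr (c _ + x _ * _); lia.
rewrite -(sum_boxes p (fun u v => c (i + u - v) + x (i + u - v) * (u.-1 + v.-1))).
by rewrite big_split.
Qed.

End Boxes.

(** * Diagrams in a rectangle as configurations of sites *)

Section ConfigOfDiagram.
Local Open Scope nat_scope.

Lemma initial_segment (q : pred nat) B : (forall n, q n.+1 -> q n) -> (forall n, q n -> n < B) ->
  exists n, forall m, q m = (m < n).
Proof.
move=> down qB; have nqB : exists n, ~~ q n by exists B; apply/negP => /qB; rewrite ltnn.
exists (ex_minn nqB) => m; case: ex_minnP => n nq nmin; have [mn|nm] := ltnP m n.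
  by apply/negPn/negP => /nmin; rewrite leqNgt mn.
apply/negP => qm; case/negP: nq; move: qm; rewrite -(subnKC nm).
by elim: (m - n) => [|d IHd]; rewrite ?addn0 // addnS => /down.
Qed.

Lemma sum_count_mem (s : seq nat) e B : all (fun a => a < B) s ->
  \sum_(e <= a < B) count_mem a s = count (leq e) s.
Proof.
elim: s => [|b s IHs] /=; first by rewrite big1.
case/andP=> bB /IHs <-; rewrite big_split /=; congr (_ + _).
have [eb|be] := leqP e b; last first.
  by rewrite big_nat_cond big1 // => a /andP[/andP[ea _] _]; case: eqP => // ?; lia.
rewrite (big_cat_nat _ (n := b)) //=; last by lia.
rewrite big_nat_cond big1 ?add0n => [|a /andP[/andP[_ ab] _]]; last by case: eqP => // ?; lia.
rewrite big_ltn // eqxx big_nat_cond big1 // => a /andP[/andP[ba _] _].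
by case: eqP => // ?; lia.
Qed.

Lemma count_decreasing (s : nat -> nat) i e v :
  (forall a b, 0 < a -> a <= b -> b <= i -> s b <= s a) -> 0 < v -> v <= i ->
  (v <= count (fun a => e <= s a) (iota 1 i)) = (e <= s v).
Proof.
move=> anti v0 vi; have [ev|ve] := leqP e (s v).
  rewrite -(subnKC vi) iotaD count_cat; apply: leq_trans (leq_addr _ _).
  rewrite -{1}(size_iota 1 v); move: (all_count (fun a => e <= s a) (iota 1 v)) => /esym.
  have -> : all (fun a => e <= s a) (iota 1 v).
    apply/allP => a; rewrite mem_iota => /andP[a0 av]; apply: leq_trans ev _.
    by apply: anti => //; lia.
  by move=> /eqP->.
apply/negbTE; rewrite -ltnNge.
have -> : i = v.-1 + (i - v.-1) by lia.
rewrite iotaD count_cat [X in _ + X](_ : _ = 0).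
  by rewrite addn0; apply: leq_ltn_trans (count_size _ _) _; rewrite size_iota prednK.
apply/eqP; rewrite -leqn0 leqNgt -has_count; apply/hasPn => a; rewrite mem_iota => av.
by rewrite -ltnNge; apply: leq_ltn_trans ve; apply: anti => //; lia.
Qed.

(* The rows of lengths [lam 1 >= lam 2 >= ...] occupy the sites
   [i + lam v - v] for [v = 1, ..., i]. *)
Lemma config_of_diagram M i L : diagram L -> i <= M.+1 ->
  (forall u v, L u v -> v <= i /\ u + i <= M.+1) ->
  exists2 p, config M i p & forall u v, L u v = in_shape M i p u v.
Proof.
move=> dL iM bound; have [pos left up] := dL.
have row_length v : exists n, forall u, L u.+1 v = (u < n).
  apply: (@initial_segment _ M.+1) => u; first exact: left.
  by move=> /bound[_]; lia.
have [lam lamE] := choice row_length.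
have lamM v : lam v + i <= M.+1.
  case lamv: (lam v) => [|n]; first by [].
  by have := lamE v n; rewrite lamv ltnSn => /bound[_].
have anti a b : 0 < a -> a <= b -> lam b <= lam a.
  move=> a0 ab; rewrite leqNgt; apply/negP => lt.
  have : L (lam a).+1 b by rewrite lamE.
  move=> Lb; have : L (lam a).+1 a by apply: (diagram_down dL Lb); rewrite ?a0 ?leqnn.
  by rewrite lamE ltnn.
pose s v := i + lam v - v; pose ss := [seq s v | v <- iota 1 i].
have ss_uniq : uniq ss.
  rewrite map_inj_in_uniq ?iota_uniq // => a b; rewrite !mem_iota /s => ai bi sab.
  have [ab|ba] := leqP a b.
    by have := anti a b ltac:(lia) ab; lia.
  by have := anti b a ltac:(lia) (ltnW ba); lia.
have ssM : all (fun a => a < M.+1) ss.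
  by apply/allP => a /mapP[v]; rewrite mem_iota => vi ->; have := lamM v; rewrite /s; lia.
pose p : pred nat := fun a => a \in ss.
have above e : above_nat M p e = count (fun v => e <= s v) (iota 1 i).
  rewrite /above_nat -[RHS]count_map -(sum_count_mem _ ssM).
  by apply: eq_bigr => a _; rewrite count_uniq_mem.
exists p; first split=> [a /(allP ssM)|] //.
  by rewrite above -[RHS](size_iota 1); apply/eqP; rewrite -all_count; apply/allP.
move=> u v; rewrite /in_shape above; case: u => [|u] /=.
  by apply/negP => /pos[].
case: v => [|v] /=; first by apply/negP => /pos[].
have [vi|iv] := leqP v.+1 i; last first.
  transitivity false; first by apply/negP => /bound[]; lia.
  apply/esym/negP => /leq_trans /(_ (count_size _ _)); rewrite size_iota; lia.
rewrite (@count_decreasing s) // ?lamE; first by rewrite /s; lia.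
by move=> a b a0 ab bi; have := anti a b a0 ab; rewrite /s; lia.
Qed.

End ConfigOfDiagram.

(** * Simple partitions as pairs of reverse plane partitions *)

Section SetsOfSequences.
Local Open Scope nat_scope.

Lemma sum_fset_set (T : choiceType) (s : seq T) (A : set T) (F : T -> nat) :
  uniq s -> (forall x, A x <-> x \in s) -> \sum_(x <- fset_set A) F x = \sum_(x <- s) F x.
Proof.
move=> us As; have AE : A = [set` s] by apply/seteqP; split=> x /=; rewrite As.
apply: perm_big; apply: uniq_perm => // x.
by rewrite AE in_fset_set; [apply/idP/idP => [/set_mem|xs] //; exact: mem_set | exact: finite_seq].
Qed.

Lemma ncard_seq (T : choiceType) (s : seq T) (A : set T) :
  uniq s -> (forall x, A x <-> x \in s) -> ncard A = size s.
Proof.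
move=> us As; have AE : A = [set` s] by apply/seteqP; split=> x /=; rewrite As.
apply: perm_size; apply: uniq_perm => // x.
by rewrite AE in_fset_set; [apply/idP/idP => [/set_mem|xs] //; exact: mem_set | exact: finite_seq].
Qed.

Lemma infinite_nat_image (T : Type) (A : set T) (h : T -> nat) N :
  (forall n, N < n -> exists2 x, A x & h x = n) -> infinite_set A.
Proof.
move=> hA /(finite_image h) fin; apply: infinite_nat.
apply: (@sub_finite_set _ _ ((h @` A) `|` `I_N.+1)).
  move=> n _; have [Nn|nN] := ltnP N n; last by right.
  by left; have [x Ax <-] := hA n Nn; exists x.
by rewrite finite_setU; split=> //; exact: finite_II.
Qed.

End SetsOfSequences.

Section Pyramid.
Local Open Scope nat_scope.
Implicit Types (L : nat -> nat -> bool) (f g : nat -> nat -> nat) (s t : stone) (r : row_index).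

(* Row [(j, v)] of the pyramid is the box in column [j + 1 - v] and row [v]. *)
Definition column r : nat := r.1.+1 - r.2.
Definition box_row (b : nat * nat) : row_index := ((b.1 + b.2).-1, b.2).

Definition on_side f g (d : side) := if d is LeftPart then f else g.

Definition pyramid L f g : set stone :=
  [set s | [/\ stones s, L (column (row_of s)) (s_row s)
    & on_side f g (s_side s) (column (row_of s)) (s_row s) < s_pos s]].

Lemma column_box_row b : 0 < b.1 -> column (box_row b) = b.1.
Proof. by rewrite /column /box_row; case: b => -[|u] v //= _; lia. Qed.

Lemma box_rowK r : rows r -> box_row (column r, r.2) = r.
Proof. by case: r => j v [/= v0 vj]; rewrite /box_row /column /=; congr (_, _); lia. Qed.

Lemma rows_box_row b : 0 < b.1 -> 0 < b.2 -> rows (box_row b).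
Proof. by case: b => u v /= u0 v0; split=> /=; lia. Qed.

Lemma row_stonesP r j v d l c : row_stones r (Stone j v d l c) -> [/\ r = (j, v), rows r & 0 < c].
Proof. by case=> -[/= v0 vj c0] <-. Qed.

Definition row_start r (l : level) (m m' : nat) : seq stone :=
  [seq Stone r.1 r.2 LeftPart l c | c <- iota 1 m]
  ++ [seq Stone r.1 r.2 RightPart l c | c <- iota 1 m'].

Lemma mem_row_start r l m m' s : s \in row_start r l m m' <->
  [/\ row_of s = r, s_level s = l & 0 < s_pos s <= if s_side s is LeftPart then m else m'].
Proof.
rewrite mem_cat; split=> [/orP[]/mapP[c]|].
- by rewrite mem_iota => cm -> /=; split=> //; case: (r).
- by rewrite mem_iota => cm -> /=; split=> //; case: (r).
case: s => j v d l' c [/= <- -> cm]; apply/orP; case: d cm => cm; [left | right];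
  by apply/mapP; exists c; rewrite // mem_iota; lia.
Qed.

Lemma row_start_uniq r l m m' : uniq (row_start r l m m').
Proof.
rewrite cat_uniq !map_inj_uniq ?iota_uniq ?andbT /=; try by move=> c c' [].
by apply/hasPn => s /mapP[c _ ->]; apply/mapP => -[].
Qed.

Lemma size_row_start r l m m' : size (row_start r l m m') = m + m'.
Proof. by rewrite size_cat !size_map !size_iota. Qed.

Section Fixed.
Variables (L : nat -> nat -> bool) (f g : nat -> nat -> nat) (bs : seq (nat * nat)).
Hypotheses (dL : diagram L) (rf : rpp L f) (rg : rpp L g).
Hypotheses (bs_uniq : uniq bs) (bsE : forall u v, ((u, v) \in bs) = L u v).

Let P := pyramid L f g.

Let bs_pos b : b \in bs -> 0 < b.1 /\ 0 < b.2.
Proof. by case: b => u v; rewrite bsE; case: dL => pos _ _ /pos. Qed.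

Lemma altered_pyramid r : altered P r <-> rows r /\ L (column r) r.2.
Proof.
split=> [[[j v d l c] [[/= v0 vj c0] Ljv _] <-] //|].
case: r => j v [[/= v0 vj] Ljv].
by exists (Stone j v LeftPart Upper (f (column (j, v)) v).+1).
Qed.

Let altered_seq : uniq (map box_row bs) /\
  forall r, altered P r <-> r \in map box_row bs.
Proof.
split.
  rewrite map_inj_in_uniq // => -[u v] [u' v'] /bs_pos[/= u0 v0] /bs_pos[/= u'0 v'0].
  by case=> /= E1 E2; congr (_, _); lia.
move=> r; rewrite altered_pyramid; split=> [[rr Lr]|/mapP[[u v] buv ->]].
  by apply/mapP; exists (column r, r.2); rewrite ?bsE ?box_rowK.
have [u0 v0] := bs_pos buv; split; first exact: rows_box_row.
by rewrite column_box_row //= -bsE.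
Qed.

Let on_side_mono d : rpp L (on_side f g d).
Proof. by case: d. Qed.

(** Row [(j + 1, v)] lies under rows [(j, v)] and [(j, v - 1)], the left and upper neighbours of its
    box. Closure under covering thus amounts to [L] being a diagram and to the monotonicity of [f]
    and [g]. *)
Lemma pyramid_simple : simple_partition P.
Proof.
have [pos left up] := dL; have [u_altered alteredE] := altered_seq.
split; last first.
  move=> r _; right; split.
    move=> [j v d l c] [j1 v1 d1 l1 c1] [j2 v2 d2 l2 c2].
    move=> [/row_stonesP[-> _ c_gt0] _] [s1 _] [/row_stonesP[[<- <-] _ _] _].
    have [[E1 E2] rr c1_gt0] := row_stonesP s1.
    rewrite /left_of /=; move: s1; rewrite -E1 -E2 => -[ss _].
    case: d; case: d1 ss; case: d2 => //= ss cc1 cc2 [_ Ljv lt1] [_ _ lt2];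
      split=> //=; rewrite /column /row_of /= in lt1 lt2 *; lia.
  move=> [j v d l c] tr [/= lE]; rewrite lE in tr * => ex.
  have [st _] := tr.
  by have [||_ /= Ljv lt] := ex (Stone j v d Upper c); [| by split=> //; left | split].
split.
- by move=> s [].
- move=> [j v d l c] [j' v' d' l' c'] /= [/= v0 vj c0]; case=> [[[/= <- <-] <- _ _ cc] [st Ljv lt]|].
    by split=> //=; rewrite /column /row_of /= in lt *; lia.
  move=> [/= -> vv <- <- _] [/= _ Ljv lt]; split=> //=.
    case: vv Ljv => -> Ljv; apply: (diagram_down dL Ljv); rewrite /column /row_of /=; lia.
  have [_ mf] := on_side_mono d; have [m1 m2] := mf _ _ Ljv.
  case: vv m1 m2 lt => -> m1 m2 lt; rewrite /column /row_of /= in m1 m2 lt *.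
    have cE : (j.+2 - v).-1 = j.+1 - v by lia.
    by rewrite cE in m1; apply: leq_ltn_trans m1 lt.
  by apply: leq_ltn_trans lt; exact: m2.
- move=> r rr; have [Lr|Lr] := boolP (L (column r) r.2); last first.
    left; apply/seteqP; split=> // -[j v d l c] [/row_stonesP[rE _ _]] [_ Ljv _].
    by move: Ljv Lr; rewrite rE => ->.
  right; split.
    apply: (@infinite_nat_image _ _ s_pos (f (column r) r.2)) => n fn.
    exists (Stone r.1 r.2 LeftPart Upper n) => //; case: r rr Lr fn => j v [/= v0 vj] Ljv fn.
    by split; split=> //; split=> //=; lia.
  pose h := maxn (f (column r) r.2) (g (column r) r.2).
  apply: (@sub_finite_set _ _ [set` row_start r Upper h h ++ row_start r Lower h h]); last first.
    exact: finite_seq.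
  move=> [j v d l c] [tr nP]; have [rE _ c0] := row_stonesP tr.
  have ch : c <= h.
    rewrite leqNgt; apply/negP => hc; apply: nP; split=> //.
      by case: tr.
      by move: Lr; rewrite rE.
    by apply: leq_ltn_trans hc; rewrite /h rE /row_of; case: (d) => /=; rewrite ?leq_maxl ?leq_maxr.
  by rewrite /= mem_cat; apply/orP; case: (l); [left | right];
    apply/mem_row_start; split=> //=; case: (d); rewrite c0.
- apply: (@sub_finite_set _ _ [set` map box_row bs]); last exact: finite_seq.
  by move=> r; rewrite alteredE.
Qed.

Lemma remaining_pyramid b : b \in bs -> forall c,
  c = (if odd (b.1 + b.2).-1 then White else Yellow) ->
  ncard (remaining P c (box_row b)) = f b.1 b.2 + g b.1 b.2.
Proof.
move=> bbs c cE; have [u0 v0] := bs_pos bbs.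
rewrite -(size_row_start (box_row b) Upper); apply: ncard_seq; first exact: row_start_uniq.
have Lb : L b.1 b.2 by rewrite -bsE -surjective_pairing.
move=> [j v d l k]; rewrite mem_row_start {}cE; split.
  move=> [tr + nP]; have [rE rr k0] := row_stonesP tr.
  have [jE vE] : (b.1 + b.2).-1 = j /\ b.2 = v by case: rE.
  rewrite /stone_color /= jE => lE; split=> //=.
    by case: (l) (odd j) lE => -[].
  rewrite k0 leqNgt /=; apply/negP => lt; apply: nP; split.
  - by case: tr.
  - by rewrite /row_of /= -rE column_box_row // -vE.
  - by rewrite /row_of /= -rE column_box_row // -vE; case: (d) lt.
move=> [rE /= lE /andP[k0 kle]].
have [jE vE] : (b.1 + b.2).-1 = j /\ b.2 = v by case: rE.
have rr := rows_box_row u0 v0; rewrite -rE in rr; have [r0 r1] := rr.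
split; [by split | by rewrite /stone_color /= lE jE |].
move=> [_ _]; rewrite rE column_box_row //= -vE.
by case: (d) kle => /= kle; rewrite ltnNge kle.
Qed.

Lemma sum_altered (A : set row_index) (q : pred nat) (F : row_index -> nat) :
  (forall r, A r <-> altered P r /\ q r.1) ->
  \sum_(r <- fset_set A) F r = \sum_(b <- bs) (if q (b.1 + b.2).-1 then F (box_row b) else 0).
Proof.
move=> AE; have [u_altered alteredE] := altered_seq.
pose s := [seq r <- map box_row bs | q r.1].
rewrite (@sum_fset_set _ s); last 2 first.
- exact: filter_uniq.
- by move=> r; rewrite AE alteredE mem_filter; split=> [[-> ->]|/andP[]].
by rewrite big_filter big_map big_mkcond.
Qed.

Lemma ncard_altered (A : set row_index) (q : pred nat) :
  (forall r, A r <-> altered P r /\ q r.1) ->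
  ncard A = \sum_(b <- bs) (if q (b.1 + b.2).-1 then 1 else 0).
Proof.
by move=> AE; rewrite -(sum_altered (fun=> 1) AE) /ncard sum1_size.
Qed.

End Fixed.
End Pyramid.

Section SimplePartitions.
Local Open Scope nat_scope.
Implicit Types (L : nat -> nat -> bool) (f g : nat -> nat -> nat) (P : set stone) (r : row_index).

Lemma pyramid_stone L f g d l u v c : 0 < u -> 0 < v -> 0 < c ->
  pyramid L f g (Stone (u + v).-1 v d l c) <-> L u v /\ on_side f g d u v < c.
Proof.
move=> u0 v0 c0; have colE : column ((u + v).-1, v) = u := @column_box_row (u, v) u0.
have [r0 r1] := @rows_box_row (u, v) u0 v0.
by rewrite /pyramid /= /row_of /= colE; split=> [[_]|[Luv lt]].
Qed.

Lemma pyramid_inj L f g L' f' g' : diagram L -> rpp L f -> rpp L g ->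
  diagram L' -> rpp L' f' -> rpp L' g' ->
  pyramid L f g = pyramid L' f' g' -> [/\ forall u v, L u v = L' u v, f = f' & g = g'].
Proof.
move=> dL [f0 _] [g0 _] dL' [f'0 _] [g'0 _] PP.
have half L1 f1 g1 L2 f2 g2 u v : diagram L1 -> pyramid L1 f1 g1 = pyramid L2 f2 g2 ->
    L1 u v -> L2 u v /\ forall d, on_side f2 g2 d u v <= on_side f1 g1 d u v.
  move=> [pos _ _] P12 L1uv; have [u0 v0] := pos _ _ L1uv.
  have memP d : L2 u v /\ on_side f2 g2 d u v < (on_side f1 g1 d u v).+1.
    by apply/(@pyramid_stone L2 f2 g2 d Upper) => //; rewrite -P12; apply/pyramid_stone.
  by split=> [|d]; [have [] := memP LeftPart | have [] := memP d].
have LL u v : L u v = L' u v.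
  by apply/idP/idP => [/(half _ _ _ _ _ _ _ _ dL PP)[]|/(half _ _ _ _ _ _ _ _ dL' (esym PP))[]].
have eq_on d u v : L u v -> on_side f g d u v = on_side f' g' d u v.
  move=> Luv; apply/eqP; rewrite eqn_leq; have L'uv : L' u v by rewrite -LL.
  by rewrite (half _ _ _ _ _ _ _ _ dL PP Luv).2 (half _ _ _ _ _ _ _ _ dL' (esym PP) L'uv).2.
split=> //; apply/funext => u; apply/funext => v; have [Luv|nL] := boolP (L u v).
- exact: (eq_on LeftPart).
- by rewrite f0 // f'0 // -LL.
- exact: (eq_on RightPart).
- by rewrite g0 // g'0 // -LL.
Qed.

Lemma finite_bound (T : Type) (A : set T) (h : T -> nat) : finite_set A ->
  exists N, forall x, A x -> h x < N.
Proof.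
move=> /(finite_image h) /finite_seqP[s sE]; exists (\max_(n <- s) n).+1 => x Ax.
have : [set` s] (h x) by rewrite -sE; exists x.
by move=> /= xs; rewrite ltnS; apply: leq_bigmax_seq.
Qed.

(* In an altered row the removed stones of each side are those beyond some
   position: far enough from the ends all stones are removed, the upper ones
   form a block, and a lower stone is removed as soon as it is exposed. *)
Lemma simple_row P r : simple_partition P -> altered P r ->
  exists m m', forall s, row_stones r s -> 
    (P s <-> (if s_side s is LeftPart then m else m') < s_pos s).
Proof.
move=> [[Pst Pup Prow _] Psimple] alt; have [s0 Ps0 rs0] := alt.
have rr : rows r by rewrite -rs0; case: (Pst _ Ps0).
have notempty : row_stones r `&` P <> set0.
  by move/seteqP=> [sub _]; apply: (sub s0); split=> //; split=> //; apply: Pst.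
have [//|[_ fin]] := Prow r rr; have [//|[block expo]] := Psimple r rr.
have [N HN] := finite_bound s_pos fin.
pose w d c := Stone r.1 r.2 d Upper c.
have st d l c : 0 < c -> row_stones r (Stone r.1 r.2 d l c).
  by move=> c0; split; [case: rr => ? ?; split | case: (r)].
have up d c : 0 < c -> upper_stones r (w d c) by move=> c0; split=> //; apply: st.
have far d l c : 0 < c -> N <= c -> P (Stone r.1 r.2 d l c).
  move=> c0 Nc; apply: contrapT => nP.
  by have := HN (Stone r.1 r.2 d l c) (conj (st d l c c0) nP); rewrite ltnNge Nc.
(* The block is spanned by the given stone and a far stone of the opposite part, which is removed
   because only finitely many stones of the row remain. *)
have beyond d c c' : 0 < c -> c < c' -> P (w d c) -> P (w d c').
  move=> c0 cc Pc; pose far_pos := (maxn N c').+1.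
  have c'0 : 0 < c' by lia.
  case: d Pc => Pc.
    by apply: (block (w LeftPart c) _ (w RightPart far_pos)) => //; try exact: up; apply: far; lia.
  apply: (block (w LeftPart far_pos) _ (w RightPart c)) => //; try exact: up; apply: far; lia.
have threshold d : exists m, forall c, 0 < c -> P (w d c) <-> m < c.
  have down n : `[< ~ P (w d n.+2) >] -> `[< ~ P (w d n.+1) >].
    by move=> /asboolP nP; apply/asboolP => Pn; apply/nP/(beyond d n.+1).
  have bounded n : `[< ~ P (w d n.+1) >] -> n < N.
    by move=> /asboolP nP; rewrite ltnNge; apply/negP => Nn; apply/nP/far => //; exact: leqW.
  have [n nE] := @initial_segment (fun n => `[< ~ P (w d n.+1) >]) N down bounded.
  exists n => c; case: c => // c _; rewrite ltnS leqNgt -nE.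
  by split=> [Pc|/asboolPn/contrapT//]; apply/asboolPn.
have [m mE] := threshold LeftPart; have [m' m'E] := threshold RightPart.
exists m, m' => -[j v d l c] sr; have [rE _ c0] := row_stonesP sr.
have wE d' : P (w d' c) <-> (if d' is LeftPart then m else m') < c.
  by case: d'; [exact: mE | exact: m'E].
have upperE : w d c = Stone j v d Upper c by rewrite /w rE.
have [u1 u2] := wE d; case: l sr => sr; first by rewrite upperE in u1 u2.
rewrite /=; split=> [Pb|lt].
  apply: u1; rewrite upperE; apply: Pup Pb; first by rewrite -upperE; case: (up d c c0) => -[].
  by left; split=> //; left.
apply: expo => //; split=> // -[j1 v1 d1 l1 c1] s1 [/= [-> ->] -> -> _ cc].
have Pc := u2 lt; rewrite upperE in Pc; case: cc => -> //.
by have := beyond d c c.+1 c0 (ltnSn c); rewrite /w rE; apply.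
Qed.

Lemma simple_pyramid P : simple_partition P -> exists L f g bs,
  [/\ diagram L, rpp L f & rpp L g] /\
  [/\ uniq bs, forall u v, ((u, v) \in bs) = L u v & P = pyramid L f g].
Proof.
move=> Ps; have [[Pst Pup _ fin] _] := Ps.
have row_threshold r : exists mm : nat * nat, altered P r -> forall s, row_stones r s ->
    (P s <-> (if s_side s is LeftPart then mm.1 else mm.2) < s_pos s).
  have [alt|nalt] := pselect (altered P r); last by exists (0, 0).
  by have [m [m' mE]] := simple_row Ps alt; exists (m, m').
have [h hE] := choice row_threshold.
pose L u v := [&& 0 < u, 0 < v & `[< altered P (box_row (u, v)) >]].
pose f u v := if L u v then (h (box_row (u, v))).1 else 0.
pose g u v := if L u v then (h (box_row (u, v))).2 else 0.
have LP u v : L u v -> [/\ 0 < u, 0 < v & altered P (box_row (u, v))].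
  by case/and3P => u0 v0 /asboolP alt.
have stoneP d l u v c : L u v -> 0 < c ->
    P (Stone (u + v).-1 v d l c) <-> on_side f g d u v < c.
  move=> Luv c0; have [u0 v0 alt] := LP _ _ Luv.
  rewrite (hE _ alt) /=; last by have [r0 r1] := @rows_box_row (u, v) u0 v0; split.
  by case: d; rewrite /= /f /g Luv.
(* The first removed upper stone in the row of [(u', v')] lies beneath the lower stone at the same
   position in the row of [(u, v)], so the latter is removed too. *)
have step d u v u' v' : L u' v' -> 0 < u -> 0 < v ->
    (u' = u.+1 /\ v' = v) \/ (u' = u /\ v' = v.+1) ->
    L u v /\ on_side f g d u v <= on_side f g d u' v'.
  move=> L' u0 v0 nbr; set c := (on_side f g d u' v').+1.
  have /(stoneP d Upper _ _ c L' isT) Pt : on_side f g d u' v' < c by [].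
  have [r0 r1] := @rows_box_row (u, v) u0 v0.
  have Pt' : P (Stone (u + v).-1 v d Lower c).
    apply: Pup Pt; first by split.
    by right; split=> //=; lia.
  have Luv : L u v by apply/and3P; split=> //; apply/asboolP; exists (Stone (u + v).-1 v d Lower c).
  by split=> //; rewrite -ltnS; apply/(stoneP d Lower _ _ c Luv isT).
have left d u v : L u.+2 v -> L u.+1 v /\ on_side f g d u.+1 v <= on_side f g d u.+2 v.
  by move=> Luv; have [_ v0 _] := LP _ _ Luv; apply: step => //; left.
have up d u v : L u v.+2 -> L u v.+1 /\ on_side f g d u v.+1 <= on_side f g d u v.+2.
  by move=> Luv; have [u0 _ _] := LP _ _ Luv; apply: step => //; right.
have dL : diagram L.
  by split=> [u v /LP[] //|u v /(left LeftPart)[]|u v /(up LeftPart)[]].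
have off d u v : ~~ L u v -> on_side f g d u v = 0.
  by move=> nL; case: d; rewrite /= /f /g (negbTE nL).
have mono d : rpp L (on_side f g d).
  split=> [u v|u v Luv]; first exact: off.
  have [u0 v0 _] := LP _ _ Luv; split.
    by case: u u0 Luv => // -[|u] _ Luv; [rewrite off | have [] := left d _ _ Luv].
  case: v v0 Luv => // -[|v] _ Luv; last by have [] := up d _ _ Luv.
  by rewrite off // /L andbF.
have alt_rows r : altered P r -> rows r.
  by case=> s /Pst[s0 s1 _] <-.
exists L, f, g, [seq (column r, r.2) | r <- fset_set (altered P)]; split.
  by split=> //; [exact: (mono LeftPart) | exact: (mono RightPart)].
have memE r : (r \in fset_set (altered P)) = `[< altered P r >].
  by rewrite in_fset_set //; apply/idP/asboolP => [/set_mem|/mem_set].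
split.
- rewrite map_inj_in_uniq ?fset_uniq // => r r'; rewrite !memE => /asboolP /alt_rows rr /asboolP /alt_rows rr'.
  by move=> E; rewrite -(box_rowK rr) E box_rowK.
- move=> u v; apply/mapP/and3P => [[r]|[u0 v0 alt]].
    rewrite memE => /asboolP alt [-> ->]; have rr := alt_rows _ alt; rewrite box_rowK //.
    by case: rr => r0 r1; split; [rewrite /column; lia | | apply/asboolP].
  by exists (box_row (u, v)); rewrite ?memE // column_box_row.
apply/seteqP; split=> -[j v d l c].
  move=> Pjv; have [/= v0 vj c0] := Pst _ Pjv.
  have alt : altered P (j, v) by exists (Stone j v d l c).
  have rE := box_rowK (alt_rows _ alt); have [jE] := rE.
  have Lc : L (column (j, v)) v.
    by apply/and3P; split; [rewrite /column /=; lia | | rewrite rE; apply/asboolP].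
  split; [by split | by [] | apply/(stoneP d l _ _ _ Lc c0)].
  by rewrite [(_ + v).-1]jE.
move=> [[/= v0 vj c0] Lc] /(stoneP d l _ _ _ Lc c0).
have rr : rows (j, v) by [].
by have [jE] := box_rowK rr; rewrite [(_ + v).-1]jE.
Qed.

End SimplePartitions.

Section Weight.
Local Open Scope nat_scope.
Variable i0 : nat.
Implicit Types (L : nat -> nat -> bool) (f g : nat -> nat -> nat).

Definition box_weight f g (b : nat * nat) : 'X_{1..4} :=
  (mnm_c i0 (i0 + b.1 - b.2)
   + mnm_x i0 (i0 + b.1 - b.2) *+ (b.1.-1 + b.2.-1 + f b.1 b.2 + g b.1 b.2))%MM.

(** The row of the box [(u, v)] is in layer [u + v - 1], of height [(u - 1) + (v - 1)]. Its layer is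
    odd exactly when its content is even, and [v <= i0] keeps the truncated [i0 + u - v] exact. *)
Lemma weight_pyramid L f g bs : diagram L -> rpp L f -> rpp L g -> uniq bs ->
  (forall u v, ((u, v) \in bs) = L u v) -> (forall u v, L u v -> v <= i0) ->
  weight (pyramid L f g) = mnm_col (\sum_(b <- bs) box_weight f g b)%MM.
Proof.
move=> dL rf rg bs_uniq bsE Li0; set P := pyramid L f g.
have bwE r : altered_bw P r <-> altered P r /\ odd r.1 by [].
have byE r : altered_by P r <-> altered P r /\ ~~ odd r.1 by [].
have bs_pos b : b \in bs -> [/\ 0 < b.1, 0 < b.2 & b.2 <= i0].
  by case: b => u v; rewrite bsE => Luv; have [pos _ _] := dL; have [] := pos _ _ Luv; split=> //; exact: Li0 Luv.
pose N (q : pred nat) := \sum_(b <- bs) (if q (b.1 + b.2).-1 then 1 else 0).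
pose X (q : pred nat) := \sum_(b <- bs) (if q (b.1 + b.2).-1
  then b.1.-1 + b.2.-1 + f b.1 b.2 + g b.1 b.2 else 0).
have XE (c : color) (A : set row_index) (q : pred nat) :
    (forall r, A r <-> altered P r /\ q r.1) ->
    (forall j, q j -> c = if odd j then White else Yellow) ->
    sum_rows A (fun r => ncard (remaining P c r)) + sum_rows A height = X q.
  move=> AE cE; rewrite /sum_rows !(sum_altered dL bs_uniq bsE _ AE) -big_split.
  apply: eq_big_seq => b bbs /=; have [u0 v0 _] := bs_pos _ bbs.
  case: ifP => // qb; rewrite (remaining_pyramid f g dL bsE bbs (cE _ qb)) /height /box_row /=.
  case: b {bbs qb} u0 v0 => -[//|u] [//|v] _ _ /=; lia.
have Eby : x2 P + h2 P = X (fun j => ~~ odd j).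
  by apply: (XE Yellow _ _ byE) => j /negbTE->.
have Ebw : x1 P + h1 P = X odd by apply: (XE White _ _ bwE) => j ->.
have Nby : ncard (altered_by P) = N (fun j => ~~ odd j) by exact: (@ncard_altered L f g bs dL bs_uniq bsE _ (fun j => ~~ odd j) byE).
have Nbw : ncard (altered_bw P) = N odd by exact: (@ncard_altered L f g bs dL bs_uniq bsE _ odd bwE).
apply/colP => i; rewrite /weight !mxE Eby Ebw Nby Nbw mnm_sumE; congr (_%:Z)%R.
have oddE b : b \in bs -> (odd (i0 + b.1 - b.2) == odd i0) = odd (b.1 + b.2).-1.
  move=> bbs; have [u0 v0 vi] := bs_pos _ bbs; lia.
rewrite /X /N; case: i => -[|[|[|[|i]]]] // i4; rewrite /= -?big_split /=;
  apply: eq_big_seq => b bbs; rewrite /box_weight /mnm_c /mnm_x oddE //;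
  case: (odd _); rewrite /= !mnmDE mulmnE ?mnmDE !mnm1E -!val_eqE /= !inordK //=; lia.
Qed.

End Weight.

(** * Counting *)

Section Counting.
Variables (M D i0 : nat).
Local Notation arrays := {ffun 'I_M.+1 * 'I_M.+1 -> 'I_D.+1}.
Local Notation P := {mpoly int[4]}.
Implicit Types (S : {set 'I_M.+1}) (w : arrays) (t : {set 'I_M.+1} * (arrays * arrays)).

Lemma prod_geom_sum n (I : finType) (Q : pred I) (h : I -> 'X_{1..n}) :
  \prod_(j | Q j) \sum_(l < D.+1) 'X_[h j *+ l]
  = \sum_(w in pfamily (ord0 : 'I_D.+1) Q (fun=> predT)) 'X_[\sum_(j | Q j) h j *+ w j]
    :> {mpoly int[n]}.
Proof.
rewrite (big_distr_big_dep (ord0 : 'I_D.+1)); apply: eq_bigr => w _.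
by rewrite (big_morph (fun m => 'X_[m] : {mpoly int[n]}) (@mpolyXD _ _) (@mpolyX0 _ _)).
Qed.

(* A hook is recorded as the pair of its occupied and its empty site. *)
Definition hooks S (ba : 'I_M.+1 * 'I_M.+1) :=
  (ba.1 \in S) && ((ba.2 \notin S) && (ba.2 < ba.1)%N).

Definition on_hooks S w := w \in pfamily ord0 (hooks S) (fun=> predT).

Definition array_mnm S w : 'X_{1..4} :=
  (\sum_(ba | hooks S ba) hook_mnm M i0 ba.2 ba.1 *+ w ba)%MM.

Definition weighs (m : 'X_{1..4}) t :=
  [&& #|t.1| == i0, on_hooks t.1 t.2.1, on_hooks t.1 t.2.2
    & (box_mnm i0 i0 0 t.1 + (array_mnm t.1 t.2.1 + array_mnm t.1 t.2.2))%MM == m].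

(** Expanding both copies of every hook sum selects a shape and two arrays; all terms have
    coefficient 1, so the coefficient is a count. *)
Lemma shape_poly_coeff m :
  (shape_poly M D.+1 i0 i0 0)@_m = #|[pred t | weighs m t]|%:Z.
Proof.
have -> : shape_poly M D.+1 i0 i0 0 = \sum_(t : {set 'I_M.+1} * (arrays * arrays) | [&& #|t.1| == i0, on_hooks t.1 t.2.1 & on_hooks t.1 t.2.2])
    'X_[box_mnm i0 i0 0 t.1 + (array_mnm t.1 t.2.1 + array_mnm t.1 t.2.2)].
  rewrite /shape_poly -(pair_big_dep (fun S => #|S| == i0)
    (fun S x => on_hooks S x.1 && on_hooks S x.2)
    (fun S x => 'X_[box_mnm i0 i0 0 S + (array_mnm S x.1 + array_mnm S x.2)])) /=.
  apply: eq_bigr => S _; rewrite pair_big_dep /=.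
  under eq_bigr do rewrite expr2; rewrite big_split /= (prod_geom_sum (hooks S)).
  rewrite big_distrlr /= pair_big mulr_sumr; apply: eq_bigr => x _.
  by rewrite !mpolyXD.
rewrite (raddf_sum (mcoeff m)) -natz -sum1_card natr_sum /=.
under eq_bigr do rewrite mcoeffX.
rewrite big_mkcond [RHS]big_mkcond; apply: eq_bigr => t _; rewrite /weighs unfold_in.
by case: (_ == i0) (on_hooks _ _) (on_hooks _ _) (_ == m) => -[] [] [].
Qed.

End Counting.

(** * Finite sets of sites and arrays as functions on the naturals *)

Section Sites.
Variable M : nat.
Local Open Scope nat_scope.
Implicit Types (S : {set 'I_M.+1}) (p : pred nat).

Definition sites_of S : pred nat := fun a => (a <= M) && (inord a \in S).

Lemma sites_of_ord S (a : 'I_M.+1) : sites_of S a = (a \in S).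
Proof. by rewrite /sites_of -ltnS ltn_ord inord_val. Qed.

Lemma above_sites S e : above_nat M (sites_of S) e = above S e.
Proof.
rewrite /above_nat big_geq_mkord /above -sum1_card [RHS]big_mkcond [LHS]big_mkcond /=.
by apply: eq_bigr => a _; rewrite inE sites_of_ord andbC; case: leqP; case: (a \in S).
Qed.

Lemma config_sites S : config M #|S| (sites_of S).
Proof.
split=> [a /andP[]//|]; rewrite above_sites /above.
by apply: eq_card => a; rewrite !inE andbT.
Qed.

Lemma sites_of_inj : injective sites_of.
Proof. by move=> S S' SS; apply/finset.setP => a; rewrite -!sites_of_ord SS. Qed.

Lemma sites_of_pred p : (forall a, p a -> a <= M) ->
  sites_of [set s : 'I_M.+1 | p s]%SET = p.
Proof.
move=> pM; apply/funext => a; rewrite /sites_of; have [aM|aM] := leqP a M; last first.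
  by apply/esym/negP => /pM; rewrite leqNgt aM.
by rewrite inE inordK.
Qed.

Section Arrays.
Variable D : nat.
Local Notation arrays := {ffun 'I_M.+1 * 'I_M.+1 -> 'I_D.+1}.
Implicit Type w : arrays.

Definition array_of w a b : nat :=
  if (a <= M) && (b <= M) then nat_of_ord (w (inord b, inord a)) else 0.

Lemma array_of_ord w (a b : 'I_M.+1) : array_of w a b = w (b, a).
Proof. by rewrite /array_of !leq_ord !inord_val. Qed.

Lemma hooks_sites S (a b : 'I_M.+1) : hooks S (b, a) = hook (sites_of S) a b.
Proof. by rewrite /hooks /hook !sites_of_ord /= andbCA. Qed.

Lemma on_hooksP S w :
  reflect (hook_array (sites_of S) (array_of w)) (on_hooks S w).
Proof.
apply: (iffP idP) => [/pfamilyP[/fintype.subsetP supp _] a b nh|hw].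
  rewrite /array_of; case: ifP => // /andP[aM bM]; apply/eqP; apply: contraNT nh => w0.
  have := supp (inord b, inord a); rewrite !inE => /(_ w0).
  by rewrite [_ \in _](@hooks_sites S) !inordK.
apply/pfamilyP; split=> //; apply/fintype.subsetP => -[b a]; rewrite !inE => w0.
rewrite [_ \in _](@hooks_sites S); apply: contraNT w0 => /hw; rewrite array_of_ord => w0.
by apply/eqP/val_inj.
Qed.

Lemma array_mnmE i0 S w : on_hooks S w -> array_mnm i0 S w
  = (\sum_(a < M.+1) \sum_(b < M.+1) hook_mnm M i0 a b *+ array_of w a b)%MM.
Proof.
move=> /on_hooksP hw; rewrite /array_mnm exchange_big pair_big /= big_mkcond /=.
apply: eq_bigr => -[b a] _ /=; rewrite array_of_ord; case: ifP => // /negbT.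
by rewrite hooks_sites => /hw; rewrite array_of_ord => ->; rewrite mulm0n.
Qed.

Lemma array_of_inj : injective array_of.
Proof.
move=> w w' ww; apply/ffunP => -[b a]; apply: val_inj.
by rewrite /= -!array_of_ord ww.
Qed.

Lemma array_of_finfun (k : nat -> nat -> nat) : (forall a b, k a b <= D) ->
  (forall a b, M < maxn a b -> k a b = 0) ->
  array_of [ffun ba : 'I_M.+1 * 'I_M.+1 => inord (k ba.2 ba.1)] = k.
Proof.
move=> kD kM; apply/funext => a; apply/funext => b; rewrite /array_of.
case: ifP => [/andP[aM bM]|/negbT abM]; first by rewrite ffunE /= !inordK // ltnS.
by rewrite kM //; lia.
Qed.

End Arrays.
End Sites.

Lemma pyramid_hook_weight M i0 (p : pred nat) (f g k l : nat -> nat -> nat) :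
  config M i0 p -> rpp (in_shape M i0 p) f -> rpp (in_shape M i0 p) g ->
  (forall e, shape_trace M i0 e f = hook_trace M e k) ->
  (forall e, shape_trace M i0 e g = hook_trace M e l) ->
  weight (pyramid (in_shape M i0 p) f g)
  = mnm_col (\sum_(e < M) \sum_(t < diag_size M i0 p e.+1)
      (mnm_c i0 e.+1 + mnm_x i0 e.+1 *+ ((e.+1 - i0) + (i0 - e.+1) + t.*2)%N)
    + \sum_(a < M.+1) \sum_(b < M.+1) hook_mnm M i0 a b *+ (k a b + l a b)%N)%MM.
Proof.
move=> pc rf rg fk gl.
rewrite (@weight_pyramid i0 _ f g (boxes M i0 p)) //; last 4 first.
- exact: in_shape_diagram.
- exact: boxes_uniq.
- by move=> u v; exact: mem_boxes.
- move=> u v /and3P[_ _ vN]; apply: leq_trans vN _; rewrite -pc.2.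
  exact: above_nat_anti.
congr mnm_col; apply/mnmP => j; rewrite mnmDE !mnm_sumE.
under eq_bigr do rewrite mnmDE mulmnE.
rewrite (weight_hooks (fun e => mnm_c i0 e j) (fun e => mnm_x i0 e j) rf rg fk gl).
congr (_ + _)%N; apply: eq_bigr => a _; rewrite mnm_sumE.
  by rewrite big_mkord; apply: eq_bigr => t _; rewrite mnmDE mulmnE.
by apply: eq_bigr => b _; rewrite mulmnE mnm_sumE.
Qed.

Section SimpleCount.
Variables (k : nat) (m : 'X_{1..4}).
Hypothesis mk : (mdeg m <= k)%N.
Let M := (k + k).+1.
Let i0 := k.+1.
Local Notation arrays := {ffun 'I_M.+1 * 'I_M.+1 -> 'I_k.+1}.
Local Notation data := ({set 'I_M.+1} * (arrays * arrays))%type.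
Implicit Types (P : set stone) (t : data).

Lemma box_mnm_sites (S : {set 'I_M.+1}) : box_mnm i0 i0 0 S
  = (\sum_(e < M) \sum_(t < diag_size M i0 (sites_of S) e.+1)
      (mnm_c i0 e.+1 + mnm_x i0 e.+1 *+ ((e.+1 - i0) + (i0 - e.+1) + t.*2)%N))%MM.
Proof. by apply: eq_bigr => e _; rewrite /diag_size above_sites. Qed.

Lemma sum_arrays (S : {set 'I_M.+1}) (w w' : arrays) : on_hooks S w -> on_hooks S w' ->
  (array_mnm i0 S w + array_mnm i0 S w')%MM
  = (\sum_(a < M.+1) \sum_(b < M.+1) hook_mnm M i0 a b *+ (array_of w a b + array_of w' a b)%N)%MM.
Proof.
move=> hw hw'; rewrite !array_mnmE // -big_split; apply: eq_bigr => a _.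
rewrite -big_split; apply: eq_bigr => b _.
by apply/mnmP => j; rewrite /= mnmDE !mulmnE mulnDr.
Qed.

(** Hook monomials have positive degree. The bound ensures that arrays with entries at most [k] miss
    no partition of weight [m]. *)
Lemma mdeg_hook_array (f : nat -> nat -> nat) (m' : 'X_{1..4}) a b :
  (a < b <= M)%N ->
  m = (m' + \sum_(a < M.+1) \sum_(b < M.+1) hook_mnm M i0 a b *+ f a b)%MM -> (f a b <= k)%N.
Proof.
move=> abM mE; apply: leq_trans mk; rewrite mE mdegD.
have /andP[ab bM] := abM; have aM : (a < M.+1)%N by lia.
rewrite (bigD1 (Ordinal aM)) //= (bigD1 (Ordinal (bM : (b < M.+1)%N))) //= !mdegD mdegMn.
have := hook_mnm_neq0 i0 abM; move: (mdeg _) (mdeg _) (mdeg _) (mdeg _) => d1 d2 d3 d4 d2_gt0.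
by apply: leq_trans (leq_addl _ _); rewrite -addnA; apply: leq_trans (leq_addr _ _); rewrite leq_pmull.
Qed.

(* Every box contributes at least one to the degree, and a shape with at most
   [k] boxes fits in the rectangle of the configurations. *)
Lemma simple_pyramid_config P : simple_partition P -> weight P = mnm_col m ->
  exists p f g, [/\ config M i0 p, rpp (in_shape M i0 p) f, rpp (in_shape M i0 p) g
                  & P = pyramid (in_shape M i0 p) f g].
Proof.
move=> /simple_pyramid[L [f [g [bs [[dL rf rg] [ubs bsE PE]]]]]] wP.
pose B := \max_(b <- bs) b.2.
have LB u v : L u v -> (v <= B)%N by rewrite -bsE => uv; rewrite /B (leq_bigmax_seq (u, v)).
have size_bs : (size bs <= k)%N.
  apply: leq_trans mk; move: wP; rewrite PE (weight_pyramid dL rf rg ubs bsE LB).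
  move=> /mnm_col_inj <-; elim: (bs) => //= b s IHs; rewrite big_cons mdegD.
  by rewrite -add1n leq_add // /box_weight mdegD mdeg_mnm_c.
have col_row u v : L u v -> (u <= k)%N /\ (v <= k)%N.
  move=> Luv; have [pos _ _] := dL; have [u0 v0] := pos _ _ Luv.
  have sub T (s : seq T) (h : T -> nat * nat) : uniq (map h s) -> {subset map h s <= bs} ->
      (size s <= k)%N.
    by move=> us ss; apply: leq_trans size_bs; rewrite -(size_map h); apply: uniq_leq_size.
  split.
    rewrite -(size_iota 1 u); apply: (sub _ _ (fun x => (x, v))).
      by rewrite map_inj_uniq ?iota_uniq // => x y [].
    move=> _ /mapP[x xu ->]; rewrite bsE; apply: (diagram_down dL Luv).
      by move: xu; rewrite mem_iota; lia.
    by rewrite v0 leqnn.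
  rewrite -(size_iota 1 v); apply: (sub _ _ (fun y => (u, y))).
    by rewrite map_inj_uniq ?iota_uniq // => x y [].
  move=> _ /mapP[y yv ->]; rewrite bsE; apply: (diagram_down dL Luv).
    by rewrite u0 leqnn.
  by move: yv; rewrite mem_iota; lia.
have [||p pc pE] := @config_of_diagram M i0 L dL.
- by rewrite /i0 /M; lia.
- by move=> u v /col_row[uk vk]; rewrite /i0 /M; split; lia.
have LE : L = in_shape M i0 p by apply/funext => u; apply/funext => v.
by exists p, f, g; split; rewrite // -LE.
Qed.

Theorem simple_partitions_count :
  finite_set (simple_partitions_of_weight (mnm_col m))
  /\ (shape_poly M k.+1 i0 i0 0)@_m = (ncard (simple_partitions_of_weight (mnm_col m)))%:Z.
Proof.
(* One bijection is fixed per configuration, so that equal shapes use the same one when injectivity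
   is checked; [(id, id)] is a filler elsewhere. *)
have bij p : exists PP : ((nat -> nat -> nat) -> nat -> nat -> nat) *
    ((nat -> nat -> nat) -> nat -> nat -> nat),
    config M i0 p -> hook_bijection M i0 p PP.1 PP.2.
  have [pc|npc] := pselect (config M i0 p); last by exists (id, id).
  by have [Phi [Psi PP]] := hook_bijection_exists pc; exists (Phi, Psi).
have [PP PPE] := choice bij.
pose Phi p := (PP p).1; pose Psi p := (PP p).2.
pose toP t := pyramid (in_shape M i0 (sites_of t.1))
  (Psi (sites_of t.1) (array_of t.2.1)) (Psi (sites_of t.1) (array_of t.2.2)).
have conf t : #|t.1| == i0 -> config M i0 (sites_of t.1).
  by move=> /eqP <-; exact: config_sites.
have PsiP p w : config M i0 p -> hook_array p w -> [/\ rpp (in_shape M i0 p) (Psi p w),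
    Phi p (Psi p w) = w & forall e, shape_trace M i0 e (Psi p w) = hook_trace M e w].
  move=> pc hw; have [bij1 bij2] := PPE _ pc; have [rP PhiPsi] := bij2 _ hw.
  by split=> // e; have [_ _ ->] := bij1 _ rP; rewrite PhiPsi.
have simple_shape p f g : config M i0 p -> rpp (in_shape M i0 p) f -> rpp (in_shape M i0 p) g ->
    simple_partition (pyramid (in_shape M i0 p) f g).
  move=> pc rf rg; apply: (pyramid_simple (bs := boxes M i0 p) _ rf rg).
  - exact: in_shape_diagram.
  - exact: boxes_uniq.
  - by move=> u v; exact: mem_boxes.
have toP_weight t : weighs i0 m t -> simple_partition (toP t) /\ weight (toP t) = mnm_col m.
  move=> /and4P[/conf tc h1 h2 /eqP <-].
  have [r1 _ tr1] := PsiP _ _ tc (on_hooksP _ _ h1).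
  have [r2 _ tr2] := PsiP _ _ tc (on_hooksP _ _ h2).
  split; first exact: simple_shape.
  by rewrite (pyramid_hook_weight tc r1 r2 tr1 tr2) box_mnm_sites sum_arrays.
have toP_inj : {in [pred t | weighs i0 m t] &, injective toP}.
  move=> [S [w1 w2]] [S' [w1' w2']] /and4P[/conf tc /on_hooksP h1 /on_hooksP h2 _].
  move=> /and4P[/conf tc' /on_hooksP h1' /on_hooksP h2' _] /=.
  rewrite /= in tc tc' h1 h2 h1' h2' *.
  have [r1 P1 _] := PsiP _ _ tc h1; have [r2 P2 _] := PsiP _ _ tc h2.
  have [r1' P1' _] := PsiP _ _ tc' h1'; have [r2' P2' _] := PsiP _ _ tc' h2'.
  move=> /(pyramid_inj (in_shape_diagram _ _ _) r1 r2 (in_shape_diagram _ _ _) r1' r2')[].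
  move=> /(in_shape_inj tc tc') SS E1 E2.
  have SS' := sites_of_inj SS; rewrite -SS' in E1 E2 P1' P2' *.
  congr (_, (_, _)); apply: array_of_inj.
    by rewrite -P1 E1 P1'.
  by rewrite -P2 E2 P2'.
have toP_surj P : simple_partition P -> weight P = mnm_col m ->
    exists2 t, weighs i0 m t & toP t = P.
  move=> Ps wP; have [p [f [g [pc rf rg PE]]]] := simple_pyramid_config Ps wP.
  have [bij1 _] := PPE _ pc; have [hf PsiPhif trf] := bij1 _ rf; have [hg PsiPhig trg] := bij1 _ rg.
  rewrite -/(Phi p) -/(Psi p) in hf hg PsiPhif PsiPhig trf trg.
  have := wP; rewrite PE (pyramid_hook_weight pc rf rg trf trg) => /mnm_col_inj/esym mE.
  have total a b : (Phi p f a b + Phi p g a b <= k)%N.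
    have [/and3P[_ pb ab]|nh] := boolP (hook p a b); last by rewrite hf // hg.
    by apply: (@mdeg_hook_array (fun a b => Phi p f a b + Phi p g a b)%N _ a b _ mE);
      rewrite ab pc.1.
  have big h a b : hook_array p h -> (M < maxn a b)%N -> h a b = 0%N.
    move=> hh Mab; apply: hh; apply/negP => /and3P[_ /pc.1 bM ab].
    by move: Mab; lia.
  pose S := [set s : 'I_M.+1 | p s]%SET.
  have SE : sites_of S = p by apply: sites_of_pred; exact: pc.1.
  pose fin h : arrays := [ffun ba => inord (h ba.2 ba.1)].
  have finE h : (forall a b, h a b <= k)%N -> hook_array p h -> array_of (fin h) = h.
    by move=> hk hh; apply: array_of_finfun => // a b; exact: big.
  have finf : array_of (fin (Phi p f)) = Phi p f.
    by apply: finE => // a b; apply: leq_trans (leq_addr _ _) (total a b).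
  have fing : array_of (fin (Phi p g)) = Phi p g.
    by apply: finE => // a b; apply: leq_trans (leq_addl _ _) (total a b).
  have onf : on_hooks S (fin (Phi p f)) by apply/on_hooksP; rewrite SE finf.
  have ong : on_hooks S (fin (Phi p g)) by apply/on_hooksP; rewrite SE fing.
  exists (S, (fin (Phi p f), fin (Phi p g))); last first.
    by rewrite /toP /= SE finf fing PsiPhif PsiPhig.
  apply/and4P; split=> //=.
    by have [_] := config_sites S; rewrite SE pc.2 => ->.
  by rewrite box_mnm_sites sum_arrays // SE finf fing mE.
pose s := map toP (enum [pred t | weighs i0 m t]).
have us : uniq s by rewrite map_inj_in_uniq ?enum_uniq // => t t'; rewrite !mem_enum; exact: toP_inj.
have sE P : simple_partitions_of_weight (mnm_col m) P <-> P \in s.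
  split=> [[Ps wP]|/mapP[t]].
    by have [t tw <-] := toP_surj P Ps wP; apply: map_f; rewrite mem_enum.
  by rewrite mem_enum => /toP_weight tP ->.
split; last by rewrite shape_poly_coeff (ncard_seq us sE) size_map -cardE.
have -> : simple_partitions_of_weight (mnm_col m) = [set` s].
  by apply/seteqP; split=> P /sE.
exact: finite_seq.
Qed.

End SimpleCount.

Theorem proposition5p5 :
  exists F : nat -> {mpoly int[4]},
    [/\ forall k : nat, (1 <= k)%N -> tofrac (F k) = cluster_var k,
        forall b : 'cV[int]_4, finite_set (simple_partitions_of_weight b)
      & forall b : 'cV[int]_4, exists N : nat, forall k : nat, (N <= k)%N ->
          stable_coeff k (F k) b = (ncard (simple_partitions_of_weight b))%:Z].
Proof.
have [F [FE Fcoeff]] := stable_coeff_cluster.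
(* Weights are non-negative, so no partition attains the other exponent vectors; the stable
   coefficients vanish there as well. *)
have no_partition b : (forall m, b != mnm_col m) -> simple_partitions_of_weight b = set0.
  move=> nb; apply/seteqP; split=> // P [_ wP].
  case/negP: (nb [multinom `|weight P i ord0|%N | i < 4]); rewrite -wP.
  by apply/eqP/colP => i; rewrite !mxE mnmE mxE.
exists F; split=> // b; have [[m ->]|nb] := pselect (exists m, b = mnm_col m).
- by have [] := simple_partitions_count (leqnn (mdeg m)).
- by rewrite no_partition // => m; apply/eqP => bm; apply: nb; exists m.
(* The degree of [m] suffices for the comparison; the additional one ensures [1 <= k]. *)
- exists (mdeg m).+1 => k mk.
  have [A [B [ones rec coeffm _]]] := Fcoeff k (leq_trans (ltn0Sn _) mk).
  rewrite coeffm (stable_limit ones rec (ltnW mk)).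
  by have [_ ->] := simple_partitions_count (ltnW mk).
have nb' m : b != mnm_col m by apply/eqP => bm; apply: nb; exists m.
exists 1%N => k k1; have [A [B [_ _ _ coeff0]]] := Fcoeff k k1.
by rewrite coeff0 // no_partition // /ncard fset_set0.
Qed.
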